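(* Fix $\alpha\in(0,1)$. Let $\mathcal P$ be a class of probability measures for the distribution of the data such that, in the many approximate means setting described in the context, Conditions M and A are satisfied with the same $B_n$, $\delta_n$ and $\beta_n$ for all $P\in\mathcal P$, and assume that $(2\sqrt2)^3B_n\log^{3/2}(pn)/\sqrt n\le\delta_n$ for all $n\ge1$. Then both the Bonferroni and the Bonferroni-Holm procedures (described in the context) have strong control of the family-wise error rate, i.e., as $n\to\infty$, $$\sup_{w\subset\{1,\dots,p\}}\ \sup_{P\in\mathcal P^w}\Pr_P\big\{\text{reject at least one }H_j\text{ for }j\in w\big\}\le\alpha+o(1).$$
   Context: Many approximate means setting (for each $n$; all objects, including $p$ and $\mathcal P$, may depend on $n$). Let $[k]=\{1,\dots,k\}$. For each $P\in\mathcal P$, $\theta_0=\theta_0(P)\in\mathbb R^p$ is a parameter and $\hat\theta$ is an estimator with $$\sqrt n(\hat\theta-\theta_0)=\frac1{\sqrt n}\sum_{i=1}^n Z_i+r_n,$$ where under $P$ the vectors $Z_i=(Z_{i1},\dots,Z_{ip})'$, $i\in[n]$, are independent zero-mean random vectors in $\mathbb R^p$ and $r_n=(r_{n1},\dots,r_{np})'$ is a random vector. $\hat Z_1,\dots,\hat Z_n$ are random vectors in $\mathbb R^p$ computed from the data (estimators of the $Z_i$). $\mathbb E_n[a_i]=n^{-1}\sum_{i=1}^n a_i$. $(B_n),(\delta_n),(\beta_n)$ are sequences with $B_n\ge1$, $\delta_n\searrow0$, $\beta_n\searrow0$. $\Phi$ is the standard normal cdf. Condition M: (i) $n^{-1}\sum_{i=1}^n\mathrm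 E[Z_{ij}^2]\ge1$ for all $j\in[p]$; (ii) $n^{-1}\sum_{i=1}^n\mathrm E[|Z_{ij}|^{2+k}]\le B_n^k$ for all $j\in[p]$ and $k=1,2$. Condition A: (i) $\Pr(\max_{j\in[p]}|r_{nj}|>\delta_n/\log^{1/2}(pn))\le\beta_n$; (ii) $\Pr(\max_{j\in[p]}\mathbb E_n[(\hat Z_{ij}-Z_{ij})^2]>\delta_n^2/\log^2(pn))\le\beta_n$. Hypotheses: for given values $\bar\theta_{0j}$, $j\in[p]$, test $H_j:\theta_{0j}\le\bar\theta_{0j}$ against $H_j':\theta_{0j}>\bar\theta_{0j}$ simultaneously. $\mathcal P_j\subset\mathcal P$ is the set of $P$ for which $H_j$ is true, and for $w\subset\{1,\dots,p\}$, $\mathcal P^w=(\cap_{j\in w}\mathcal P_j)\cap(\cap_{j\notin w}(\mathcal P\setminus\mathcal P_j))$. $\Pr_P$ is probability under $P$. $t$-statistics: $t_j=\sqrt n(\hat\theta_j-\bar\theta_{0j})/(\mathbb E_n[\hat Z_{ij}^2])^{1/2}$. Bonferroni procedure: reject $H_j$ iff $t_j>\Phi^{-1}(1-\alpha/p)$. Bonferroni-Holm procedure: the stepdown procedure with critical values $c_{1-\alpha,w}=\Phi^{-1}(1-\alpha/|w|)$, $w\subset\{1,\dots,p\}$: set $w(1)=\{1,\dots,p\}$; at step $l\ge1$ reject all $H_j$, $j\in w(l)$, with $t_j>c_{1-\alpha,w(l)}$; if no hypothesis is rejected at step $l$, stop; otherwise let $w(l+1)$ be the set of $j\in w(l)$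 whose hypotheses were not rejected and proceed to step $l+1$. *)

(* Defs.v *)
From HB Require Import structures.
From mathcomp Require Import all_boot all_order all_algebra.
From mathcomp Require Import all_classical all_reals all_analysis.

Set Implicit Arguments.
Unset Strict Implicit.
Unset Printing Implicit Defensive.

Import Order.TTheory GRing.Theory Num.Theory.
Import numFieldNormedType.Exports.

Local Open Scope classical_set_scope.
Local Open Scope ring_scope.

(* Vectors of R^p are p.-tuple R, which the library equips with the product
   sigma-algebra; indices range over {0, ..., p-1}. *)

Section normal_quantile.
Variable R : realType.

Definition Phi (x : R) : R := fine (normal_prob 0 1 `]-oo, x]).

(* Phi is a bijection from R onto ]0, 1[, so for u in ]0, 1[ the choice below
   is the only one; outside of ]0, 1[ the value is 0. *)
Definition Phi_inv (u : R) : R := xget 0 [set x | Phi x = u].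

End normal_quantile.

Definition mutually_independent d d' (T : measurableType d)
    (T' : measurableType d') (R : realType) (P : probability T R) (n : nat)
    (X : 'I_n -> {RV P >-> T'}) : Prop :=
  forall (J : {set 'I_n}) (A : 'I_n -> set T'),
    (forall i, measurable (A i)) ->
    P (\bigcap_(i in [set` J]) (X i @^-1` A i)) =
    (\prod_(i in J) P (X i @^-1` A i))%E.

Definition emp_mean (R : realType) (n : nat) (a : 'I_n -> R) : R :=
  n%:R^-1 * \sum_(i < n) a i.

(* The maximum is taken with 0, which changes nothing for nonnegative a and
   p > 0. *)
Definition max_coord (R : realType) (p : nat) (a : 'I_p -> R) : R :=
  \big[Num.max/0]_(j < p) a j.

Definition decreases_to0 (R : realType) (u : R^nat) : Prop :=
  (forall m n : nat, (0 < m)%N -> (m <= n)%N -> u n <= u m) /\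
  u @ \oo --> (0 : R).

Section many_approximate_means.
Context d (Omega : measurableType d) (R : realType) (n p : nat).

Definition approximate_means (P : probability Omega R) (theta0 : p.-tuple R)
    (thetahat : {mfun Omega >-> p.-tuple R})
    (Z : 'I_n -> {RV P >-> p.-tuple R}) (r : {RV P >-> p.-tuple R}) : Prop :=
  [/\ mutually_independent Z,
      forall i j, 'E_P[fun x => tnth (Z i x) j]%E = 0%E
    & forall x j,
        Num.sqrt n%:R * (tnth (thetahat x) j - tnth theta0 j) =
        (Num.sqrt n%:R)^-1 * \sum_(i < n) tnth (Z i x) j + tnth (r x) j].

Definition condition_M (P : probability Omega R)
    (Z : 'I_n -> {RV P >-> p.-tuple R}) (B : R) : Prop :=
  (forall j,
     (1 <= (n%:R^-1)%:E *
           \sum_(i < n) 'E_P[fun x => (tnth (Z i x) j ^+ 2)%R])%E) /\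
  (forall j k, k = 1%N \/ k = 2%N ->
     ((n%:R^-1)%:E * \sum_(i < n) 'E_P[fun x => (`|tnth (Z i x) j| ^+ (2 + k))%R]
      <= (B ^+ k)%:E)%E).

(* When p * n = 1 the logarithm vanishes and both thresholds are infinite, so
   that the condition is void. *)
Definition condition_A (P : probability Omega R)
    (Z : 'I_n -> {RV P >-> p.-tuple R})
    (Zhat : 'I_n -> {mfun Omega >-> p.-tuple R}) (r : {RV P >-> p.-tuple R})
    (delta beta : R) : Prop :=
  (1 < p * n)%N ->
  (P [set x | (max_coord (fun j => `|tnth (r x) j|) >
               delta / Num.sqrt (ln (p * n)%:R))%R] <= beta%:E)%E /\
  (P [set x | (max_coord (fun j =>
                 emp_mean (fun i => (tnth (Zhat i x) j - tnth (Z i x) j) ^+ 2)) >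
               delta ^+ 2 / ln (p * n)%:R ^+ 2)%R] <= beta%:E)%E.

(* A vanishing denominator gives the value 0. *)
Definition t_stat (thetahat : {mfun Omega >-> p.-tuple R})
    (thetabar : p.-tuple R) (Zhat : 'I_n -> {mfun Omega >-> p.-tuple R})
    (x : Omega) (j : 'I_p) : R :=
  Num.sqrt n%:R * (tnth (thetahat x) j - tnth thetabar j) /
  Num.sqrt (emp_mean (fun i => (tnth (Zhat i x) j) ^+ 2)).

End many_approximate_means.

Section multiple_testing.
Context (R : realType) (p : nat).

(* A testing procedure maps the vector of t-statistics to the set of rejected
   hypotheses. *)
Definition procedure := ('I_p -> R) -> set 'I_p.

Definition bonferroni (alpha : R) : procedure :=
  fun t => [set j | t j > Phi_inv (1 - alpha / p%:R)].

(* The sets w(1), w(2), ... of the stepdown procedure, numbered from 0.  If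
   nothing is rejected at step l then w(l + 1) = w(l) and nothing is rejected
   later, so the stopping rule needs no separate encoding. *)
Fixpoint stepdown_set (c : {set 'I_p} -> R) (t : 'I_p -> R) (l : nat) :
    {set 'I_p} :=
  if l is l'.+1 then
    let w := stepdown_set c t l' in [set j in w | ~~ (t j > c w)]%SET
  else [set: 'I_p]%SET.

Definition stepdown (c : {set 'I_p} -> R) : procedure :=
  fun t => [set j | exists l : nat,
    j \in stepdown_set c t l /\ t j > c (stepdown_set c t l)].

Definition bonferroni_holm (alpha : R) : procedure :=
  stepdown (fun w => Phi_inv (1 - alpha / #|w|%:R)).

Context d (Omega : measurableType d).

Definition null_class (Pc : set (probability Omega R))
    (theta0 : probability Omega R -> p.-tuple R) (thetabar : p.-tuple R)
    (j : 'I_p) : set (probability Omega R) :=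
  [set P | Pc P /\ tnth (theta0 P) j <= tnth thetabar j].

Definition true_null_class (Pc : set (probability Omega R))
    (theta0 : probability Omega R -> p.-tuple R) (thetabar : p.-tuple R)
    (w : {set 'I_p}) : set (probability Omega R) :=
  (\bigcap_(j in [set` w]) null_class Pc theta0 thetabar j) `&`
  (\bigcap_(j in ~` [set` w]) (Pc `\` null_class Pc theta0 thetabar j)).

Definition sup_fwer (Pc : set (probability Omega R))
    (theta0 : probability Omega R -> p.-tuple R) (thetabar : p.-tuple R)
    (t : Omega -> 'I_p -> R) (proc : procedure) : \bar R :=
  ereal_sup [set ereal_sup
    [set P [set x | exists2 j, j \in w & proc (t x) j]
      | P in true_null_class Pc theta0 thetabar w] | w in [set: {set 'I_p}]].

End multiple_testing.

(* u_n <= alpha + o(1) as n tends to infinity. *)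
Definition le_add_o1 (R : realType) (u : nat -> \bar R) (alpha : R) : Prop :=
  exists2 e : R^nat, e @ \oo --> (0 : R) &
    forall n : nat, (0 < n)%N -> (u n <= (alpha + e n)%:E)%E.

(* Main.v *)
Require Import Defs.
From HB Require Import structures.
From mathcomp Require Import all_boot all_order all_algebra.
From mathcomp Require Import all_classical all_reals all_analysis.
From mathcomp Require Import measurable_realfun ring lra.

Set Implicit Arguments.
Unset Strict Implicit.
Unset Printing Implicit Defensive.

Import Order.TTheory GRing.Theory Num.Theory.
Import numFieldNormedType.Exports.

Local Open Scope classical_set_scope.
Local Open Scope ring_scope.

(** Why the theorem holds.

    Reduction to one coordinate.  Let w be the set of true nulls.  A false
    rejection forces some t_j, j in w, above the quantile
    x = Phi_inv (1 - alpha / k), where k = p for the Bonferroni procedure and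
    k = #|w| for the stepdown one: at the first step that rejects a true null
    the working set still contains w, so that its critical value is at least
    the one of w (stepdown_reject_true_null).  By the union bound over the at
    most k elements of w it is enough that every true null is rejected with
    probability at most (1 + eps) * (alpha / k) + 1 / (p n), up to the two
    exceptional events of condition A.  Since p may grow exponentially in a
    power of n, x may be as large as sqrt (log (p n)), and an additive normal
    approximation would be useless: what is needed is a moderate deviation
    bound with a multiplicative error for the self-normalized sum S / V,
    where S is the sum of the Z_ij over i and V ^+ 2 the sum of their squares
    (studentized_tail, specialised to a coordinate in coordinate_tail).

    The moderate deviation bound.  Rescale the summands so that their
    variances add up to lam ^+ 2 with lam = K * (1 + |x|) and K a large
    constant.  At this scale 1 is the threshold between small and large terms
    and an error O(1) in S is negligible: the Gaussian density varies only by
    a factor 1 + O(1 / K) over the corresponding distance O(1 / lam).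

    (a) Self-normalization is removed by a deterministic inclusion.  Suppose
    that x V - 1 / 2 <= S with x >= 0, and let N be the number of terms larger
    than 1 in absolute value.  By Cauchy-Schwarz the large terms add to S at
    most what they add to x V, plus N / x times the root of the sum of the
    small squares (truncated_lower).  Since that root is about lam, and lam / x
    is at most 2 K when x >= 1, the event is contained in the event that the
    sum in which every large term is replaced by the constant 2 K exceeds
    lam * x - c, unless N > x ^+ 2 or the sum of the small squares is abnormally small
    (studentized_inclusion_nonneg).  Both exceptional events are handled with
    exponential moments (exceedance_tail, truncated_squares_lower).  When x is
    negative, but bounded from below, it suffices that with high probability
    N = 0 and V is close to lam (studentized_inclusion_neg,
    sum_squares_chebyshev).

    (b) The tail of the modified sum is bounded by the expectation of a
    logistic function at the same scale, to which Lindeberg's replacement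
    argument is applied.  The first three derivatives of the logistic function
    are bounded by multiples of the function itself; hence replacing one
    summand by a Gaussian variable costs a factor 1 + O(E |X_i| ^+ 3), and not
    an additive error (replacement_step).  The product of the factors is
    exp (O(sum of E |X_i| ^+ 3)), which tends to 1.  Only an upper bound is
    wanted, so that the large terms may be replaced by any constant: on them
    1 <= |X_i| ^+ 3.  The resulting Gaussian expectation is
    (1 + O(1 / K)) * (1 - Phi x) (heat_upper); together this gives
    moderate_deviation.

    Asymptotics.  The quantile satisfies 1 + |x| = O(sqrt (log (p n)))
    (quantile_growth).  By the growth condition the sum of third moments,
    the noise from r and from Zhat - Z at scale lam, and the exponent of the
    exceptional probabilities are then controlled by delta
    (growth_consequences), which gives the bound of fwer_bound uniformly
    in P and w. *)

(** * Sums of independent variables, one term at a time *)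

Section independence.
Context d (T : measurableType d) (R : realType) (P : probability T R).
Local Open Scope ereal_scope.

(** Conditioning on an event E that is independent of the pair (U, V) keeps the
    product law.  E is later the event fixed by the terms that follow; with
    E = setT this is the joint law of two independent variables. *)
Lemma restr_joint_law (U V : {mfun T >-> R}) (E : set T) :
  measurable E ->
  (forall A B, measurable A -> measurable B ->
     P (U @^-1` A `&` V @^-1` B `&` E) = P (U @^-1` A) * P (V @^-1` B) * P E) ->
  forall C, measurable C ->
    P ([set t | C (U t, V t)] `&` E) =
    P E * (distribution P U \x distribution P V) C.
Proof.
move=> mE H C mC.
have PE0 : (0 <= fine (P E))%R by rewrite fine_ge0.
pose c := NngNum PE0.
pose m1 := mscale c (distribution P U).
have mUV : measurable_fun setT (fun t => (U t, V t)).
  exact: measurable_fun_pair.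
pose m' :=
  measure_function_pushforward__canonical__measure_function_Measure (mrestr P mE) mUV.
have := @product_measure_unique _ _ _ _ R m1 (distribution P V) m' _ C mC.
rewrite /m' /= /pushforward /mrestr /= => <-.
  rewrite /product_measure1 ge0_integral_mscale//=; first by rewrite fineK// fin_num_measure.
  exact: measurable_fun_xsection.
move=> A B mA mB; rewrite [X in P (X `&` _)](_ : _ = U @^-1` A `&` V @^-1` B)//.
by rewrite H// /m1 /mscale/= fineK ?fin_num_measure// muleC muleA.
Qed.

Definition psum (X : nat -> {mfun T >-> R}) (k : nat) (t : T) : R :=
  \sum_(i < k) X i t.

Lemma measurable_psum X k : measurable_fun setT (psum X k).
Proof. by apply: measurable_sum => i. Qed.

HB.instance Definition _ X k := isMeasurableFun.Build _ _ _ _ _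
  (measurable_psum X k).

Lemma psumS X k t : psum X k.+1 t = (psum X k t + X k t)%R.
Proof. by rewrite /psum big_ord_recr. Qed.

(** Sequences indexed by nat, of which only the first n terms count, make it
    possible to peel off the terms by induction.  Sets A i = setT recover the
    product rule for subfamilies. *)
Definition independent_upto (n : nat) (X : nat -> {mfun T >-> R}) :=
  forall A : nat -> set R, (forall i, measurable (A i)) ->
    P (\big[setI/setT]_(i < n) (X i @^-1` A i)) =
    \prod_(i < n) P (X i @^-1` A i).

Lemma measurable_addset (D : set R) : measurable D ->
  measurable [set z : R * R | D (z.1 + z.2)%R].
Proof.
move=> mD; rewrite -[X in measurable X]setTI.
have : measurable_fun setT (fun z : R * R => (z.1 + z.2)%R) by exact: measurable_funD.
by apply.
Qed.

(** Mutual independence is stated on rectangles.  Each step of the induction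
    extends it from the pair (psum X k, X k) to sets of the form
    (psum X k.+1 in D) by uniqueness of the product measure. *)
Lemma psum_independent n X : independent_upto n X ->
  forall k, (k <= n)%N -> forall D A, measurable D ->
    (forall i, measurable (A i)) ->
  P (psum X k @^-1` D `&` \big[setI/setT]_(k <= i < n) (X i @^-1` A i)) =
  P (psum X k @^-1` D) * \prod_(k <= i < n) P (X i @^-1` A i).
Proof.
move=> indX; elim=> [_ D A mD mA|k IH kn D A mD mA].
  have [D0|D0] := pselect (D 0%R).
    rewrite (_ : _ @^-1` D = setT); last first.
      by apply/seteqP; split => // t _; rewrite /preimage/= /psum big_ord0.
    rewrite setTI probability_setT mul1e !big_mkord; exact: indX.
  rewrite (_ : _ @^-1` D = set0) ?set0I ?measure0 ?mul0e//.
  by apply/seteqP; split => // t; rewrite /preimage/= /psum big_ord0.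
(* E is the event of the terms after X k; taking A k arbitrary in the induction
   hypothesis makes it independent of the pair (psum X k, X k). *)
pose E := \big[setI/setT]_(k.+1 <= i < n) (X i @^-1` A i).
have mE : measurable E.
  by apply: bigsetI_measurable => i _; rewrite -[X in measurable X]setTI; apply: measurable_funP.
have step B C : measurable B -> measurable C ->
    P (psum X k @^-1` B `&` X k @^-1` C `&` E) =
    P (psum X k @^-1` B) * P (X k @^-1` C) * \prod_(k.+1 <= i < n) P (X i @^-1` A i).
  move=> mB mC.
  pose A' i := if i == k then C else A i.
  have := IH (ltnW kn) B A' mB; rewrite !(big_ltn kn).
  have big1' : \big[setI/setT]_(k.+1 <= i < n) (X i @^-1` A' i) = E.
    apply: eq_big_nat => i /andP[ki _]; rewrite /A'.
    by rewrite gtn_eqF.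
  have big2' : \prod_(k.+1 <= i < n) P (X i @^-1` A' i) =
               \prod_(k.+1 <= i < n) P (X i @^-1` A i).
    apply: eq_big_nat => i /andP[ki _]; rewrite /A'.
    by rewrite gtn_eqF.
  have A'k : A' k = C by rewrite /A' eqxx.
  rewrite big1' big2' A'k setIA muleA; apply => i.
  by rewrite /A'; case: ifP.
have PE : P E = \prod_(k.+1 <= i < n) P (X i @^-1` A i).
  have := step setT setT measurableT measurableT.
  by rewrite !preimage_setT !setTI probability_setT !mul1e.
have mC : measurable [set z : R * R | D (z.1 + z.2)%R] by exact: measurable_addset.
have st B C mB mC' := etrans (step B C mB mC') (congr1 _ (esym PE)).
have H1 := restr_joint_law mE st mC.
have H2 := @restr_joint_law (psum X k) (X k) setT measurableT _ _ mC.
have SE : psum X k.+1 @^-1` D = [set t | D (psum X k t + X k t)%R].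
  by apply/seteqP; split => t; rewrite /preimage/= psumS.
rewrite SE -/E H1 -PE muleC; congr (_ * _).
rewrite -[LHS]mul1e -(probability_setT P) -H2 ?setIT// => B C mB mC'.
rewrite setIT probability_setT mule1.
pose A' i := if i == k then C else setT.
have A'k : A' k = C by rewrite /A' eqxx.
have := IH (ltnW kn) B A' mB; rewrite !(big_ltn kn) /= A'k.
rewrite big_nat [X in _ `&` (_ `&` X)]big1 ?setIT; last first.
  by move=> i /andP[ki _]; rewrite /A' gtn_eqF ?preimage_setT.
rewrite big_nat [X in _ * (_ * X)]big1 ?mule1; last first.
  by move=> i /andP[ki _]; rewrite /A' gtn_eqF ?preimage_setT ?probability_setT.
by apply => i; rewrite /A'; case: ifP.
Qed.

Lemma integral_psum_next n X k (g : R -> R -> \bar R) :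
  independent_upto n X -> (k < n)%N ->
  measurable_fun setT (fun z : R * R => g z.1 z.2) ->
  (forall x y, 0 <= g x y) ->
  \int[P]_t g (psum X k t) (X k t) =
  \int[P]_s \int[P]_t g (psum X k s) (X k t).
Proof.
move=> indX kn mg g0.
have mUV : measurable_fun setT (fun t => (psum X k t, X k t)).
  exact: measurable_fun_pair.
have mg1 x : measurable_fun setT (fun y => g x y).
  apply: (@measurableT_comp _ _ _ _ _ _ (fun z : R * R => g z.1 z.2) _ (pair x)) => //.
transitivity (\int[distribution P (psum X k) \x distribution P (X k)]_z g z.1 z.2).
  transitivity (\int[pushforward P (fun t => (psum X k t, X k t))]_z g z.1 z.2).
    by rewrite ge0_integral_pushforward.
  apply: eq_measure_integral => C mC _.
  rewrite /= /pushforward.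
  have := @restr_joint_law (psum X k) (X k) setT measurableT _ _ mC.
  rewrite setIT [P setT]probability_setT mul1e.
  move=> -> // A B mA mB; rewrite setIT mule1.
  pose A' i := if i == k then B else setT.
  have := psum_independent indX (ltnW kn) (A := A') mA.
  have A'k : A' k = B by rewrite /A' eqxx.
  rewrite !(big_ltn kn) /= A'k.
  rewrite big_nat [X in _ `&` (_ `&` X)]big1 ?setIT; last first.
    by move=> i /andP[ki _]; rewrite /A' gtn_eqF ?preimage_setT.
  rewrite big_nat [X in _ * (_ * X)]big1 ?mule1; last first.
    by move=> i /andP[ki _]; rewrite /A' gtn_eqF ?preimage_setT ?probability_setT.
  by apply => i; rewrite /A'; case: ifP.
rewrite fubini_tonelli1//= /fubini_F ge0_integral_distribution//=; last 2 first.
- apply: (@measurable_fun_fubini_tonelli_F _ _ _ _ _ (distribution P (X k))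
    (fun z : R * R => g z.1 z.2)) => //= z; exact: g0.
- by move=> y; exact: integral_ge0.
apply: eq_integral => s _ /=.
by rewrite ge0_integral_distribution.
Qed.

(** The engine of all probabilistic bounds below.  If F k.+1, averaged over the
    law of X k, is at most c k times F k, then the errors c k multiply along
    the sum.  It serves for Lindeberg replacement (F k is a Gaussian smoothing
    of the test function by the terms that remain), for exponential moments
    and for second moments. *)
Lemma telescoping n X (F : nat -> R -> \bar R) (c : nat -> R) :
  independent_upto n X ->
  (forall k, measurable_fun setT (F k)) -> (forall k x, 0 <= F k x) ->
  (forall k, (0 <= c k)%R) ->
  (forall k w, (k < n)%N ->
     \int[P]_t F k.+1 (w + X k t)%R <= (c k)%:E * F k w) ->
  \int[P]_t F n (psum X n t) <= (\prod_(k < n) c k)%:E * F 0%N 0%R.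
Proof.
move=> indX mF F0 c0 step.
suff: forall k, (k <= n)%N ->
    \int[P]_t F k (psum X k t) <= (\prod_(i < k) c i)%:E * F 0%N 0%R.
  by apply.
elim=> [_|k IH kn].
  rewrite big_ord0 mul1e.
  under eq_integral do rewrite /psum big_ord0.
  by rewrite integral_cst// [X in _ * X]probability_setT mule1.
have mF2 : measurable_fun setT (fun z : R * R => F k.+1 (z.1 + z.2)%R).
  by apply: measurableT_comp => //; exact: measurable_funD.
under eq_integral do rewrite psumS.
rewrite (@integral_psum_next n X k (fun x y => F k.+1 (x + y)%R))//.
have mG : measurable_fun setT (fun x : R => \int[P]_t F k.+1 (x + X k t)%R).
  apply: (@measurable_fun_fubini_tonelli_F _ _ _ _ _ P
    (fun z : R * T => F k.+1 (z.1 + X k z.2)%R)) => //.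
  apply: measurableT_comp => //; apply: measurable_funD => //.
  exact: measurableT_comp.
apply: (@le_trans _ _ (\int[P]_s ((c k)%:E * F k (psum X k s)))).
  apply: ge0_le_integral => //.
  - by move=> s _; exact: integral_ge0.
  - exact: (measurableT_comp mG (measurable_psum X k)).
  - apply: measurable_funeM; exact: measurableT_comp.
  - by move=> s _; exact: step.
rewrite ge0_integralZl//; last 2 first.
- exact: measurableT_comp.
- by rewrite lee_fin.
rewrite big_ord_recr/= mulrC EFinM -muleA lee_wpmul2l ?lee_fin//.
exact/IH/ltnW.
Qed.

End independence.

(** * The Gaussian semigroup *)

Section gaussian.
Context (R : realType).
Local Notation mu := (@lebesgue_measure R).
Local Notation phi := (@normal_pdf R 0 1).
Implicit Types (x w z a b c : R).

Lemma phiE z : phi z = normal_peak 1 * expR (- z ^+ 2 / 2).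
Proof.
by rewrite normal_pdfE ?oner_neq0// /normal_fun subr0 expr1n.
Qed.

Lemma phi_ge0 z : 0 <= phi z.
Proof. exact: normal_pdf_ge0. Qed.

Lemma phi_gt0 z : 0 < phi z.
Proof. by rewrite phiE mulr_gt0 ?expR_gt0// normal_peak_gt0// oner_neq0. Qed.

Lemma continuous_phi : continuous phi.
Proof. by apply: continuous_normal_pdf; rewrite oner_neq0. Qed.

Lemma measurable_phi : measurable_fun setT phi.
Proof. exact: measurable_normal_pdf. Qed.

Lemma integral_phi : (\int[mu]_z (phi z)%:E = 1)%E.
Proof. exact: integral_normal_pdf. Qed.

Lemma integral_affine (G : R -> R) a b : 0 < a -> continuous G ->
  (forall x, 0 <= G x) ->
  (\int[mu]_x (G x)%:E = \int[mu]_x (G (a * x + b) * a)%:E)%E.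
Proof.
move=> a0 cG G0.
pose F (x : R^o) : R^o := a * x + b.
have dF x : is_derive (x : R^o) (1 : R^o) F a.
  by apply: is_derive_eq; rewrite addr0 /GRing.scale/= mulr1.
have F'E : F^`()%classic = cst a.
  by apply/funext => x; rewrite derive1E; apply: derive_val.
rewrite (@increasing_ge0_integration_by_substitutionT R F G) ?F'E//.
- by move=> x y xy; rewrite /F ltrD2r ltr_pM2l.
- by move=> x; exact: cvg_cst.
- exact: is_cvg_cst.
- exact: is_cvg_cst.
- apply: (@cvg_comp _ _ _ (fun x => a * x) (fun x => x + b)).
    by apply: gt0_cvgMrNy => //; exact: cvg_id.
  exact: cvg_addrr_Ny.
- apply: (@cvg_comp _ _ _ (fun x => a * x) (fun x => x + b)).
    by apply: gt0_cvgMry => //; exact: cvg_id.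
  exact: cvg_addrr.
Qed.

(** Completing the square turns the tilted density into normal_pdf t 1. *)
Lemma integral_mgf t : (\int[mu]_z (expR (t * z) * phi z)%:E = (expR (t ^+ 2 / 2))%:E)%E.
Proof.
transitivity (\int[mu]_z ((expR (t ^+ 2 / 2))%:E * (normal_pdf t 1 z)%:E))%E.
  apply: eq_integral => z _; rewrite -EFinM; congr EFin.
  rewrite phiE normal_pdfE ?oner_neq0// /normal_fun expr1n mulrCA [RHS]mulrCA.
  by congr (_ * _); rewrite -!expRD; congr expR; field.
rewrite ge0_integralZl//=.
- by rewrite integral_normal_pdf mule1.
- by apply/measurable_EFinP; exact: measurable_normal_pdf.
- by move=> z _; rewrite lee_fin normal_pdf_ge0.
Qed.

(** The expectation of h (w + s z) for z standard normal: the heat semigroup,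
    parametrised by the standard deviation s instead of the time. *)
Definition heat (s : R) (h : R -> R) (w : R) : \bar R :=
  (\int[mu]_z (h (w + s * z) * phi z)%:E)%E.

Lemma measurable_heat (s : R) (h : R -> R) : measurable_fun setT h -> (forall x, 0 <= h x) ->
  measurable_fun setT (heat s h).
Proof.
move=> mh h0.
apply: (@measurable_fun_fubini_tonelli_F _ _ _ _ _ mu
  (fun z : R * R => (h (z.1 + s * z.2) * phi z.2)%:E)) => //=.
- apply/measurable_EFinP; apply: measurable_funM.
    apply: measurableT_comp => //; apply: measurable_funD => //.
    exact: measurable_funM.
  by apply: (measurableT_comp measurable_phi).
- by move=> z; rewrite lee_fin mulr_ge0// phi_ge0.
Qed.

Lemma heat_ge0 (s : R) (h : R -> R) w : (forall x, 0 <= h x) -> (0 <= heat s h w)%E.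
Proof. by move=> h0; apply: integral_ge0 => z _; rewrite lee_fin mulr_ge0// phi_ge0. Qed.

Lemma heat0 (h : R -> R) w : (forall x, 0 <= h x) -> heat 0 h w = (h w)%:E.
Proof.
move=> h0; rewrite /heat.
under eq_integral do rewrite mul0r addr0 EFinM.
rewrite ge0_integralZl//= ?integral_phi ?mule1 ?lee_fin//.
- by apply/measurable_EFinP; exact: measurable_phi.
- by move=> z _; rewrite lee_fin phi_ge0.
Qed.

Lemma continuous_affine a b : continuous (fun x : R => a * x + b).
Proof.
move=> x; apply: (@continuousD _ R^o R^o); last exact: cvg_cst.
by apply: (@continuousM _ R^o); [exact: cvg_cst|exact: cvg_id].
Qed.

(** The semigroup property, i.e., independent Gaussian variances add.  It rests
    on rotation invariance: substituting x = (c / b) u - (a / b) z in the inner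
    integral turns the exponent z ^+ 2 + x ^+ 2 into u ^+ 2 + y ^+ 2 with
    y = (c / b) z - (a / b) u, and after Fubini the variable y integrates
    out. *)
Lemma heat_heat a b c (h : R -> R) w : 0 <= a -> 0 <= b -> 0 <= c ->
  a ^+ 2 + b ^+ 2 = c ^+ 2 -> continuous h -> (forall x, 0 <= h x) ->
  (\int[mu]_z (heat b h (w + a * z) * (phi z)%:E) = heat c h w)%E.
Proof.
move=> a0 b0 c0 abc ch h0.
move: b0; rewrite le_eqVlt => /predU1P[b0|b0].
  have ac : a = c.
    by apply/eqP; rewrite -(@eqrXn2 _ 2%N)// -abc -b0 expr0n/= addr0.
  rewrite -b0; under eq_integral do rewrite heat0//.
  by rewrite ac.
have {}c0 : 0 < c.
  rewrite lt_neqAle c0 andbT eq_sym; apply/eqP => c00; move: abc.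
  rewrite c00 expr0n/= => /eqP; rewrite paddr_eq0 ?sqr_ge0// => /andP[_].
  by rewrite sqrf_eq0 gt_eqF.
have mh : measurable_fun setT h by exact: continuous_measurable_fun.
pose k (z : R * R) : R :=
  h (w + c * z.2) * phi z.2 * (phi (c / b * z.1 + - (a / b * z.2)) * (c / b)).
have cb0 : 0 < c / b by rewrite divr_gt0.
have k0 (z : R * R) : 0 <= k z by rewrite /k !mulr_ge0 ?phi_ge0 ?invr_ge0// ltW//.
have mk : measurable_fun setT k.
  apply: measurable_funM; apply: measurable_funM => //.
  - apply: measurableT_comp => //; apply: measurable_funD => //.
    exact: measurable_funM.
  - exact: (measurableT_comp measurable_phi).
  - apply: (measurableT_comp measurable_phi); apply: measurable_funD.
      exact: measurable_funM.
    by apply: measurable_funN; exact: measurable_funM.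
transitivity (\int[mu]_z \int[mu]_u (k (z, u))%:E)%E.
  apply: eq_integral => z _.
  have cwb : continuous (fun x : R => w + a * z + b * x).
    rewrite (_ : (fun x => _) = (fun x => b * x + (w + a * z))).
      exact: continuous_affine.
    by apply/funext => x; rewrite addrC.
  have cG : continuous (fun x => h (w + a * z + b * x) * phi x).
    move=> x; apply: (@continuousM _ R^o); last exact: continuous_phi.
    apply: (@continuous_comp _ _ _ (fun x => w + a * z + b * x) h); last exact: ch.
    exact: cwb.
  rewrite /heat (integral_affine (- (a / b * z)) cb0 cG); last first.
    by move=> x; rewrite mulr_ge0// phi_ge0.
  rewrite -ge0_integralZr//=; last 3 first.
  - apply/measurable_EFinP; apply: measurable_funM => //.
    apply: (@measurableT_comp _ _ _ _ _ _ (fun x => h (w + a * z + b * x) * phi x)).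
      exact: continuous_measurable_fun.
    by apply: continuous_measurable_fun; exact: continuous_affine.
  - by move=> x _; rewrite lee_fin !mulr_ge0 ?phi_ge0 ?invr_ge0// ltW//.
  - by rewrite lee_fin phi_ge0.
  apply: eq_integral => u _; rewrite -EFinM /k/=; congr EFin.
  have -> : w + a * z + b * (c / b * u - a / b * z) = w + c * u.
    by field; rewrite gt_eqF.
  set A := c / b * u - a / b * z; set B := c / b * z - a / b * u.
  suff E : phi A * phi z = phi u * phi B.
    transitivity (h (w + c * u) * (c / b) * (phi A * phi z)); first by ring.
    by rewrite E; ring.
  rewrite !phiE mulrACA [RHS]mulrACA; congr (_ * _); rewrite -!expRD; congr expR.
  rewrite -!mulrDl -!opprD; congr (- _ / _).
  have bb : b ^+ 2 != 0 by rewrite sqrf_eq0 gt_eqF.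
  apply: (mulfI bb).
  have -> : b ^+ 2 * (A ^+ 2 + z ^+ 2) = (c * u - a * z) ^+ 2 + b ^+ 2 * z ^+ 2.
    by rewrite /A; field; rewrite gt_eqF.
  have -> : b ^+ 2 * (u ^+ 2 + B ^+ 2) = (c * z - a * u) ^+ 2 + b ^+ 2 * u ^+ 2.
    by rewrite /B; field; rewrite gt_eqF.
  have -> : b ^+ 2 = c ^+ 2 - a ^+ 2 by rewrite -abc; ring.
  ring.
rewrite (@fubini_tonelli _ _ _ _ _ mu mu (fun z : R * R => (k z)%:E))//=; last first.
  by apply/measurable_EFinP.
apply: eq_integral => u _; rewrite /k/=.
under eq_integral do rewrite EFinM.
rewrite ge0_integralZl//=; last 3 first.
- apply/measurable_EFinP; apply: measurable_funM => //.
  apply: (measurableT_comp measurable_phi).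
  by apply: continuous_measurable_fun; exact: continuous_affine.
- by move=> x _; rewrite lee_fin !mulr_ge0 ?phi_ge0 ?invr_ge0// ltW//.
- by rewrite lee_fin mulr_ge0// phi_ge0.
by rewrite -(integral_affine _ cb0 continuous_phi phi_ge0) integral_phi mule1.
Qed.
End gaussian.

(** * Gaussian moments *)

Section integrable_real.
Context d (T : measurableType d) (R : realType) (m : {measure set T -> \bar R}).
Implicit Types f g : T -> R.

Lemma integrable_add f g : m.-integrable setT (EFin \o f) ->
  m.-integrable setT (EFin \o g) -> m.-integrable setT (EFin \o (fun x => f x + g x)).
Proof. by move=> mf mg; exact: (integrableD measurableT mf mg). Qed.

Lemma integrable_sub f g : m.-integrable setT (EFin \o f) ->
  m.-integrable setT (EFin \o g) -> m.-integrable setT (EFin \o (fun x => f x - g x)).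
Proof. by move=> mf mg; exact: (integrableB measurableT mf mg). Qed.

Lemma integrable_scale k f : m.-integrable setT (EFin \o f) ->
  m.-integrable setT (EFin \o (fun x => k * f x)).
Proof. by move=> mf; exact: (integrableZl measurableT k mf). Qed.

End integrable_real.

Section gaussian_moments.
Context (R : realType).
Local Notation mu := (@lebesgue_measure R).
Local Notation phi := (@normal_pdf R 0 1).
Implicit Types (x w z a b c t : R).

Lemma integrable_mgf t : mu.-integrable setT (EFin \o (fun z => expR (t * z) * phi z)).
Proof.
apply/integrableP; split.
  apply/measurable_EFinP; apply: measurable_funM; last exact: measurable_phi.
  by apply: measurableT_comp => //; exact: measurable_funM.
under eq_integral => z _ do
  rewrite /= ger0_norm ?mulr_ge0 ?expR_ge0 ?phi_ge0//.
by rewrite (integral_mgf t) ltry.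
Qed.

Lemma integrable_gauss (g : R -> R) C : measurable_fun setT g -> 0 <= C ->
  (forall z, `|g z| <= C * (expR z + expR (- z))) ->
  mu.-integrable setT (EFin \o (fun z => g z * phi z)).
Proof.
move=> mg C0 gC.
have i1 := integrableD measurableT (integrable_mgf 1) (integrable_mgf (-1)).
have i2 := integrableZl measurableT C i1.
apply: le_integrable i2 => //.
  apply/measurable_EFinP; apply: measurable_funM => //; exact: measurable_phi.
move=> z _ /=; rewrite lee_fin normrM.
rewrite (ger0_norm (phi_ge0 _)) [leRHS]ger0_norm; last first.
  by rewrite mulr_ge0// addr_ge0// mulr_ge0 ?expR_ge0 ?phi_ge0.
rewrite mul1r mulN1r -mulrDl mulrA ler_wpM2r ?phi_ge0//.
Qed.

Lemma expR_abs_le z : expR `|z| <= expR z + expR (- z).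
Proof.
have [z0|z0] := leP 0 z.
  by rewrite ger0_norm// lerDl expR_ge0.
by rewrite ltr0_norm// lerDr expR_ge0.
Qed.

Lemma pow_le_expR k z : `|z ^+ k.+1| <= (k.+1)`!%:R * (expR z + expR (- z)).
Proof.
rewrite normrX; have := @expR_ge1Dxn _ `|z| k (normr_ge0 _).
set f := _`!%:R => h.
have f0 : 0 < f by rewrite ltr0n fact_gt0.
have : `|z| ^+ k.+1 / f <= expR `|z| by apply: le_trans h; rewrite lerDr.
rewrite ler_pdivrMr// mulrC => /le_trans -> //.
by rewrite ler_pM2l// expR_abs_le.
Qed.

Lemma integrable_gauss_pow k : mu.-integrable setT (EFin \o (fun z => z ^+ k.+1 * phi z)).
Proof.
apply: (integrable_gauss (C := (k.+1)`!%:R)) => //.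
- by move=> z; exact: pow_le_expR.
Qed.

Lemma integrable_gauss_pow_abs k :
  mu.-integrable setT (EFin \o (fun z => `|z| ^+ k.+1 * phi z)).
Proof.
apply: (integrable_gauss (C := (k.+1)`!%:R)) => //.
- by apply: (@measurable_funX _ _ _ _ (fun z : R => `|z|)); exact: measurableT_comp.
- by move=> z; rewrite -normrX normr_id; exact: pow_le_expR.
Qed.

Lemma integrable_phi : mu.-integrable setT (EFin \o phi).
Proof. exact: integrable_normal_pdf. Qed.

Definition gauss3 : R := (\int[mu]_z (`|z| ^+ 3 * phi z))%R.

Lemma gauss3_ge0 : 0 <= gauss3.
Proof. by apply: Rintegral_ge0 => z _; rewrite mulr_ge0 ?exprn_ge0 ?phi_ge0. Qed.

(** With m the mean, integrating 1 + t z <= exp (t z) gives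
    1 + t m <= exp (t ^+ 2 / 2) for all t; both sides are tangent at t = 0 only
    if m = 0. *)
Lemma gauss_mean0 : (\int[mu]_z (z * phi z) = 0)%R.
Proof.
have h t : 1 + t * (\int[mu]_z (z * phi z))%R <= expR (t ^+ 2 / 2).
  have iz := integrable_gauss_pow 0.
  have -> : expR (t ^+ 2 / 2) = (\int[mu]_z (expR (t * z) * phi z))%R.
    by rewrite /Rintegral integral_mgf.
  have <- : (\int[mu]_z (phi z + t * (z * phi z)) =
          1 + t * \int[mu]_z (z * phi z))%R.
    rewrite RintegralD//; [|exact: integrable_phi|exact: integrable_scale].
    by rewrite RintegralZl// {1}/Rintegral integral_phi.
  apply: le_Rintegral => //.
  - by apply: integrable_add; [exact: integrable_phi|exact: integrable_scale].
  - exact: integrable_mgf.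
  - move=> z _; rewrite mulrA -[X in X + _]mul1r -mulrDl.
    by rewrite ler_wpM2r ?phi_ge0// expR_ge1Dx.
move: h; set m := (\int[mu]_z _)%R => h.
have {}h t : 0 < t -> t <= 1 -> `|m| <= t.
  move=> t0 t1.
  have e1 : expR (t ^+ 2 / 2) <= 1 + t ^+ 2.
    have := expR_ge1Dx (- (t ^+ 2 / 2)).
    rewrite expRN => h1; have ep := expR_gt0 (t ^+ 2 / 2).
    rewrite -(ler_pM2r ep) mulVf ?gt_eqF// in h1.
    have : (1 - t ^+ 2 / 2) * expR (t ^+ 2 / 2) <= (1 - t ^+ 2 / 2) * (1 + t ^+ 2).
      apply: (le_trans h1).
      have : t ^+ 2 <= 1 by rewrite expr_le1// ltW.
      have : 0 <= t ^+ 2 by exact: sqr_ge0.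
      nra.
    rewrite ler_pM2l// subr_gt0.
    have : t ^+ 2 <= 1 by rewrite expr_le1// ltW.
    lra.
  have := h t; have := h (- t); rewrite sqrrN => h1 h2.
  rewrite ler_norml; apply/andP; split.
    by rewrite -(ler_pM2l t0); nra.
  by rewrite -(ler_pM2l t0); nra.
apply/eqP; rewrite -normr_le0; apply/ler_addgt0Pl => e e0; rewrite addr0.
have [e1|e1] := leP e 1; first exact: h.
by rewrite (le_trans (h 1 _ _))// ltW.
Qed.

(** The same device in the scale parameter.  As a function of s ^- 2,
    s * normal_pdf 0 s z lies above its tangent at 1, and integrating gives
    1 - (s ^- 2 - 1) / 2 * m <= s; letting s tend to 1 from either side pins
    down m = 1. *)
Lemma gauss_var1 : (\int[mu]_z (z ^+ 2 * phi z) = 1)%R.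
Proof.
set m := (\int[mu]_z _)%R.
have h s : 0 < s -> 1 - (s ^- 2 - 1) / 2 * m <= s.
  move=> s0; pose k := (s ^- 2 - 1) / 2.
  have iz := integrable_gauss_pow 1.
  have <- : (\int[mu]_z (phi z - k * (z ^+ 2 * phi z)) = 1 - k * m)%R.
    rewrite RintegralB//; [|exact: integrable_phi|exact: integrable_scale].
    by rewrite RintegralZl// {1}/Rintegral integral_phi.
  have <- : (\int[mu]_z (s * normal_pdf 0 s z) = s)%R.
    rewrite RintegralZl//; last exact: integrable_normal_pdf.
    by rewrite /Rintegral integral_normal_pdf mulr1.
  apply: le_Rintegral => //.
  - by apply: integrable_sub; [exact: integrable_phi|exact: integrable_scale].
  - by apply: integrable_scale; exact: integrable_normal_pdf.
  - move=> z _.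
    have -> : s * normal_pdf 0 s z = phi z * expR (- (k * z ^+ 2)).
      have pk : s * normal_peak s = normal_peak 1.
        rewrite /normal_peak -mulrnAr sqrtrM ?sqr_ge0// sqrtr_sqr (gtr0_norm s0).
        by rewrite expr1n mul1r invfM mulrA mulfV ?gt_eqF// mul1r.
      rewrite phiE normal_pdfE ?gt_eqF// /normal_fun subr0 mulrA pk -[RHS]mulrA -expRD.
      by congr (_ * expR _); rewrite /k; field; rewrite gt_eqF.
    rewrite mulrA -[X in X - _]mul1r -mulrBl mulrC ler_wpM2l ?phi_ge0//.
    by rewrite (le_trans _ (expR_ge1Dx _)).
have h2 s : 0 < s -> s < 1 -> 2 * s ^+ 2 <= m * (1 + s).
  move=> s0 s1; have := h _ s0.
  have -> : (s ^- 2 - 1) / 2 * m = (1 - s) * (m * (1 + s)) / (2 * s ^+ 2).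
    by field; rewrite gt_eqF.
  rewrite lerBlDr -lerBlDl ler_pdivlMr ?mulr_gt0 ?exprn_gt0//.
  by rewrite ler_pM2l ?subr_gt0.
have h3 s : 1 < s -> m * (1 + s) <= 2 * s ^+ 2.
  move=> s1; have s0 : 0 < s by apply: lt_trans s1.
  have := h _ s0.
  have -> : (s ^- 2 - 1) / 2 * m = - ((s - 1) * (m * (1 + s)) / (2 * s ^+ 2)).
    by field; rewrite gt_eqF.
  rewrite opprK -lerBrDl ler_pdivrMr ?mulr_gt0 ?exprn_gt0//.
  by rewrite ler_pM2l ?subr_gt0.
apply/eqP; rewrite eq_le; apply/andP; split; apply/ler_addgt0Pl => e e0.
  have e20 : 0 < e / 2 by rewrite divr_gt0.
  have := @h3 (1 + e / 2); rewrite ltrDl => /(_ e20); nra.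
have [e1|e1] := ltP e 1.
  have e20 : 0 < e / 2 by rewrite divr_gt0.
  have := @h2 (1 - e / 2); rewrite ltrBlDr ltrDl subr_gt0 => /(_ _ e20).
  have -> : e / 2 < 1 by lra.
  by move=> /(_ isT); nra.
have : 0 <= m by apply: Rintegral_ge0 => z _; rewrite mulr_ge0 ?sqr_ge0 ?phi_ge0.
lra.
Qed.

(** A cubic minorant of h around w integrates to its even part, as the Gaussian
    mean is 0 and its variance 1.  This is the Gaussian half of one Lindeberg
    step. *)
Lemma heat_ge_cubic (s : R) (h : R -> R) w (a0 a1 a2 a3 : R) :
  measurable_fun setT h -> (forall x, 0 <= h x <= 1) ->
  (forall z, a0 + a1 * z + a2 * z ^+ 2 - a3 * `|z| ^+ 3 <= h (w + s * z)) ->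
  ((a0 + a2 - a3 * gauss3)%:E <= heat s h w)%E.
Proof.
move=> mh h01 hz.
pose g z := a0 * phi z + a1 * (z ^+ 1 * phi z) + a2 * (z ^+ 2 * phi z)
            - a3 * (`|z| ^+ 3 * phi z).
have i0 := integrable_scale a0 integrable_phi.
have i1 := integrable_scale a1 (integrable_gauss_pow 0).
have i2 := integrable_scale a2 (integrable_gauss_pow 1).
have i3 := integrable_scale a3 (integrable_gauss_pow_abs 2).
have i01 := integrable_add i0 i1.
have i012 := integrable_add i01 i2.
have ig : mu.-integrable setT (EFin \o g) by exact: integrable_sub.
have -> : a0 + a2 - a3 * gauss3 = (\int[mu]_z g z)%R.
  rewrite /g RintegralB// RintegralD// RintegralD// !RintegralZl//; last 4 first.
  - exact: (integrable_gauss_pow_abs 2).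
  - exact: (integrable_gauss_pow 1).
  - exact: (integrable_gauss_pow 0).
  - exact: integrable_phi.
  by rewrite {1}/Rintegral integral_phi/= gauss_mean0 gauss_var1 mulr0 addr0 !mulr1.
have ih : mu.-integrable setT (EFin \o (fun z => h (w + s * z) * phi z)).
  apply: (le_integrable _ _ _ integrable_phi) => //.
    apply/measurable_EFinP; apply: measurable_funM; last exact: measurable_phi.
    by apply: measurableT_comp => //; apply: measurable_funD => //; exact: measurable_funM.
  move=> z _ /=; rewrite lee_fin normrM ler_piMl//.
  by case/andP: (h01 (w + s * z)) => h0 h1; rewrite ger0_norm.
rewrite /heat -[leRHS]fineK; last exact: integrable_fin_num.
rewrite lee_fin; apply: le_Rintegral => // z _.
rewrite /g !mulrA -!mulrDl -mulrBl expr1 ler_wpM2r ?phi_ge0//.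
by move: (hz z); rewrite !exprS !expr0 !mulr1 !mulrA.
Qed.
End gaussian_moments.

(** * The normal distribution function and its quantiles *)

Section gaussian_tail.
Context (R : realType).
Local Notation mu := (@lebesgue_measure R).
Local Notation phi := (@normal_pdf R 0 1).
Implicit Types (x w z a b c t u v : R).

Definition Phi_bar x : R := fine (normal_prob 0 1 `]x, +oo[).

Lemma Phi_barE x : ((Phi_bar x)%:E = \int[mu]_(z in `]x, +oo[) (phi z)%:E)%E.
Proof. by rewrite /Phi_bar fineK// fin_num_measure. Qed.

Lemma Phi_eq_bar x : Phi x = 1 - Phi_bar x.
Proof.
rewrite /Phi /Phi_bar.
have -> : `]x, +oo[%classic = ~` `]-oo, x] by rewrite setCitvl.
rewrite probability_setC//.
have gen (a : \bar R) : a \is a fin_num -> fine a = 1 - fine (1 - a)%E.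
  by case: a => [a| |]//= _; rewrite opprB addrC subrK.
by apply: gen; rewrite fin_num_measure.
Qed.

Lemma Phi_bar_ge0 x : 0 <= Phi_bar x.
Proof. by rewrite /Phi_bar fine_ge0. Qed.

Lemma phi_shift x z :
  phi z = phi x * expR (- (x * (z - x)) - (z - x) ^+ 2 / 2).
Proof. by rewrite !phiE -mulrA -expRD; congr (_ * expR _); field. Qed.

Lemma phi_shift_le x z : phi z <= phi x * expR (`|x| * `|z - x|).
Proof.
rewrite (phi_shift x z) ler_wpM2l ?phi_ge0// ler_expR.
have := sqr_ge0 (z - x); have := ler_norm (- (x * (z - x))).
rewrite normrN normrM; lra.
Qed.

(** On the interval from x to x + 1 / (1 + |x|) the density stays above
    exp (- 3 / 2) times its value at x, which gives a Mills ratio bound that is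
    sharp up to a constant for all real x at once. *)
Lemma Phi_bar_lower x : expR (- (3 / 2)) * phi x <= (1 + `|x|) * Phi_bar x.
Proof.
pose h := (1 + `|x|)^-1.
have px : 0 < 1 + `|x| by rewrite ltr_pwDl.
have h0 : 0 < h by rewrite invr_gt0.
have h1 : h <= 1 by rewrite invf_le1// lerDl.
rewrite -ler_pdivrMl// -/h -lee_fin Phi_barE.
apply: (@le_trans _ _ (\int[mu]_(z in `]x, (x + h)%R]) (expR (- (3 / 2)) * phi x)%:E)%E).
  rewrite integral_cst//= lebesgue_measure_itv/= lte_fin ltrDl h0 -EFinD.
  by rewrite addrAC subrr add0r -EFinM lee_fin mulrC.
apply: (@le_trans _ _ (\int[mu]_(z in `]x, (x + h)%R]) (phi z)%:E)%E).
  apply: ge0_le_integral => //.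
  - by move=> z _; rewrite lee_fin mulr_ge0 ?expR_ge0 ?phi_ge0.
  - by apply/measurable_EFinP; apply: measurable_funTS; exact: measurable_phi.
  - move=> z /=; rewrite in_itv/= => /andP[xz zh].
    rewrite lee_fin (phi_shift x z) mulrC ler_wpM2l ?phi_ge0// ler_expR.
    have zx0 : 0 <= z - x by rewrite subr_ge0 ltW.
    have zxh : z - x <= h by rewrite lerBlDl.
    have a1 : x * (z - x) <= `|x| * h.
      by apply: le_trans (ler_norm _) _; rewrite normrM (ger0_norm zx0) ler_wpM2l.
    have a2 : `|x| * h <= 1 by rewrite ler_pdivrMr// mul1r lerDr.
    have a3 : (z - x) ^+ 2 <= 1 by rewrite expr_le1// (le_trans zxh).
    lra.
apply: ge0_subset_integral => //.
- by apply/measurable_EFinP; apply: measurable_funTS; exact: measurable_phi.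
- by move=> z _; rewrite lee_fin phi_ge0.
- by move=> z /=; rewrite !in_itv/= andbT => /andP[].
Qed.

Lemma Phi_bar_gt0 x : 0 < Phi_bar x.
Proof.
have := Phi_bar_lower x; have : 0 < expR (- (3 / 2)) * phi x by rewrite mulr_gt0 ?expR_gt0 ?phi_gt0.
move=> h1 h2; have : 0 < (1 + `|x|) * Phi_bar x by exact: lt_le_trans h2.
by rewrite pmulr_rgt0// ltr_pwDl.
Qed.

(** Chernoff's bound. *)
Lemma Phi_bar_tail x : 0 <= x -> Phi_bar x <= expR (- (x ^+ 2 / 2)).
Proof.
move=> x0; rewrite -lee_fin Phi_barE.
have e : (\int[mu]_z ((expR (- x ^+ 2))%:E * (expR (x * z) * phi z)%:E) = (expR (- (x ^+ 2 / 2)))%:E)%E.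
  rewrite ge0_integralZl//=.
  - by rewrite integral_mgf -EFinM -expRD; congr (EFin (expR _)); field.
  - by have /integrableP[] := integrable_mgf x.
  - by move=> z _; rewrite lee_fin mulr_ge0 ?expR_ge0 ?phi_ge0.
rewrite -e.
apply: (@le_trans _ _ (\int[mu]_(z in `]x, +oo[) ((expR (- x ^+ 2))%:E * (expR (x * z) * phi z)%:E))%E).
  apply: ge0_le_integral => //.
  - by move=> z _; rewrite lee_fin phi_ge0.
  - by apply/measurable_EFinP; apply: measurable_funTS; exact: measurable_phi.
  - by apply: measurable_funTS; apply: measurable_funeM; have /integrableP[] := integrable_mgf x.
  - move=> z /=; rewrite in_itv/= andbT => xz.
    rewrite -EFinM lee_fin mulrA -expRD ler_peMl ?phi_ge0//.
    by rewrite -[leLHS]expR0 ler_expR; nra.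
apply: ge0_subset_integral => //.
- by apply: measurable_funeM; have /integrableP[] := integrable_mgf x.
- by move=> z _; rewrite mule_ge0// lee_fin ?mulr_ge0 ?expR_ge0 ?phi_ge0.
Qed.

Lemma Phi_nondecreasing x y : x <= y -> Phi x <= Phi y.
Proof.
move=> xy; rewrite /Phi fine_le ?fin_num_measure// le_measure ?inE//.
exact: subitvPr.
Qed.

Lemma Phi_lip x y : x <= y -> Phi y - Phi x <= normal_peak 1 * (y - x).
Proof.
move=> xy.
have e : normal_prob 0 1 `]-oo, y] = (normal_prob 0 1 `]-oo, x] + normal_prob 0 1 `]x, y])%E.
  rewrite -measureU//; last by apply/seteqP; split => z//=; rewrite !in_itv/=; lra.
  congr (normal_prob _ _ _); apply/seteqP; split => z /=; rewrite !in_itv/=.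
    by case: (leP z x) => zx zy; [left|right].
  by case=> [zx|/andP[]//]; apply: le_trans xy.
rewrite /Phi e fineD ?fin_num_measure// addrAC subrr add0r.
rewrite -lee_fin fineK ?fin_num_measure//.
apply: (@le_trans _ _ (\int[mu]_(z in `]x, y]) (normal_peak 1)%:E)%E).
  apply: ge0_le_integral => //.
  - by move=> z _; rewrite lee_fin phi_ge0.
  - by apply/measurable_EFinP; apply: measurable_funTS; exact: measurable_phi.
  - by move=> z _; rewrite lee_fin normal_pdf_ub// oner_neq0.
rewrite integral_cst//= lebesgue_measure_itv/= lte_fin.
case: ifPn => [_|_]; first by rewrite -EFinD -EFinM lee_fin.
by rewrite mule0 lee_fin mulr_ge0 ?normal_peak_ge0 ?subr_ge0.
Qed.

Lemma continuous_Phi : continuous (@Phi R).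
Proof.
have pk : 0 < normal_peak (1 : R) by rewrite normal_peak_gt0// oner_neq0.
move=> x; apply/cvgrPdist_le => e e0; near=> y.
have h : `|x - y| <= e / normal_peak 1.
  near: y; apply: cvgr_dist_le; [exact: cvg_id|by rewrite divr_gt0].
apply: (@le_trans _ _ (normal_peak 1 * `|x - y|)); last first.
  by rewrite mulrC -ler_pdivlMr.
have [xy|xy] := leP x y.
  rewrite distrC (distrC x) !ger0_norm ?subr_ge0 ?Phi_nondecreasing//.
  exact: Phi_lip.
by rewrite !ger0_norm ?subr_ge0 ?Phi_nondecreasing ?(ltW xy)// Phi_lip// ltW.
Unshelve. all: by end_near. Qed.

Lemma Phi_surj u : 0 < u < 1 -> exists x, Phi x = u.
Proof.
move=> /andP[u0 u1].
pose f : measurableTypeR R -> R := @idfun R.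
have mf : measurable_fun setT f by exact: measurable_id.
pose mid := isMeasurableFun.Build _ _ (measurableTypeR R) R f mf.
pose X : {mfun measurableTypeR R >-> R} := HB.pack f mid.
have [a au] : exists a, Phi a < u.
  have /fine_cvgP[_ /cvgrPdist_lt/(_ _ u0)[a [_ /(_ (a - 1))]]] :=
    cvg_cdfNy0 (X : {RV (normal_prob (0 : R) 1) >-> R}).
  rewrite ltrBlDr ltrDl ltr01 => /(_ isT) h; exists (a - 1).
  have {}h : `|0 - Phi (a - 1)| < u := h.
  by move: h; rewrite sub0r normrN; apply: le_lt_trans; exact: ler_norm.
have [b bu] : exists b, u < Phi b.
  have u10 : 0 < 1 - u by rewrite subr_gt0.
  have /fine_cvgP[_ /cvgrPdist_lt/(_ _ u10)[b [_ /(_ (b + 1))]]] :=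
    cvg_cdfy1 (X : {RV (normal_prob (0 : R) 1) >-> R}).
  rewrite ltrDl ltr01 => /(_ isT) h; exists (b + 1).
  have {}h : `|1 - Phi (b + 1)| < 1 - u := h.
  by move: h => /ltr_normlW; lra.
have ab : a <= b.
  by rewrite leNgt; apply/negP => /ltW/Phi_nondecreasing; lra.
have cP : {within `[a, b], continuous (@Phi R)}.
  by apply: continuous_subspaceT; exact: continuous_Phi.
have [|c _ <-] := IVT ab cP (v := u); last by exists c.
by rewrite ge_min le_max (ltW au) (ltW bu) orbT.
Qed.

Lemma Phi_invK u : 0 < u < 1 -> Phi (Phi_inv u) = u.
Proof.
move=> /Phi_surj[x xu]; rewrite /Phi_inv.
by case: xgetP => [y _ <-//|/(_ x)]; elim.
Qed.

Lemma Phi_inv_le u v : 0 < u < 1 -> 0 < v < 1 -> u <= v -> Phi_inv u <= Phi_inv v.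
Proof.
move=> u01 v01; rewrite le_eqVlt => /predU1P[->//|uv].
rewrite leNgt; apply/negP => /ltW/Phi_nondecreasing.
by rewrite !Phi_invK// leNgt uv.
Qed.

Lemma Phi_bar_Phi_inv b : 0 < b < 1 -> Phi_bar (Phi_inv (1 - b)) = b.
Proof.
move=> b01; have := Phi_eq_bar (Phi_inv (1 - b)); rewrite Phi_invK; last lra.
lra.
Qed.

End gaussian_tail.

(** * The logistic function *)

Section logistic.
Context (R : realType).
Implicit Types (u v q c : R).

Let k_aux (k u : R) : R := expR (- u) * (1 + u + u ^+ 2 / 2 + k * u ^+ 3).

Lemma is_derive_k_aux k u :
  is_derive u 1 (k_aux k) (expR (- u) * ((3 * k - 1 / 2) * u ^+ 2 - k * u ^+ 3)).
Proof.
rewrite /k_aux; apply: is_derive_eq.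
have sE (a b : R^o) : a *: b = a * b by [].
by rewrite !sE; field.
Qed.

(** Bounds on exp u from both sides amount to the monotonicity, on the half line
    u <= 1, of exp (- u) * (1 + u + u ^+ 2 / 2 + k * u ^+ 3): it is
    nonincreasing for k = 0 and nondecreasing for k = 1 / 4. *)
Lemma expR_taylor3 u : u <= 1 -> `|expR u - 1 - u - u ^+ 2 / 2| <= `|u| ^+ 3 / 4.
Proof.
move=> u1.
have dk k x : derivable (k_aux k) x 1.
  by have [] := is_derive_k_aux k x.
have d1 k x : (k_aux k)^`()%classic x =
    expR (- x) * ((3 * k - 1 / 2) * x ^+ 2 - k * x ^+ 3).
  by rewrite derive1E; have [_ ->] := is_derive_k_aux k x.
have ck k : {within `]-oo, 1%R], continuous (k_aux k)}.
  apply: continuous_subspaceT => x.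
  exact/differentiable_continuous/derivable1_diffP/dk.
have k0 k : k_aux k 0 = 1.
  by rewrite /k_aux oppr0 expR0 !expr0n/= !(mulr0, mul0r, addr0, mulr1).
have A x y : x <= y -> y <= 1 -> k_aux 0 y <= k_aux 0 x.
  move=> xy y1; apply: (@ler0_derive1_nincrNy _ (k_aux 0) 1) => // z _.
  rewrite d1 mul0r subr0 mulr_ge0_le0 ?expR_ge0//.
  by have := sqr_ge0 z; lra.
have B x y : x <= y -> y <= 1 -> k_aux (1 / 4) x <= k_aux (1 / 4) y.
  move=> xy y1; apply: (@ger0_derive1_ndecrNy _ (k_aux (1 / 4)) 1) => // z.
  rewrite in_itv/= => z1; rewrite d1 mulr_ge0 ?expR_ge0//.
  have -> : (3 * (1 / 4) - 1 / 2) * z ^+ 2 - 1 / 4 * z ^+ 3 = (1 - z) / 4 * z ^+ 2 by field.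
  by rewrite mulr_ge0 ?sqr_ge0// divr_ge0// subr_ge0 ltW.
have eu : expR u * expR (- u) = 1 by rewrite -expRD subrr expR0.
have e0 := expR_gt0 u.
have kE k : expR u * k_aux k u = 1 + u + u ^+ 2 / 2 + k * u ^+ 3.
  by rewrite /k_aux mulrA eu mul1r.
have [u0|u0] := leP 0 u.
  have := A 0 u u0 u1; have := B 0 u u0 u1; rewrite !k0 => h1 h2.
  have {}h1 : expR u * 1 <= expR u * k_aux (1 / 4) u by rewrite ler_pM2l.
  have {}h2 : expR u * k_aux 0 u <= expR u * 1 by rewrite ler_pM2l.
  move: h1 h2; rewrite !kE mulr1 (ger0_norm u0) => h1 h2.
  by rewrite ler_norml; apply/andP; split; have := exprn_ge0 3 u0; lra.
have := A u 0 (ltW u0) ler01; have := B u 0 (ltW u0) ler01; rewrite !k0 => h1 h2.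
have {}h1 : expR u * k_aux (1 / 4) u <= expR u * 1 by rewrite ler_pM2l.
have {}h2 : expR u * 1 <= expR u * k_aux 0 u by rewrite ler_pM2l.
move: h1 h2; rewrite !kE mulr1 (ltr0_norm u0) => h1 h2.
have : 0 <= (- u) ^+ 3 by rewrite exprn_ge0// oppr_ge0 ltW.
have -> : (- u) ^+ 3 = - u ^+ 3 by ring.
by rewrite ler_norml => h; apply/andP; split; lra.
Qed.

(** The logistic function is the smooth substitute for an indicator in the
    Lindeberg argument.  An exponential test function would lose a factor
    1 + |x|, and the derivatives of a smooth ramp that vanishes on the left are
    not bounded by multiples of the ramp near its foot; the logistic function
    decays exponentially and its derivatives are at most multiples of it. *)
Definition logistic v : R := (1 + expR (- v))^-1.

Lemma logistic_den_gt0 v : 0 < 1 + expR (- v).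
Proof. by rewrite addr_gt0// expR_gt0. Qed.

Lemma logistic_gt0 v : 0 < logistic v.
Proof. by rewrite invr_gt0 logistic_den_gt0. Qed.

Lemma logistic_lt1 v : logistic v < 1.
Proof. by rewrite invf_lt1 ?logistic_den_gt0// ltrDl expR_gt0. Qed.

Lemma logistic01 v : 0 <= logistic v <= 1.
Proof. by rewrite !ltW ?logistic_gt0 ?logistic_lt1. Qed.

Lemma continuous_logistic : continuous logistic.
Proof.
move=> v; apply: cvgV; first by rewrite gt_eqF// logistic_den_gt0.
apply: (@cvgD _ R^o); first exact: cvg_cst.
apply: (@continuous_comp _ _ _ (fun v : R => - v) expR); last exact: continuous_expR.
by apply: (@continuousN _ R^o); exact: cvg_id.
Qed.

Lemma measurable_logistic : measurable_fun setT logistic.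
Proof. exact: continuous_measurable_fun continuous_logistic. Qed.

Lemma logistic_nondecreasing u v : u <= v -> logistic u <= logistic v.
Proof. by move=> uv; rewrite lef_pV2 ?posrE ?logistic_den_gt0// lerD2l ler_expR lerN2. Qed.

(** The increment is a rational function of exp u - 1, which reduces the Taylor
    expansion of the logistic function to the one of exp. *)
Lemma logisticD u v : logistic (v + u) =
  logistic v + logistic v * (1 - logistic v) * (expR u - 1) / (1 + logistic v * (expR u - 1)).
Proof.
have eu := expR_gt0 u; have ev := expR_gt0 v.
rewrite /logistic opprD expRD !expRN.
have h1 : expR v * expR u + 1 != 0 by rewrite gt_eqF// addr_gt0// mulr_gt0.
have h2 : expR v + 1 != 0 by rewrite gt_eqF// addr_gt0.
field; apply/and4P; split; rewrite ?gt_eqF//.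
have -> : expR v + 1 + expR v * (expR u - 1) = expR v * expR u + 1 by ring.
by rewrite addr_gt0// mulr_gt0.
Qed.

Lemma logistic_le_expR v : logistic v <= expR v.
Proof.
by rewrite -[leRHS]invrK -expRN lef_pV2 ?posrE ?logistic_den_gt0 ?expR_gt0// lerDr.
Qed.

Lemma logistic_le_expR_frac k v : 0 <= k <= 1 -> logistic v <= expR (k * v).
Proof.
move=> /andP[k0 k1]; have [v0|v0] := leP 0 v.
  by apply: (le_trans (ltW (logistic_lt1 v))); rewrite -expR0 ler_expR mulr_ge0.
by apply: (le_trans (logistic_le_expR v)); rewrite ler_expR; nra.
Qed.

Lemma logistic_shift_le v C : 0 <= C -> logistic (v + C) <= expR C * logistic v.
Proof.
move=> C0.
rewrite /logistic ler_pdivlMr ?logistic_den_gt0// mulrC ler_pdivrMr ?logistic_den_gt0//.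
by rewrite opprD expRD !expRN mulrDr mulr1 mulrCA mulfV ?gt_eqF ?expR_gt0// mulr1 lerD2r -expR0 ler_expR.
Qed.

(** The Taylor coefficients of orders 1 and 2 at v, the latter with its 1 / 2. *)
Definition logistic1 v := logistic v * (1 - logistic v).
Definition logistic2 v := logistic v * (1 - logistic v) * (1 - 2 * logistic v) / 2.

Lemma logistic1_abs v : `|logistic1 v| <= logistic v.
Proof.
case/andP: (logistic01 v) => h0 h1; rewrite /logistic1 ger0_norm ?mulr_ge0// ?subr_ge0//; nra.
Qed.

Lemma logistic2_abs v : `|logistic2 v| <= logistic v / 2.
Proof.
case/andP: (logistic01 v); rewrite /logistic2; set q := logistic v => h0 h1.
have a1 : -1 <= (1 - q) * (1 - 2 * q) by nra.
have a2 : (1 - q) * (1 - 2 * q) <= 1 by nra.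
by rewrite ler_norml -mulrA; apply/andP; split; nra.
Qed.

(** The remainder carries the factor logistic v.  This relative error is what
    makes the replacement errors multiplicative. *)
Lemma logistic_taylor v u : u <= 1 ->
  `|logistic (v + u) - logistic v - logistic1 v * u - logistic2 v * u ^+ 2| <=
  35 * `|u| ^+ 3 * logistic v.
Proof.
move=> u1; have q0 := logistic_gt0 v; have q1 := logistic_lt1 v.
have [uN1|uN1] := ltP u (-1).
  (* For u < -1 no expansion is needed: each of the terms is at most
     |u| ^+ 3 * logistic v. *)
  have h : logistic (v + u) <= logistic v by apply: logistic_nondecreasing; lra.
  have h0 := logistic_gt0 (v + u).
  have e1 : `|logistic (v + u) - logistic v| <= logistic v by rewrite ler_norml; apply/andP; split; lra.
  have p1 : 1 <= `|u| by rewrite ltr0_norm; lra.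
  have e2 : `|logistic1 v * u| <= logistic v * `|u| ^+ 3.
    by rewrite normrM ler_pM ?logistic1_abs// -[leLHS]expr1 ler_weXn2l.
  have e3 : `|logistic2 v * u ^+ 2| <= logistic v / 2 * `|u| ^+ 3.
    by rewrite normrM normrX ler_pM ?logistic2_abs ?exprn_ge0// ler_weXn2l.
  have e4 : logistic v <= logistic v * `|u| ^+ 3 by rewrite ler_peMr ?exprn_ege1// ltW.
  rewrite (le_trans (ler_normB _ _))// (le_trans (lerD (ler_normB _ _) (lexx _)))//.
  lra.
have ua : `|u| <= 1 by rewrite ler_norml u1 uN1.
have u0 := normr_ge0 u.
have T := expR_taylor3 u1.
set q := logistic v in q0 q1 *; set E := expR u - 1.
have TE : `|E - u| <= 3 / 4 * `|u| ^+ 2.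
  have -> : E - u = (expR u - 1 - u - u ^+ 2 / 2) + u ^+ 2 / 2 by rewrite /E; ring.
  apply: (le_trans (ler_normD _ _)).
  have -> : `|u ^+ 2 / 2| = `|u| ^+ 2 / 2 by rewrite normrM normrX [X in _ * X]gtr0_norm ?invr_gt0.
  have : `|u| ^+ 3 <= `|u| ^+ 2 by rewrite exprS ler_piMl// exprn_ge0.
  lra.
have E1 : `|E| <= 7 / 4 * `|u|.
  have -> : E = (E - u) + u by ring.
  apply: (le_trans (ler_normD _ _)).
  have : `|u| ^+ 2 <= `|u| by rewrite expr2 ler_piMl.
  lra.
have E2 : `|E ^+ 2 - u ^+ 2| <= 33 / 16 * `|u| ^+ 3.
  rewrite subr_sqr normrM.
  have h : `|E + u| <= 11 / 4 * `|u| by apply: (le_trans (ler_normD _ _)); lra.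
  apply: (le_trans (ler_pM _ _ TE h)) => //.
  have -> : 3 / 4 * `|u| ^+ 2 * (11 / 4 * `|u|) = 33 / 16 * `|u| ^+ 3 by field.
  exact: lexx.
have E3 : `|E ^+ 3| <= 343 / 64 * `|u| ^+ 3.
  rewrite normrX; apply: (@le_trans _ _ ((7 / 4 * `|u|) ^+ 3)); first by rewrite lerXn2r ?nnegrE ?mulr_ge0.
  by rewrite exprMn; have := exprn_ge0 3 u0; lra.
have D0 : 1 / 4 <= 1 + q * E.
  have h : 1 / 4 <= expR u.
    have : expR (-1) <= expR u by rewrite ler_expR.
    have := @expR_taylor3 (-1) _; rewrite (ler_norml _ (_ / 4)) => /(_ _)/andP[|+ _]; first lra.
    by rewrite normrN1 expr1n; lra.
  rewrite /E; nra.
have D0' : 0 < 1 + q * E by lra.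
have -> : logistic (v + u) - q - logistic1 v * u - logistic2 v * u ^+ 2 =
  q * (1 - q) * ((expR u - 1 - u - u ^+ 2 / 2) - q * (E ^+ 2 - u ^+ 2)
    + q ^+ 2 * E ^+ 3 / (1 + q * E)).
  rewrite logisticD /logistic1 /logistic2 -/q.
  have -> : expR u - 1 = E by [].
  by field; rewrite gt_eqF.
have E4 : `|q ^+ 2 * E ^+ 3 / (1 + q * E)| <= 343 / 16 * `|u| ^+ 3.
  rewrite normrM normrM (ger0_norm (sqr_ge0 _)) normfV (gtr0_norm D0').
  rewrite ler_pdivrMr//.
  have : q ^+ 2 <= 1 by rewrite expr_le1// ltW.
  have := sqr_ge0 q; have := normr_ge0 (E ^+ 3); have := exprn_ge0 3 u0.
  set a := `|u| ^+ 3 in E3 *; set b := `|E ^+ 3| in E3 * => a0 b0 q20 q21.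
  have : q ^+ 2 * b <= b by rewrite ler_piMl.
  have : 0 <= a * (1 + q * E - 1 / 4) by rewrite mulr_ge0// subr_ge0.
  move: E3; clear; lra.
have E5 : `|q * (E ^+ 2 - u ^+ 2)| <= 33 / 16 * `|u| ^+ 3.
  by rewrite normrM gtr0_norm// (le_trans _ E2)// ler_piMl// ltW.
rewrite normrM gtr0_norm ?mulr_gt0 ?subr_gt0//.
have p3 := exprn_ge0 3 u0.
have E6 : `|(expR u - 1 - u - u ^+ 2 / 2) - q * (E ^+ 2 - u ^+ 2)
    + q ^+ 2 * E ^+ 3 / (1 + q * E)| <= 35 * `|u| ^+ 3.
  rewrite (le_trans (ler_normD _ _))// (le_trans (lerD (ler_normB _ _) (lexx _)))//.
  lra.
rewrite mulrC; apply: ler_pM => //; first by rewrite mulr_ge0 ?subr_ge0 ?ltW.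
by have := sqr_ge0 q; lra.
Qed.

Lemma logistic_taylor_lower v u :
  logistic v + logistic1 v * u + logistic2 v * u ^+ 2 - 35 * `|u| ^+ 3 * logistic v <=
  logistic (v + u).
Proof.
have [u1|u1] := leP u 1.
  by have := logistic_taylor v u1; rewrite ler_norml => /andP[+ _]; lra.
have u0 : 0 < u by lra.
rewrite (gtr0_norm u0).
have h : logistic v <= logistic (v + u) by apply: logistic_nondecreasing; rewrite lerDl ltW.
have h1 := logistic1_abs v; have h2 := logistic2_abs v; have h3 := logistic_gt0 v.
have {}h1 : logistic1 v <= logistic v by apply: le_trans (ler_norm _) h1.
have {}h2 : logistic2 v <= logistic v / 2 by apply: le_trans (ler_norm _) h2.
have e1 : logistic1 v * u <= logistic v * u ^+ 3.
  by apply: (@le_trans _ _ (logistic v * u)); [nra|rewrite ler_pM2l//; nra].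
have e2 : logistic2 v * u ^+ 2 <= logistic v * u ^+ 3.
  have p2 : 0 < u ^+ 2 by rewrite exprn_gt0.
  apply: (@le_trans _ _ (logistic v * u ^+ 2)); first by rewrite ler_pM2r//; lra.
  rewrite ler_pM2l// exprS; nra.
have : 0 < logistic v * u ^+ 3 by rewrite mulr_gt0// exprn_gt0.
lra.
Qed.

(** Large terms become the constant D.  They are not truncated at the
    threshold, because a large term in the numerator of a self-normalized sum
    may have to be charged up to 2 K (see studentized_inclusion_nonneg). *)
Definition replace_large (D x : R) : R := if `|x| <= 1 then x else D.

(** The cubic majorant survives the replacement of large terms since there
    1 <= |x| ^+ 3 and the value is at most exp D * logistic v.  The moments of
    the variable that enter are therefore those before replacement. *)
Lemma logistic_replace_large_upper D v x : 0 <= D ->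
  logistic (v + replace_large D x) <=
  logistic v + logistic1 v * x + logistic2 v * x ^+ 2 + (expR D + 35) * logistic v * `|x| ^+ 3.
Proof.
move=> D0; rewrite /replace_large; have h3 := logistic_gt0 v; case: ifPn => [x1|].
  have x1' : x <= 1 by apply: le_trans (ler_norm _) x1.
  have := logistic_taylor v x1'; rewrite ler_norml => /andP[_ +].
  have : 0 <= expR D * logistic v * `|x| ^+ 3 by rewrite !mulr_ge0 ?expR_ge0// ?exprn_ge0// ltW.
  lra.
rewrite -ltNge => x1.
have h1 := logistic1_abs v; have h2 := logistic2_abs v.
have x3 : 1 <= `|x| ^+ 3 by rewrite exprn_ege1// ltW.
have e0 := logistic_shift_le v D0.
have e1 : - (logistic v * `|x| ^+ 3) <= logistic1 v * x.
  rewrite lerNl; apply: (le_trans (ler_norm _)); rewrite normrN normrM.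
  by rewrite ler_pM// -[leLHS]expr1 ler_weXn2l// ltW.
have e2 : - (logistic v * `|x| ^+ 3) <= logistic2 v * x ^+ 2.
  rewrite lerNl; apply: (le_trans (ler_norm _)); rewrite normrN normrM normrX.
  by rewrite ler_pM//; [lra|rewrite ler_weXn2l// ltW].
have e3 : expR D * logistic v <= expR D * logistic v * `|x| ^+ 3 by rewrite ler_peMr// mulr_ge0 ?expR_ge0// ltW.
have : logistic v <= logistic v * `|x| ^+ 3 by rewrite ler_peMr// ltW.
lra.
Qed.

Lemma measurable_replace_large D : measurable_fun setT (replace_large D).
Proof.
apply: measurable_fun_ifT => //.
by apply: measurable_fun_ler => //; exact: measurableT_comp.
Qed.

End logistic.

(** * Replacing one summand by a Gaussian variable *)

Section moments.
Context d (T : measurableType d) (R : realType) (P : probability T R).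

(** Stating the third absolute moment as a real number includes its finiteness,
    hence all the integrability that is needed. *)
Definition centered_moments (X : T -> R) (m2 m3 : R) :=
  [/\ (\int[P]_t (X t)%:E = 0)%E, (\int[P]_t (X t ^+ 2)%:E = m2%:E)%E
    & (\int[P]_t (`|X t| ^+ 3)%:E = m3%:E)%E].

Lemma integrable_of_cube (X : {mfun T >-> R}) (f : R -> R) (c : R) m2 m3 :
  centered_moments X m2 m3 ->
  measurable_fun setT f -> 0 <= c -> (forall x, `|f x| <= c * (1 + `|x| ^+ 3)) ->
  P.-integrable setT (EFin \o (f \o X)).
Proof.
move=> [_ _ e3] mf c0 fle.
have m3' : measurable_fun setT (fun t => `|X t| ^+ 3).
  by apply: measurable_funX; exact: measurableT_comp.
have i3 : P.-integrable setT (EFin \o (fun t => `|X t| ^+ 3)).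
  apply/integrableP; split; first by apply/measurable_EFinP.
  under eq_integral => t _ do rewrite /= ger0_norm ?exprn_ge0//.
  by rewrite e3 ltry.
have i1 : P.-integrable setT (EFin \o (fun _ : T => 1 : R)).
  exact: finite_measure_integrable_cst.
have ib := integrable_scale c (integrable_add i1 i3).
apply: le_integrable ib => //.
  by apply/measurable_EFinP; exact: measurableT_comp.
move=> t _ /=; rewrite lee_fin [leRHS]ger0_norm ?mulr_ge0 ?addr_ge0 ?exprn_ge0//.
Qed.

Lemma normX_le_cube (x : R) k : (k <= 3)%N -> `|x| ^+ k <= 1 + `|x| ^+ 3.
Proof.
move=> k3; have [x1|x1] := leP `|x| 1.
  by rewrite (@le_trans _ _ 1)// ?exprn_ile1// lerDl exprn_ge0.
by rewrite (@le_trans _ _ (`|x| ^+ 3))// ?lerDr// ler_weXn2l// ltW.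
Qed.

(** The extra term r allows for a quartic part, used for fourth moments. *)
Lemma integral_le_cubic (X : {mfun T >-> R}) (g r : R -> R) (a0 a1 a2 a3 m2 m3 rho : R) :
  centered_moments X m2 m3 -> measurable_fun setT g -> (forall x, 0 <= g x) ->
  measurable_fun setT r -> (forall x, 0 <= r x) ->
  (\int[P]_t (r (X t))%:E = rho%:E)%E ->
  (forall x, g x <= a0 + a1 * x + a2 * x ^+ 2 + a3 * `|x| ^+ 3 + r x) ->
  (\int[P]_t (g (X t))%:E <= (a0 + a2 * m2 + a3 * m3 + rho)%:E)%E.
Proof.
move=> cm mg g0 mr r0 er gle.
have ip f c := @integrable_of_cube X f c _ _ cm.
have i1 : P.-integrable setT (EFin \o X).
  apply: (ip idfun 1) => [|//|x]; first exact: measurable_id.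
  by rewrite mul1r -[leLHS]expr1 normX_le_cube.
have i2 : P.-integrable setT (EFin \o (fun t => X t ^+ 2)).
  apply: (ip (fun x => x ^+ 2) 1) => [|//|x]; first exact: exprn_measurable.
  by rewrite mul1r normrX normX_le_cube.
have i3 : P.-integrable setT (EFin \o (fun t => `|X t| ^+ 3)).
  apply: (ip (fun x => `|x| ^+ 3) 1) => [|//|x].
    by apply: measurable_funX; exact: normr_measurable.
  by rewrite mul1r ger0_norm ?exprn_ge0// lerDr.
have i0 : P.-integrable setT (EFin \o (fun _ : T => a0)).
  exact: finite_measure_integrable_cst.
have ir : P.-integrable setT (EFin \o (fun t => r (X t))).
  apply/integrableP; split.
    by apply/measurable_EFinP; exact: (measurableT_comp mr).
  under eq_integral => t _ do rewrite /= ger0_norm//.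
  by rewrite er ltry.
have j1 := integrable_scale a1 i1; have j2 := integrable_scale a2 i2.
have j3 := integrable_scale a3 i3.
have k1 := integrable_add i0 j1; have k2 := integrable_add k1 j2.
have k3 := integrable_add k2 j3; have k4 := integrable_add k3 ir.
have [e1 e2 e3] := cm.
have -> : a0 + a2 * m2 + a3 * m3 + rho =
   (\int[P]_t (a0 + a1 * X t + a2 * X t ^+ 2 + a3 * `|X t| ^+ 3 + r (X t)))%R.
  rewrite RintegralD// RintegralD// RintegralD// RintegralD// !RintegralZl// Rintegral_cst//.
  have -> : fine (P setT) = 1 by rewrite probability_setT.
  by rewrite mulr1 /Rintegral e1 e2 e3 er/= mulr0 addr0.
rewrite /Rintegral fineK; last exact: integrable_fin_num.
apply: ge0_le_integral => //=.
- by move=> t _; rewrite lee_fin.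
- by apply/measurable_EFinP; exact: measurableT_comp.
- by have /integrableP[] := k4.
- by move=> t _; rewrite lee_fin.
Qed.

(** Integrate (|X| - s) ^+ 2 * (2 |X| + s) >= 0. *)
Lemma lyapunov23 (X : {mfun T >-> R}) (s m3 : R) : 0 <= s ->
  centered_moments X (s ^+ 2) m3 -> s ^+ 3 <= m3.
Proof.
move=> s0 cm.
have h : (0 <= (s ^+ 3 + (- (3 * s)) * s ^+ 2 + 2 * m3)%:E)%E.
  have := @integral_le_cubic X (cst 0) (cst 0) (s ^+ 3) 0 (- (3 * s)) 2 _ _ 0 cm.
  rewrite integral0 addr0; apply => // x /=.
  have -> : s ^+ 3 + 0 * x + - (3 * s) * x ^+ 2 + 2 * `|x| ^+ 3 + 0 =
    (`|x| - s) ^+ 2 * (2 * `|x| + s).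
    by rewrite -[x ^+ 2]real_normK ?num_real//; ring.
  by rewrite mulr_ge0 ?sqr_ge0// addr_ge0// mulr_ge0.
move: h; rewrite lee_fin; have : s ^+ 3 = s * s ^+ 2 by rewrite exprS.
lra.
Qed.

(** The cost of a replacement per unit of third moment.  The factor 4 absorbs
    the division by the Gaussian expectation, which is at least half of
    logistic v. *)
Definition stepC (D : R) : R := 4 * (expR D + 35 + 35 * gauss3 R).

Lemma stepC_gt0 D : 0 < stepC D.
Proof.
have := @gauss3_ge0 R; have := expR_gt0 D; rewrite /stepC => h1 h2.
lra.
Qed.

(** Cubic majorant for X against cubic minorant for the Gaussian variable: the
    terms of orders 0, 1 and 2 cancel, and the third-order terms on both sides
    are multiples of logistic v, which the Gaussian expectation dominates. *)
Lemma replacement_step (D : R) (X : {mfun T >-> R}) (s m3 : R) v : 0 <= D -> 0 <= s ->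
    centered_moments X (s ^+ 2) m3 -> stepC D * m3 <= 1 ->
  (\int[P]_t (logistic (v + replace_large D (X t)))%:E <=
   (1 + stepC D * m3)%:E * heat s (@logistic R) v)%E.
Proof.
move=> D0 s0 cm; rewrite /stepC => Cm.
have g3 := @gauss3_ge0 R.
pose A := expR D + 35.
have A0 : 36 <= A by rewrite /A lerD2r// -[leLHS]expR0 ler_expR.
rewrite -/A in Cm *.
have ly := lyapunov23 s0 cm.
have m30 : 0 <= m3 by apply: le_trans ly; rewrite exprn_ge0.
pose q := logistic v; have q0 : 0 < q := logistic_gt0 v.
have up : (\int[P]_t (logistic (v + replace_large D (X t)))%:E <= (q + logistic2 v * s ^+ 2 + A * q * m3)%:E)%E.
  rewrite -[leRHS]adde0 -EFinD.
  apply: (@integral_le_cubic X (fun x => logistic (v + replace_large D x)) (cst 0) q (logistic1 v) (logistic2 v)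
    (A * q) _ _ 0 cm) => //.
  - apply: (measurableT_comp (@measurable_logistic R)); apply: measurable_funD => //.
    exact: measurable_replace_large.
  - by move=> x; rewrite ltW// logistic_gt0.
  - by rewrite integral0.
  - by move=> x; rewrite addr0; exact: logistic_replace_large_upper.
have lo : ((q + logistic2 v * s ^+ 2 - 35 * q * s ^+ 3 * gauss3 R)%:E <= heat s (@logistic R) v)%E.
  apply: (@heat_ge_cubic _ s (@logistic R) v q (logistic1 v * s) (logistic2 v * s ^+ 2)) => [||z].
  - exact: measurable_logistic.
  - exact: logistic01.
  - have := logistic_taylor_lower v (s * z); rewrite exprMn normrM exprMn (ger0_norm s0).
    rewrite -/q; lra.
apply: (le_trans up); apply: (@le_trans _ _ ((1 + 4 * (A + 35 * gauss3 R) * m3)%:E *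
  (q + logistic2 v * s ^+ 2 - 35 * q * s ^+ 3 * gauss3 R)%:E)%E); last first.
  by rewrite lee_wpmul2l// lee_fin addr_ge0// !mulr_ge0// addr_ge0 ?mulr_ge0//; lra.
rewrite -EFinM lee_fin.
(* A third moment small compared to 1 forces a small variance, so that the
   second-order term cannot spoil the comparison with logistic v. *)
have s12 : s ^+ 2 <= 1 / 4.
  have sh : s <= 1 / 2.
    rewrite leNgt; apply/negP => sh.
    have : (1 / 2) ^+ 3 < s ^+ 3 by rewrite ltrXn2r// nnegrE.
    have : m3 <= 1 / 144 by nra.
    have -> : (1 / 2) ^+ 3 = 1 / 8 :> R by field.
    lra.
  by have -> : 1 / 4 = (1 / 2) ^+ 2 :> R; [field|rewrite lerXn2r// nnegrE].
have s2q : - (q / 8) <= logistic2 v * s ^+ 2.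
  have := logistic2_abs v; rewrite -/q ler_norml => /andP[h1 h2].
  have := sqr_ge0 s; nra.
pose y := 35 * q * s ^+ 3 * gauss3 R.
have yle : y <= 35 * gauss3 R * m3 * q.
  have -> : y = 35 * gauss3 R * q * s ^+ 3 by rewrite /y; ring.
  have -> : 35 * gauss3 R * m3 * q = 35 * gauss3 R * q * m3 by ring.
  by rewrite ler_wpM2l// !mulr_ge0// ltW.
have yq : 35 * gauss3 R * m3 * q <= q / 4.
  have : 35 * gauss3 R * m3 <= 1 / 4 by nra.
  nra.
rewrite -/y.
set w := logistic2 v * s ^+ 2 in s2q *.
set k := (A + 35 * gauss3 R) * m3.
have kq : (q / 2) * (4 * k) <= (q + w - y) * (4 * k).
  rewrite ler_wpM2r//; last by lra.
  by rewrite !mulr_ge0// addr_ge0 ?mulr_ge0//; lra.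
have -> : 4 * (A + 35 * gauss3 R) * m3 = 4 * k by rewrite /k; ring.
have e1 : A * q * m3 + 35 * gauss3 R * m3 * q = q * k by rewrite /k; ring.
have k0 : 0 <= q * k by rewrite /k !mulr_ge0 ?addr_ge0 ?mulr_ge0//; lra.
have -> : (1 + 4 * k) * (q + w - y) = (q + w - y) + (q + w - y) * (4 * k) by ring.
have e2 : q / 2 * (4 * k) = 2 * (q * k) by field.
lra.
Qed.

End moments.

(** * Moderate deviations of sums with replaced large terms *)

Section heat_upper.
Context (R : realType).
Local Notation mu := (@lebesgue_measure R).
Local Notation phi := (@normal_pdf R 0 1).

Lemma integral_laplace (nu x : R) : 0 < nu ->
  (\int[mu]_z (expR (- (nu * `|z - x|)))%:E = (2 / nu)%:E)%E.
Proof.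
move=> nu0.
have cG : continuous (fun z : R => expR (- (nu * `|z|))).
  move=> z; apply: (@continuous_comp _ _ _ (fun z : R => - (nu * `|z|)) expR).
    apply: (@continuousN _ R^o); apply: (@continuousM _ R^o); first exact: cvg_cst.
    exact: norm_continuous.
  exact: continuous_expR.
have G0 (z : R) : 0 <= expR (- (nu * `|z|)) by exact: expR_ge0.
have := integral_affine (- x) ltr01 cG G0.
under [in X in _ = X -> _]eq_integral do rewrite mulr1 mul1r.
move=> <-.
rewrite ge0_symfun_integralT//; last by move=> z /=; rewrite normrN.
rewrite -set_itvcy.
have : (nu%:E * \int[mu]_(z in `[0%R, +oo[) (expR (- (nu * `|z|)))%:E = 1)%E.
  rewrite -ge0_integralZl//=; last 2 first.
  - by apply/measurable_EFinP; apply: measurable_funTS; exact: continuous_measurable_fun.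
  - by rewrite lee_fin ltW.
  rewrite -(integral_exponential_pdf nu0) /exponential_pdf integral_mkcond.
  apply: eq_integral => z _; rewrite !patchE; case: ifPn => //.
  rewrite inE/= in_itv/= andbT => z0.
  by rewrite -EFinM ger0_norm// mulNr.
have fi : (\int[mu]_(z in `[0%R, +oo[) (expR (- (nu * `|z|)))%:E >= 0)%E.
  by apply: integral_ge0 => z _; rewrite lee_fin expR_ge0.
move: fi; case: (\int[mu]_(z in _) _)%E => [r| |]//= _.
  rewrite -EFinM => -[e]; rewrite -EFinM; congr (_%:E).
  by congr (_ * _); rewrite -[RHS]mulr1 -e mulKf// gt_eqF.
by rewrite gt0_muley ?lte_fin.
Qed.

(** Here the test function is logistic (lam (z - x) + 2 c).  To the right of x it
    is at most 1, which contributes 1 - Phi x.  To the left it is at most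
    exp ((lam (z - x) + 2 c) / (2 c)), whose decay beats the growth of the
    density away from x, so that the left contributes at most phi x / lam up to
    constants, i.e., O(1 / K) times 1 - Phi x by the Mills ratio bound. *)
Lemma heat_upper (x K c : R) : 1 / 2 <= c -> 2 * c < K ->
  (heat (K * (1 + `|x|)) (@logistic R) (2 * c - K * (1 + `|x|) * x) <=
   (Phi_bar x * (1 + 2 * expR (5 / 2) / (K / (2 * c) - 1)))%:E)%E.
Proof.
move=> c12 cK; set lam := K * (1 + `|x|).
have c0 : 0 < c by lra.
have px : 0 < 1 + `|x| by rewrite ltr_pwDl.
have k0 : 0 < K / (2 * c) - 1 by rewrite subr_gt0 ltr_pdivlMr ?mulr_gt0// mul1r.
pose nu := lam / (2 * c) - `|x|.
have nule : (K / (2 * c) - 1) * (1 + `|x|) <= nu.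
  have -> : nu = (K / (2 * c)) * (1 + `|x|) - `|x| by rewrite /nu /lam; field; rewrite gt_eqF.
  lra.
have nu0 : 0 < nu by apply: lt_le_trans nule; rewrite mulr_gt0.
have pt z : logistic (2 * c - lam * x + lam * z) * phi z <=
   (phi z) * \1_(`]x, +oo[%classic) z + (expR 1 * phi x) * expR (- (nu * `|z - x|)).
  have [zx|xz] := leP z x.
    rewrite indicE memNset ?mulr0 ?add0r; last by rewrite /= in_itv/= andbT; lra.
    have k01 : 0 <= 1 / (2 * c) <= 1.
      apply/andP; split; first by rewrite divr_ge0// ltW// mulr_gt0.
      by rewrite ler_pdivrMr ?mulr_gt0// mul1r; lra.
    have h1 := logistic_le_expR_frac (2 * c - lam * x + lam * z) k01.
    have h2 := phi_shift_le x z.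
    have h0 := ltW (logistic_gt0 (2 * c - lam * x + lam * z)).
    apply: (le_trans (ler_pM h0 (phi_ge0 z) h1 h2)).
    rewrite mulrCA -expRD -mulrA mulrCA -expRD ler_wpM2l ?phi_ge0// ler_expR.
    have zx' : `|z - x| = x - z by rewrite distrC ger0_norm// subr_ge0.
    rewrite zx' le_eqVlt; apply/orP; left; apply/eqP.
    by rewrite /nu; field; rewrite gt_eqF.
  rewrite indicE mem_set ?mulr1; last by rewrite /= in_itv/= xz.
  rewrite -[leLHS]addr0 lerD//.
    by rewrite ler_piMl ?phi_ge0// ltW// logistic_lt1.
  by rewrite !mulr_ge0 ?expR_ge0 ?phi_ge0.
have m1 : measurable_fun setT (fun z : R => phi z * \1_(`]x, +oo[%classic) z).
  by apply: measurable_funM; [exact: measurable_phi|exact: measurable_indic].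
have m2 : measurable_fun setT (fun z : R => expR (- (nu * `|z - x|))).
  apply: measurableT_comp => //; apply: measurable_funN; apply: measurable_funM => //.
  by apply: measurableT_comp => //; exact: measurable_funB.
apply: (@le_trans _ _ (\int[mu]_z ((phi z * \1_(`]x, +oo[%classic) z)%:E +
    (expR 1 * phi x)%:E * (expR (- (nu * `|z - x|)))%:E))%E).
  apply: ge0_le_integral => //.
  - by move=> z _; rewrite lee_fin mulr_ge0 ?phi_ge0// ltW// logistic_gt0.
  - apply/measurable_EFinP; apply: measurable_funM; last exact: measurable_phi.
    by apply: (measurableT_comp (@measurable_logistic R)); apply: measurable_funD.
  - apply: emeasurable_funD; first by apply/measurable_EFinP.
    by apply: measurable_funeM; apply/measurable_EFinP.
  - by move=> z _; rewrite -EFinM -EFinD lee_fin.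
rewrite ge0_integralD//=; last 4 first.
- by move=> z _; rewrite lee_fin mulr_ge0 ?phi_ge0.
- by apply/measurable_EFinP.
- by move=> z _; rewrite mule_ge0// lee_fin ?expR_ge0// mulr_ge0 ?expR_ge0 ?phi_ge0.
- by apply: measurable_funeM; apply/measurable_EFinP.
rewrite ge0_integralZl//=; last 2 first.
- by apply/measurable_EFinP.
- by rewrite lee_fin mulr_ge0 ?expR_ge0 ?phi_ge0.
rewrite integral_laplace//.
have -> : (\int[mu]_z (phi z * \1_(`]x, +oo[%classic) z)%:E = (Phi_bar x)%:E)%E.
  rewrite Phi_barE [RHS]integral_mkcond; apply: eq_integral => z _.
  by rewrite epatch_indic/= EFinM.
rewrite -EFinM -EFinD lee_fin mulrDr mulr1 lerD2l.
have ql := Phi_bar_lower x.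
have e52 : expR (5 / 2) = expR 1 * expR (3 / 2) :> R by rewrite -expRD; congr expR; field.
have e32 : expR (3 / 2) * expR (- (3 / 2)) = 1 :> R by rewrite -expRD subrr expR0.
have px' : phi x <= expR (3 / 2) * (1 + `|x|) * Phi_bar x.
  have : expR (3 / 2) * (expR (- (3 / 2)) * phi x) <= expR (3 / 2) * ((1 + `|x|) * Phi_bar x).
    by rewrite ler_wpM2l ?expR_ge0.
  by rewrite mulrA e32 mul1r mulrA.
rewrite [leLHS]mulrA ler_pdivrMr//.
apply: (@le_trans _ _ (expR 1 * (expR (3 / 2) * (1 + `|x|) * Phi_bar x) * 2)).
  by rewrite ler_wpM2r// ler_wpM2l ?expR_ge0.
rewrite e52.
apply: (@le_trans _ _ (Phi_bar x * (2 * (expR 1 * expR (3 / 2)) / (K / (2 * c) - 1)) *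
    ((K / (2 * c) - 1) * (1 + `|x|)))).
  rewrite le_eqVlt; apply/orP; left; apply/eqP; field.
  by apply/andP; split; rewrite gt_eqF//; lra.
by rewrite ler_wpM2l// mulr_ge0 ?Phi_bar_ge0// divr_ge0 ?(ltW k0)// !mulr_ge0 ?expR_ge0.
Qed.

End heat_upper.

HB.instance Definition _ (R : realType) (D : R) :=
  isMeasurableFun.Build _ _ _ _ (replace_large D) (measurable_replace_large D).

Section moderate_deviation.
Context d (T : measurableType d) (R : realType) (P : probability T R).
Local Notation mu := (@lebesgue_measure R).
Local Notation phi := (@normal_pdf R 0 1).

(** Markov's inequality in the form used for all the tails. *)
Lemma prob_le_integral (A : set T) (f : T -> \bar R) : measurable A ->
  measurable_fun setT f -> (forall w, 0 <= f w)%E -> (forall w, A w -> 1 <= f w)%E ->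
  (P A <= \int[P]_w f w)%E.
Proof.
move=> mA mf f0 f1; rewrite -[leLHS]mul1e -[leLHS](integral_cst P mA).
rewrite [leLHS]integral_mkcond; apply: ge0_le_integral => //=.
- by move=> w _; rewrite patchE; case: ifP.
- by apply/(measurable_restrictT _ _).1.
move=> w _; rewrite patchE; case: ifPn => // /set_mem; exact: f1.
Qed.

Lemma independent_comp n (X : nat -> {mfun T >-> R}) (g : nat -> {mfun R >-> R}) :
  independent_upto P n X -> independent_upto P n (fun i => g i \o X i).
Proof.
move=> indX A mA.
have mg i : measurable (g i @^-1` A i).
  by rewrite -[X in measurable X]setTI; exact: measurable_funP.
by have := indX (fun i => g i @^-1` A i) mg.
Qed.

Lemma prod_le_expR n (C : R) (t : nat -> R) : 0 <= C -> (forall i, 0 <= t i) ->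
  \prod_(k < n) (1 + C * t k) <= expR (C * \sum_(k < n) t k).
Proof.
move=> C0 t0; elim: n => [|n IH]; first by rewrite !big_ord0 mulr0 expR0.
rewrite !big_ord_recr/= [C * (_ + _)]mulrDr expRD ler_pM//.
- by apply: prodr_ge0 => i _; rewrite addr_ge0// mulr_ge0.
- by rewrite addr_ge0// mulr_ge0.
- exact: expR_ge1Dx.
Qed.

(** The step without smoothing, applied under the integral over the Gaussian
    part s' and followed by the semigroup property. *)
Lemma integral_step_heat (C D : R) (X : {mfun T >-> R}) (s s' s'' m3 w : R) :
  (forall v, (\int[P]_t (logistic (v + replace_large D (X t)))%:E <=
     (1 + C * m3)%:E * heat s (@logistic R) v)%E) ->
  0 <= 1 + C * m3 -> 0 <= s -> 0 <= s' -> 0 <= s'' -> s' ^+ 2 + s ^+ 2 = s'' ^+ 2 ->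
  (\int[P]_t heat s' (@logistic R) (w + replace_large D (X t)) <=
   (1 + C * m3)%:E * heat s'' (@logistic R) w)%E.
Proof.
move=> step C0 s0 s'0 s''0 e.
have logistic_ge0 v : 0 <= @logistic R v by rewrite ltW// logistic_gt0.
pose f (z : T * R) : \bar R := (logistic (w + replace_large D (X z.1) + s' * z.2) * phi z.2)%:E.
have mf : measurable_fun setT f.
  apply/measurable_EFinP; apply: measurable_funM.
    apply: (measurableT_comp (@measurable_logistic R)); apply: measurable_funD.
      apply: measurable_funD => //.
      by apply: (measurableT_comp (measurable_replace_large D)); exact: (measurableT_comp (measurable_funP X)).
    exact: measurable_funM.
  exact: (measurableT_comp (@measurable_phi R)).
have f0 z : (0 <= f z)%E by rewrite lee_fin mulr_ge0 ?phi_ge0.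
have -> : (\int[P]_t heat s' (@logistic R) (w + replace_large D (X t)) =
    \int[mu]_z \int[P]_t f (t, z))%E.
  exact: (@fubini_tonelli _ _ _ _ _ P mu f mf f0).
rewrite -(heat_heat w s'0 s0 s''0 e (@continuous_logistic R) logistic_ge0).
rewrite -ge0_integralZl//=; last 2 first.
- apply: emeasurable_funM; last by apply/measurable_EFinP; exact: measurable_phi.
  apply: (measurableT_comp (measurable_heat s (@measurable_logistic R) logistic_ge0)).
  by apply: measurable_funD => //; exact: measurable_funM.
- by move=> z _; rewrite mule_ge0 ?heat_ge0// lee_fin phi_ge0.
apply: ge0_le_integral => //=.
- by move=> z _; exact: integral_ge0.
- exact: (@measurable_fun_fubini_tonelli_G _ _ _ _ _ P f mf f0).
- apply: measurable_funeM; apply: emeasurable_funM; last by apply/measurable_EFinP; exact: measurable_phi.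
  apply: (measurableT_comp (measurable_heat s (@measurable_logistic R) logistic_ge0)).
  by apply: measurable_funD => //; exact: measurable_funM.
move=> z _; rewrite /f/=.
under eq_integral do rewrite EFinM.
rewrite ge0_integralZr//=; last 3 first.
- apply/measurable_EFinP; apply: (measurableT_comp (@measurable_logistic R)); apply: measurable_funD => //.
  apply: measurable_funD => //.
  by apply: (measurableT_comp (measurable_replace_large D)); exact: measurable_funP.
- by move=> t _; rewrite lee_fin.
- by rewrite lee_fin phi_ge0.
rewrite muleA lee_wpmul2r ?lee_fin ?phi_ge0//.
under eq_integral do rewrite addrAC.
exact: step.
Qed.

(** Markov's inequality for logistic (v + 2 c - lam * x), which is at least
    1 / (1 + exp (- c)) on the event, and Lindeberg replacement with F k the
    smoothing by the variances of the terms k, ..., n - 1. *)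
Lemma moderate_deviation (D : R) n (X : nat -> {mfun T >-> R}) (s t : nat -> R) (x K c : R) :
  0 <= D -> independent_upto P n X ->
  (forall i, 0 <= s i) -> (forall i, 0 <= t i) ->
  (forall i, (i < n)%N -> centered_moments P (X i) (s i ^+ 2) (t i)) ->
  \sum_(i < n) s i ^+ 2 = (K * (1 + `|x|)) ^+ 2 ->
  stepC D * \sum_(i < n) t i <= 1 ->
  1 / 2 <= c -> 2 * c < K ->
  (P [set w | (K * (1 + `|x|) * x - c <= \sum_(i < n) replace_large D (X i w))%R] <=
  ((1 + expR (- c)) * expR (stepC D * \sum_(i < n) t i) *
   (Phi_bar x * (1 + 2 * expR (5 / 2) / (K / (2 * c) - 1))))%:E)%E.
Proof.
set C := stepC D; move=> D0 indX s0 t0 mX sums Ct c12 cK.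
have C0 : 0 < C := stepC_gt0 D.
set lam := K * (1 + `|x|) in sums *.
have lam0 : 0 <= lam by rewrite mulr_ge0 ?addr_ge0//; lra.
have logistic_ge0 v : 0 <= @logistic R v by rewrite ltW// logistic_gt0.
pose Y i : {mfun T >-> R} := replace_large D \o X i.
have indY : independent_upto P n Y by exact: (@independent_comp _ _ (fun=> replace_large D)).
pose S k := \sum_(k <= i < n) s i ^+ 2.
have S0 k : 0 <= S k by apply: sumr_ge0 => i _; rewrite sqr_ge0.
pose v0 := 2 * c - lam * x.
pose F k w := heat (Num.sqrt (S k)) (@logistic R) (v0 + w).
have Fge0 k w : (0 <= F k w)%E by exact: heat_ge0.
have mF k : measurable_fun setT (F k).
  apply: (measurableT_comp (measurable_heat (Num.sqrt (S k)) (@measurable_logistic R) logistic_ge0)).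
  exact: measurable_funD.
have tl : (\int[P]_w F n (psum Y n w) <= (\prod_(k < n) (1 + C * t k))%:E * F 0%N 0%R)%E.
  apply: (telescoping (c := fun k => 1 + C * t k)) => // [k|k w kn].
    by rewrite addr_ge0// mulr_ge0// ltW.
  rewrite /F; under eq_integral do rewrite addrA.
  apply: (@integral_step_heat C D (X k) (s k)) => //.
  - move=> v; apply: replacement_step => //; first exact: mX.
    apply: le_trans Ct; rewrite ler_pM2l// (bigD1 (Ordinal kn))//= lerDl sumr_ge0//.
  - by rewrite addr_ge0// mulr_ge0// ltW.
  - by rewrite !sqr_sqrtr// /S [in RHS]big_ltn// addrC.
have Fn w : F n w = (logistic (v0 + w))%:E by rewrite /F /S big_geq// sqrtr0 heat0.
have F0 : (F 0%N 0%R <= (Phi_bar x * (1 + 2 * expR (5 / 2) / (K / (2 * c) - 1)))%:E)%E.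
  rewrite /F /S big_mkord sums sqrtr_sqr (ger0_norm lam0) addr0.
  exact: heat_upper.
set A := [set w | _].
have psE w : psum Y n w = \sum_(i < n) replace_large D (X i w) by [].
have mA : measurable A.
  have -> : A = psum Y n @^-1` `[lam * x - c, +oo[.
    by apply/seteqP; split => w; rewrite /A/= psE in_itv/= andbT.
  by rewrite -[X in measurable X]setTI; exact: measurable_psum.
have e0 : 0 < 1 + expR (- c) := logistic_den_gt0 c.
have mk : (P A <= (1 + expR (- c))%:E * \int[P]_w F n (psum Y n w))%E.
  have mFY : measurable_fun setT (fun w => F n (psum Y n w)).
    by apply: (measurableT_comp (mF n)); exact: measurable_psum.
  rewrite -ge0_integralZl//=.
  apply: (prob_le_integral mA) => [|w|w].
  - exact: measurable_funeM.
  - by rewrite mule_ge0// lee_fin ltW.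
  rewrite /A/= -psE => h; rewrite Fn -EFinM lee_fin.
  rewrite -ler_pdivrMl// mulr1; apply: logistic_nondecreasing; rewrite /v0; lra.
apply: (le_trans mk); rewrite -mulrA EFinM lee_wpmul2l ?lee_fin ?(ltW e0)//.
apply: (le_trans tl); rewrite EFinM.
apply: (@le_trans _ _ ((expR (C * \sum_(i < n) t i))%:E * F 0%N 0%R)%E).
  by rewrite lee_wpmul2r// lee_fin prod_le_expR// ltW.
by rewrite lee_wpmul2l// lee_fin expR_ge0.
Qed.

End moderate_deviation.

(** * Exceptional events *)

Section truncation_functions.
Context (R : realType).

Definition exceed1 (x : R) : R := if `|x| <= 1 then 0 else 1.
Definition sq1 (x : R) : R := if `|x| <= 1 then x ^+ 2 else 0.

Let measurable_le1 : measurable_fun setT (fun x : R => `|x| <= 1).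
Proof. by apply: measurable_fun_ler => //; exact: normr_measurable. Qed.

Lemma measurable_exceed1 : measurable_fun setT exceed1.
Proof. exact: measurable_fun_ifT. Qed.

Lemma measurable_sq1 : measurable_fun setT sq1.
Proof. by apply: measurable_fun_ifT => //; exact: exprn_measurable. Qed.

HB.instance Definition _ := isMeasurableFun.Build _ _ _ _ exceed1 measurable_exceed1.
HB.instance Definition _ := isMeasurableFun.Build _ _ _ _ sq1 measurable_sq1.

Lemma exceed1_ge0 x : 0 <= exceed1 x.
Proof. by rewrite /exceed1; case: ifP. Qed.

Lemma sq1_ge0 x : 0 <= sq1 x.
Proof. by rewrite /sq1; case: ifP => //; rewrite sqr_ge0. Qed.

Lemma expRN_le_quad (y : R) : 0 <= y -> expR (- y) <= 1 - y + y ^+ 2.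
Proof.
move=> y0; have [y1|y1] := leP y 1.
  have := @expR_taylor3 R (- y); rewrite sqrrN normrN (ger0_norm y0) => /(_ _)/ler_normlW.
  have y3 : y ^+ 3 <= y ^+ 2 by rewrite exprS ler_piMl// exprn_ge0.
  have : - y <= 1 by lra.
  by move=> h /(_ h); have := sqr_ge0 y; lra.
apply: (@le_trans _ _ 1); last by nra.
by rewrite -expR0 ler_expR; lra.
Qed.

End truncation_functions.

Section deviation_bounds.
Context d (T : measurableType d) (R : realType) (P : probability T R).
Implicit Types (X : nat -> {mfun T >-> R}) (s t u : nat -> R).

Lemma exp_moment_le n X (g : {mfun R >-> R}) (b : nat -> R) :
  independent_upto P n X ->
  (forall i, (i < n)%N -> (\int[P]_w (expR (g (X i w)))%:E <= (expR (b i))%:E)%E) ->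
  (\int[P]_w (expR (\sum_(i < n) g (X i w)))%:E <= (expR (\sum_(i < n) b i))%:E)%E.
Proof.
move=> indX gb.
have indY := @independent_comp _ _ _ P n X (fun=> g) indX.
have := @telescoping _ _ _ P n _ (fun _ w => (expR w)%:E) (fun k => expR (b k)) indY.
rewrite expR0 mule1 -expR_sum; apply => //.
- by move=> k; apply/measurable_EFinP.
- move=> k w kn; under eq_integral do rewrite expRD EFinM.
  rewrite ge0_integralZl//= ?lee_fin ?expR_ge0//; last first.
    by apply/measurable_EFinP; apply: measurableT_comp => //; exact: measurableT_comp.
  by rewrite muleC lee_wpmul2r ?lee_fin ?expR_ge0//; exact: gb.
Qed.

(** A Chernoff bound for the number of large terms, applied to exp N - 1
    instead of exp N: this keeps a factor that vanishes with the third moments.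
    Without it the bound would not be small relative to 1 - Phi x when x stays
    bounded. *)
Lemma exceedance_tail n X s t (y : R) :
  independent_upto P n X -> (forall i, 0 <= t i) ->
  (forall i, (i < n)%N -> centered_moments P (X i) (s i) (t i)) ->
  (P [set w | (1 <= \sum_(i < n) exceed1 (X i w))%R /\ (y <= \sum_(i < n) exceed1 (X i w))%R]
   <= (2 * expR (- y) * (expR (2 * \sum_(i < n) t i) - 1))%:E)%E.
Proof.
move=> indX t0 mX.
pose N w := \sum_(i < n) exceed1 (X i w).
have mN : measurable_fun setT N.
  by apply: measurable_sum => i; exact: (measurableT_comp (@measurable_exceed1 R)).
have N0 w : 0 <= N w by apply: sumr_ge0 => i _; exact: exceed1_ge0.
have e3 : expR 1 <= 3 :> R.
  have := @expR_taylor3 R 1 (lexx _); rewrite normr1 !expr1n => /ler_normlW; lra.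
have EN : (\int[P]_w (expR (N w))%:E <= (expR (2 * \sum_(i < n) t i))%:E)%E.
  rewrite mulr_sumr; apply: (@exp_moment_le n X (@exceed1 R) (fun i => 2 * t i)) => // i i_n.
  apply: (@le_trans _ _ (1 + 2 * t i)%:E); last by rewrite lee_fin expR_ge1Dx.
  have := @integral_le_cubic _ _ _ P (X i) (fun x => expR (exceed1 x)) (cst 0) 1 0 0 2 _ _ 0 (mX i i_n).
  rewrite mul0r !addr0; apply => //.
  - by apply: measurableT_comp => //; exact: measurable_exceed1.
  - by rewrite integral0.
  - move=> x; rewrite !mul0r !addr0 /exceed1; case: ifPn => [_|].
      by rewrite expR0 lerDl mulr_ge0 ?exprn_ge0.
    rewrite -ltNge => x1; have : 1 <= `|x| ^+ 3 by rewrite exprn_ege1// ltW.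
    lra.
set A := [set w | _].
have mA : measurable A.
  have -> : A = N @^-1` (`[1, +oo[ `&` `[y, +oo[)%classic.
    by apply/seteqP; split => w; rewrite /A/= /N !in_itv/= !andbT.
  rewrite -[X in measurable X]setTI; apply: mN => //.
  by apply: measurableI.
pose f w := 2 * expR (- y) * (expR (N w) - 1).
have f0 w : 0 <= f w.
  by rewrite !mulr_ge0 ?expR_ge0// subr_ge0 -expR0 ler_expR.
have mf : measurable_fun setT f.
  by apply: measurable_funM => //; apply: measurable_funB => //; exact: measurableT_comp.
have PA : (P A <= \int[P]_w (f w)%:E)%E.
  apply: prob_le_integral => //; first by apply/measurable_EFinP.
  move=> w [n1 ny]; rewrite lee_fin /f.
  have e1 : 2 <= expR 1 :> R by rewrite (le_trans _ (expR_ge1Dx _)).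
  have h1 : expR 1 <= expR (N w) by rewrite ler_expR.
  have h2 : expR y <= expR (N w) by rewrite ler_expR.
  have ey : expR (- y) * expR y = 1 by rewrite -expRD addrC subrr expR0.
  have : expR (- y) * expR y <= expR (- y) * (2 * (expR (N w) - 1)).
    by rewrite ler_wpM2l ?expR_ge0//; lra.
  by rewrite ey; lra.
have ef : (\int[P]_w (f w)%:E + (2 * expR (- y))%:E <=
           (2 * expR (- y) * expR (2 * \sum_(i < n) t i))%:E)%E.
  have -> : (2 * expR (- y))%:E = (\int[P]_w (2 * expR (- y))%:E)%E.
    by rewrite integral_cst//= (_ : P setT = 1%E) ?mule1//; exact: probability_setT.
  rewrite -ge0_integralD//=; last 2 first.
  - by move=> w _; rewrite lee_fin.
  - by apply/measurable_EFinP.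
  under eq_integral => w _.
    rewrite -EFinD (_ : f w + _ = 2 * expR (- y) * expR (N w)); last by rewrite /f; ring.
    rewrite EFinM; over.
  rewrite ge0_integralZl//=; last by apply/measurable_EFinP; exact: measurableT_comp.
  by rewrite [leRHS]EFinM lee_wpmul2l// lee_fin mulr_ge0 ?expR_ge0.
apply: (le_trans PA); rewrite mulrBr mulr1 EFinB leeBrDr//.
Qed.

(** Chernoff's bound for exp (- a * sum of small squares).  Nonnegative variables
    have light lower tails, so fourth moments are enough; discarding the large
    terms costs their variance, at most the third moment. *)
Lemma truncated_squares_lower n X s t u (h a : R) :
  independent_upto P n X -> 0 <= a ->
  (forall i, (i < n)%N -> centered_moments P (X i) (s i ^+ 2) (t i)) ->
  (forall i, (i < n)%N -> (\int[P]_w (X i w ^+ 4)%:E = (u i)%:E)%E) ->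
  (P [set w | (\sum_(i < n) sq1 (X i w) <= \sum_(i < n) s i ^+ 2 - h)%R]
   <= (expR (- (a * h) + a * \sum_(i < n) t i + a ^+ 2 * \sum_(i < n) u i))%:E)%E.
Proof.
move=> indX a0 mX mu4.
pose V w := \sum_(i < n) sq1 (X i w).
have mV : measurable_fun setT V.
  by apply: measurable_sum => i; exact: (measurableT_comp (@measurable_sq1 R)).
pose mg := isMeasurableFun.Build _ _ R R (fun x : R => - a * sq1 x)
  (measurable_funM (measurable_cst (- a)) (@measurable_sq1 R)).
pose g : {mfun R >-> R} := HB.pack (fun x : R => - a * sq1 x) mg.
have E := @exp_moment_le n X g (fun i => - a * s i ^+ 2 + a * t i + a ^+ 2 * u i) indX.
set A := [set w | _]; set S := \sum_(i < n) s i ^+ 2.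
have mA : measurable A.
  have -> : A = V @^-1` (`]-oo, S - h])%classic.
    by apply/seteqP; split => w; rewrite /A/= /V in_itv/=.
  by rewrite -[X in measurable X]setTI; apply: mV.
pose f w := expR (a * (S - h)) * expR (- a * V w).
have f0 w : 0 <= f w by rewrite mulr_ge0 ?expR_ge0.
have mf : measurable_fun setT f.
  apply: measurable_funM => //; apply: measurableT_comp => //.
  exact: measurable_funM.
have PA : (P A <= \int[P]_w (f w)%:E)%E.
  apply: prob_le_integral => //; first by apply/measurable_EFinP.
  move=> w; rewrite /A/= -/(V w) => VS; rewrite lee_fin /f -expRD -[leLHS]expR0 ler_expR.
  by rewrite mulNr subr_ge0 ler_wpM2l.
apply: (le_trans PA); rewrite /f; under eq_integral do rewrite EFinM.
rewrite ge0_integralZl//=; last first.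
  by apply/measurable_EFinP; apply: measurableT_comp => //; exact: measurable_funM.
have -> : (expR (- (a * h) + a * \sum_(i < n) t i + a ^+ 2 * \sum_(i < n) u i))%:E =
  ((expR (a * (S - h)))%:E * (expR (\sum_(i < n) (- a * s i ^+ 2 + a * t i + a ^+ 2 * u i)))%:E)%E.
  rewrite -EFinM -expRD !big_split/= -!mulr_sumr -/S; congr (expR _)%:E; ring.
rewrite lee_wpmul2l ?lee_fin ?expR_ge0//.
under eq_integral => w _ do rewrite /V mulr_sumr.
apply: E => i i_n.
apply: (@le_trans _ _ (1 + (- a) * s i ^+ 2 + a * t i + a ^+ 2 * u i)%:E); last first.
  by rewrite lee_fin -!addrA expR_ge1Dx.
have i4 : (\int[P]_w (a ^+ 2 * X i w ^+ 4)%:E = (a ^+ 2 * u i)%:E)%E.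
  under eq_integral do rewrite EFinM.
  rewrite ge0_integralZl//= ?mu4 ?lee_fin ?sqr_ge0//.
  - by apply/measurable_EFinP; exact: measurable_funX.
  - by move=> w _; rewrite lee_fin (exprM _ 2 2) sqr_ge0.
apply: (@integral_le_cubic _ _ _ P (X i) (fun x => expR (g x)) (fun x => a ^+ 2 * x ^+ 4)
  1 0 (- a) a _ _ _ (mX i i_n)) => //.
- by apply: measurableT_comp => //; exact: measurable_funP.
- by apply: measurable_funM => //; exact: exprn_measurable.
- by move=> x; rewrite mulr_ge0 ?sqr_ge0// (exprM _ 2 2) sqr_ge0.
move=> x; rewrite /g/= /sq1 mul0r addr0; case: ifPn => [_|].
  rewrite mulNr; have := @expRN_le_quad R (a * x ^+ 2); rewrite mulr_ge0 ?sqr_ge0// => /(_ isT).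
  have : 0 <= a * `|x| ^+ 3 by rewrite mulr_ge0 ?exprn_ge0.
  have -> : (a * x ^+ 2) ^+ 2 = a ^+ 2 * x ^+ 4 by ring.
  lra.
rewrite -ltNge => x1; rewrite mulr0 expR0.
have : 0 <= a ^+ 2 * x ^+ 4 by rewrite mulr_ge0 ?sqr_ge0// (exprM _ 2 2) sqr_ge0.
have : a * x ^+ 2 <= a * `|x| ^+ 3.
  by rewrite ler_wpM2l// -real_normK ?num_real// ler_weXn2l// ltW.
lra.
Qed.

(** Telescoping with F k w = w ^+ 2 + the fourth moments that remain bounds the
    variance of the sum. *)
Lemma sum_squares_chebyshev n X s t u (e : R) :
  independent_upto P n X -> 0 < e ->
  (forall i, 0 <= u i) ->
  (forall i, (i < n)%N -> centered_moments P (X i) (s i ^+ 2) (t i)) ->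
  (forall i, (i < n)%N -> (\int[P]_w (X i w ^+ 4)%:E = (u i)%:E)%E) ->
  (P [set w | (e <= `|\sum_(i < n) X i w ^+ 2 - \sum_(i < n) s i ^+ 2|)%R]
   <= ((\sum_(i < n) u i) / e ^+ 2)%:E)%E.
Proof.
move=> indX e0 u0 mX mu4.
have mg i : measurable_fun setT (fun x : R => x ^+ 2 - s i ^+ 2).
  by apply: measurable_funB => //; exact: exprn_measurable.
pose mg' i := isMeasurableFun.Build _ _ R R (fun x : R => x ^+ 2 - s i ^+ 2) (mg i).
pose g i : {mfun R >-> R} := HB.pack (fun x : R => x ^+ 2 - s i ^+ 2) (mg' i).
have indY := independent_comp g indX.
pose U k := \sum_(k <= i < n) u i.
have U0 k : 0 <= U k by apply: sumr_ge0.
pose F k (w : R) := (w ^+ 2 + U k)%:E.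
have mF k : measurable_fun setT (F k).
  by apply/measurable_EFinP; apply: measurable_funD => //; exact: exprn_measurable.
have F0 k w : (0 <= F k w)%E by rewrite lee_fin addr_ge0 ?sqr_ge0.
have step k w : (k < n)%N -> (\int[P]_t F k.+1 (w + (g k \o X k) t)%R <= (1 : R)%:E * F k w)%E.
  move=> kn; rewrite mul1e /F /=.
  have mx2 : measurable_fun setT (fun x : R => (w + (x ^+ 2 - s k ^+ 2)) ^+ 2 + U k.+1).
    by apply: measurable_funD => //; apply: measurable_funX; apply: measurable_funD => //; exact: mg.
  have := @integral_le_cubic _ _ _ P (X k)
    (fun x => (w + (x ^+ 2 - s k ^+ 2)) ^+ 2 + U k.+1) (fun x => x ^+ 4)
    ((w - s k ^+ 2) ^+ 2 + U k.+1) 0 (2 * (w - s k ^+ 2)) 0 _ _ (u k) (mX k kn) mx2.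
  move=> /(_ _ _ _ _ _)/le_trans; apply.
  - by move=> x; rewrite addr_ge0 ?sqr_ge0.
  - exact: exprn_measurable.
  - by move=> x; rewrite (exprM _ 2 2) sqr_ge0.
  - exact: mu4.
  - by move=> x; rewrite le_eqVlt; apply/orP; left; apply/eqP; ring.
  rewrite lee_fin mul0r addr0 /U [X in _ <= _ + X]big_ltn//.
  by have := sqr_ge0 (s k ^+ 2); lra.
have tl := telescoping indY mF F0 (fun=> ler01) step.
have {}tl : (\int[P]_w ((\sum_(i < n) X i w ^+ 2 - \sum_(i < n) s i ^+ 2) ^+ 2)%:E <=
    (\sum_(i < n) u i)%:E)%E.
  move: tl; rewrite big1_eq mul1e /F expr0n/= add0r /U big_mkord.
  apply: le_trans; rewrite le_eqVlt; apply/orP; left; apply/eqP.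
  apply: eq_integral => w _; rewrite big_geq// addr0 /psum/=; congr ((_ ^+ 2)%:E).
  by rewrite sumrB.
set A := [set w | _].
pose V w := \sum_(i < n) X i w ^+ 2 - \sum_(i < n) s i ^+ 2.
have mV : measurable_fun setT V.
  by apply: measurable_funB => //; apply: measurable_sum => i; exact: measurable_funX.
have mA : measurable A.
  have -> : A = (fun w => `|V w|) @^-1` (`[e, +oo[)%classic.
    by apply/seteqP; split => w; rewrite /A/= /V in_itv/= andbT.
  by rewrite -[X in measurable X]setTI; apply: measurableT_comp.
have e20 : 0 < e ^- 2 by rewrite invr_gt0 exprn_gt0.
apply: (@le_trans _ _ (\int[P]_w ((e ^- 2)%:E * (V w ^+ 2)%:E))%E).
  apply: prob_le_integral => //.
  - by apply: measurable_funeM; apply/measurable_EFinP; exact: measurable_funX.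
  - by move=> w; rewrite -EFinM lee_fin mulr_ge0 ?sqr_ge0// ltW.
  - move=> w; rewrite /A/= -/(V w) => eV; rewrite -EFinM lee_fin.
    rewrite mulrC ler_pdivlMr ?exprn_gt0// mul1r -[leRHS]real_normK ?num_real//.
    by rewrite lerXn2r// ?nnegrE ltW.
rewrite ge0_integralZl//=; last 3 first.
- by apply/measurable_EFinP; exact: measurable_funX.
- by move=> w _; rewrite lee_fin sqr_ge0.
- by rewrite lee_fin ltW.
by rewrite mulrC EFinM lee_wpmul2l// lee_fin ltW.
Qed.

End deviation_bounds.

(** * Removing the self-normalization *)

Section deterministic.
Context (R : realType).

Lemma cauchy_schwarz_sum n (a b : 'I_n -> R) :
  (\sum_i a i * b i) ^+ 2 <= (\sum_i a i ^+ 2) * (\sum_i b i ^+ 2).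
Proof.
set A := \sum_i a i ^+ 2; set B := \sum_i b i ^+ 2; set C := \sum_i a i * b i.
have A0 : 0 <= A by apply: sumr_ge0 => i _; exact: sqr_ge0.
have B0 : 0 <= B by apply: sumr_ge0 => i _; exact: sqr_ge0.
have h (x y : R) : 0 <= x ^+ 2 * A - 2 * x * y * C + y ^+ 2 * B.
  have -> : x ^+ 2 * A - 2 * x * y * C + y ^+ 2 * B = \sum_i (x * a i - y * b i) ^+ 2.
    rewrite /A /B /C !mulr_sumr -sumrN -!big_split/=.
    by apply: eq_bigr => i _; ring.
  by apply: sumr_ge0 => i _; exact: sqr_ge0.
have [B00|B00] := eqVneq B 0.
  have C0 : C = 0.
    have := h 1 ((A + 1) / (2 * C)); rewrite B00 mulr0 addr0 expr1n mul1r mulr1.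
    apply: contraTeq => Cn0; rewrite -ltNge.
    have -> : A - 2 * ((A + 1) / (2 * C)) * C = -1 by field.
    by rewrite oppr_lt0.
  by rewrite C0 B00 mulr0 expr0n.
have Bp : 0 < B by rewrite lt_neqAle eq_sym B00.
have := h B C.
have -> : B ^+ 2 * A - 2 * B * C * C + C ^+ 2 * B = B * (A * B - C ^+ 2) by ring.
by rewrite pmulr_rge0// subr_ge0.
Qed.

Variables (n : nat) (X : 'I_n -> R).
Let S := \sum_i X i.
Let V := Num.sqrt (\sum_i X i ^+ 2).
Let N := \sum_i exceed1 (X i).
Let Sa := \sum_i replace_large 0 (X i).
Let Va := Num.sqrt (\sum_i sq1 (X i)).

Lemma count_nat : N = 0 \/ 1 <= N.
Proof.
have [|h] := boolP [forall i, `|X i| <= 1].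
  move=> /forallP h; left; rewrite /N big1//= => i _.
  by rewrite /exceed1 h.
right; move: h; rewrite negb_forall => /existsP[i hi].
rewrite /N (bigD1 i)//= {1}/exceed1 (negbTE hi) lerDl.
by apply: sumr_ge0 => j _; exact: exceed1_ge0.
Qed.

Lemma sum_replace_large D : \sum_i replace_large D (X i) = Sa + D * N.
Proof.
rewrite /Sa /N mulr_sumr -big_split/=; apply: eq_bigr => i _.
by rewrite /replace_large /exceed1; case: ifP => _; rewrite ?mulr0 ?addr0 ?add0r ?mulr1.
Qed.

(** The contribution sb of the large terms to S satisfies sb ^+ 2 <= N * U2 with
    U2 their sum of squares, and V ^+ 2 = Va ^+ 2 + U2.  A second use of
    Cauchy-Schwarz gives (x - N / x) * Va + sb <= x * V because
    (x - N / x) ^+ 2 + N <= x ^+ 2.  So large terms help S by no more than they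
    help x V, except for the loss N / x * Va. *)
Lemma truncated_lower (x : R) : 0 <= x -> N <= x ^+ 2 \/ N = 0 ->
  x * V - S + Sa >= (x - N / x) * Va.
Proof.
move=> x0 hN.
pose b i := X i - replace_large 0 (X i).
have Sb : S = Sa + \sum_i b i.
  by rewrite /S /Sa -big_split/=; apply: eq_bigr => i _; rewrite /b addrC subrK.
have Vb : \sum_i X i ^+ 2 = \sum_i sq1 (X i) + \sum_i b i ^+ 2.
  rewrite -big_split/=; apply: eq_bigr => i _; rewrite /b /sq1 /replace_large.
  by case: ifP => _; rewrite ?subrr ?subr0 ?expr0n/= ?addr0 ?add0r.
have cs : (\sum_i b i) ^+ 2 <= N * (\sum_i b i ^+ 2).
  have -> : \sum_i b i = \sum_i exceed1 (X i) * b i.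
    apply: eq_bigr => i _; rewrite /b /replace_large /exceed1.
    by case: ifP => _; rewrite ?subrr ?mulr0// mul1r.
  apply: (le_trans (cauchy_schwarz_sum _ _)); rewrite ler_wpM2r//.
    by apply: sumr_ge0 => i _; exact: sqr_ge0.
  rewrite /N le_eqVlt; apply/orP; left; apply/eqP; apply: eq_bigr => i _.
  by rewrite /exceed1; case: ifP => _; rewrite ?expr0n ?expr1n.
set sb := \sum_i b i in Sb cs *; set U2 := \sum_i b i ^+ 2 in Vb cs.
have U20 : 0 <= U2 by apply: sumr_ge0 => i _; exact: sqr_ge0.
have W20 : 0 <= \sum_i sq1 (X i) by apply: sumr_ge0 => i _; exact: sq1_ge0.
have Va2 : Va ^+ 2 = \sum_i sq1 (X i) by rewrite sqr_sqrtr.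
have V2 : V ^+ 2 = Va ^+ 2 + U2 by rewrite Va2 sqr_sqrtr ?Vb// addr_ge0.
have Va0 : 0 <= Va := sqrtr_ge0 _.
have V0 : 0 <= V := sqrtr_ge0 _.
have N0 : 0 <= N by apply: sumr_ge0 => i _; exact: exceed1_ge0.
suff : (x - N / x) * Va + sb <= x * V by rewrite Sb; lra.
have [N00|Nn0] := eqVneq N 0.
  have -> : sb = 0.
    by apply/eqP; rewrite -sqrf_eq0 eq_le sqr_ge0 andbT (le_trans cs)// N00 mul0r.
  rewrite N00 mul0r subr0 addr0 ler_wpM2l//.
  by rewrite -(@ler_pXn2r _ 2)// ?nnegrE// V2 lerDl.
have {hN} N1 : N <= x ^+ 2 by case: hN => // h; rewrite h eqxx in Nn0.
have Np : 0 < N by rewrite lt_neqAle eq_sym Nn0.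
have xp : 0 < x.
  rewrite lt_neqAle x0 andbT; apply/eqP => xx; move: N1; rewrite -xx expr0n/=; lra.
have y2 : (x - N / x) ^+ 2 <= x ^+ 2 - N.
  have -> : (x - N / x) ^+ 2 = x ^+ 2 - N - (N - N * (N / x ^+ 2)).
    by field; rewrite gt_eqF.
  rewrite gerBl subr_ge0 ler_piMr// ler_pdivrMr ?exprn_gt0// mul1r//.
apply: le_trans (ler_norm _) _.
rewrite -(@ler_pXn2r _ 2)// ?nnegrE ?mulr_ge0// real_normK ?num_real//.
set y := x - N / x in y2 *.
rewrite exprMn V2.
(* Cauchy-Schwarz for the vectors (y, sqrt N) and (Va, sb / sqrt N). *)
have cs' : sb ^+ 2 / N <= U2 by rewrite ler_pdivrMr// mulrC.
apply: (@le_trans _ _ ((y ^+ 2 + N) * (Va ^+ 2 + sb ^+ 2 / N))).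
  rewrite -subr_ge0.
  have -> : (y ^+ 2 + N) * (Va ^+ 2 + sb ^+ 2 / N) - (y * Va + sb) ^+ 2 =
    (y * sb - N * Va) ^+ 2 / N by field; rewrite gt_eqF.
  by rewrite divr_ge0// sqr_ge0.
apply: ler_pM.
- by rewrite addr_ge0// sqr_ge0.
- by rewrite addr_ge0 ?divr_ge0 ?sqr_ge0// sqr_ge0.
- lra.
- by rewrite lerD2l.
Qed.

(** By truncated_lower the sum of the small terms is at least
    x * Va - N / x * Va, up to c / 2.  As Va is about lam = K * (1 + x) and
    x >= 1 as soon as N > 0, the loss N / x * lam is at most 2 K N, which is
    exactly what the N replaced terms contribute. *)
Lemma studentized_inclusion_nonneg (x K c h : R) : 0 <= x -> 1 <= K -> 0 <= h ->
  h <= (K * (1 + x)) ^+ 2 -> h <= c * K / 2 ->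
  N <= x ^+ 2 \/ N = 0 ->
  (K * (1 + x)) ^+ 2 - h <= \sum_i sq1 (X i) ->
  x * V - c / 2 <= S ->
  K * (1 + x) * x - c <= \sum_i replace_large (2 * K) (X i).
Proof.
move=> x0 K1 h0 hl hc hN hV hS; rewrite sum_replace_large.
have := truncated_lower x0 hN.
set lam := K * (1 + x) in hl hV *.
have lam1 : 1 <= lam by rewrite /lam; nra.
have lam0 : 0 < lam by lra.
have Vale : lam - h / lam <= Va.
  have hl0 : 0 <= lam - h / lam by rewrite subr_ge0 ler_pdivrMr// -expr2.
  rewrite -(@ler_pXn2r _ 2)// ?nnegrE ?sqrtr_ge0// sqr_sqrtr; last first.
    by apply: sumr_ge0 => i _; exact: sq1_ge0.
  apply: le_trans hV.
  have -> : (lam - h / lam) ^+ 2 = lam ^+ 2 - h - (h - h * (h / lam ^+ 2)).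
    by field; rewrite gt_eqF.
  by rewrite gerBl subr_ge0 ler_piMr// ler_pdivrMr ?exprn_gt0// mul1r.
have N0 : 0 <= N by apply: sumr_ge0 => i _; exact: exceed1_ge0.
have y0 : 0 <= x - N / x.
  have [xx|xn] := eqVneq x 0; first by rewrite xx invr0 mulr0 subr0.
  have xp : 0 < x by rewrite lt_neqAle eq_sym xn.
  rewrite subr_ge0 ler_pdivrMr// -expr2; case: hN => // ->; exact: sqr_ge0.
have e1 : (x - N / x) * (lam - h / lam) <= (x - N / x) * Va by rewrite ler_wpM2l.
have Nx0 : 0 <= N / x by rewrite divr_ge0.
have hlam : 0 <= h / lam by rewrite divr_ge0// ltW.
have e2 : x * (h / lam) <= c / 2.
  rewrite mulrCA.
  have : x / lam <= 1 / K.
    by rewrite ler_pdivrMr// mulrC mulrA ler_pdivlMr; rewrite /lam; nra.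
  have K0 : 0 < K by lra.
  move=> hx; apply: (@le_trans _ _ (h * (1 / K))); first by rewrite ler_wpM2l.
  by rewrite mulrA mulr1 ler_pdivrMr//; lra.
have e3 : N / x * lam <= 2 * K * N.
  have [N00|N1] := count_nat; first by rewrite N00 !mul0r mulr0.
  have Nx : N <= x ^+ 2 by case: hN => // h1; lra.
  have x1 : 1 <= x by rewrite -(@ler_pXn2r _ 2)// ?nnegrE// expr1n; lra.
  have xp : 0 < x by lra.
  rewrite mulrAC ler_pdivrMr//.
  have -> : N * lam = K * N * (1 + x) by rewrite /lam; ring.
  have -> : 2 * K * N * x = K * N * (2 * x) by ring.
  by rewrite ler_wpM2l ?mulr_ge0//; lra.
have e4 : (x - N / x) * (lam - h / lam) >= x * lam - N / x * lam - x * (h / lam).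
  have -> : (x - N / x) * (lam - h / lam) = x * lam - N / x * lam - x * (h / lam) + N / x * (h / lam) by ring.
  by rewrite lerDl mulr_ge0.
lra.
Qed.

(** For negative x a smaller V makes the event x * V <= S harder, so V must be
    bounded from above; since x is bounded from below a relative error e in
    V ^+ 2 is negligible.  The alternative V <= lam / 2, which covers a
    vanishing studentization, is excluded by the same concentration. *)
Lemma studentized_inclusion_neg (x K c e M : R) : x < 0 -> - M <= x -> 1 <= K -> 0 <= e ->
  2 * K ^+ 2 * (1 + M) ^+ 2 * e <= c ->
  e <= 1 / 2 ->
  N = 0 ->
  `|\sum_i X i ^+ 2 - (K * (1 + `|x|)) ^+ 2| <= e * (K * (1 + `|x|)) ^+ 2 ->
  x * V - c / 2 <= S \/ V <= K * (1 + `|x|) / 2 ->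
  K * (1 + `|x|) * x - c <= \sum_i replace_large (2 * K) (X i).
Proof.
move=> x0 xM K1 e0 ec e12 N00 hV.
set lam := K * (1 + `|x|) in hV *.
have ax : `|x| = - x by rewrite ltr0_norm.
have lam1 : 1 <= lam by rewrite /lam ax; nra.
have V0 : 0 <= V := sqrtr_ge0 _.
have V2 : V ^+ 2 = \sum_i X i ^+ 2.
  by rewrite sqr_sqrtr// sumr_ge0// => i _; exact: sqr_ge0.
move: hV; rewrite -V2 ler_norml => /andP[h1 h2].
have l2 : 1 <= lam ^+ 2 by rewrite exprn_ege1.
case=> [hS|hV]; last first.
  have : V ^+ 2 <= (lam / 2) ^+ 2 by rewrite lerXn2r ?nnegrE//; lra.
  have -> : (lam / 2) ^+ 2 = lam ^+ 2 / 4 by field.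
  nra.
have Vle : V <= lam * (1 + e).
  have le0 : 0 <= lam * (1 + e) by rewrite mulr_ge0//; lra.
  rewrite -(@ler_pXn2r _ 2)// ?nnegrE//.
  have -> : (lam * (1 + e)) ^+ 2 = lam ^+ 2 * (1 + e) + lam ^+ 2 * (e * (1 + e)) by ring.
  have : 0 <= lam ^+ 2 * (e * (1 + e)) by rewrite mulr_ge0 ?sqr_ge0// mulr_ge0//; lra.
  lra.
have SE : \sum_i replace_large (2 * K) (X i) = S.
  rewrite sum_replace_large N00 mulr0 addr0 /S /Sa; apply: eq_bigr => i _.
  rewrite /replace_large; case: ifPn => // hi; move: N00; rewrite /N (bigD1 i)//= {1}/exceed1 (negbTE hi).
  move=> /eqP; rewrite paddr_eq0 ?oner_eq0//; apply: sumr_ge0 => j _; exact: exceed1_ge0.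
rewrite SE.
have xV : x * (lam * (1 + e)) <= x * V by rewrite ler_nM2l.
have : - x * lam * e <= c / 2.
  have M0 : 0 <= M by lra.
  have a1 : - x * lam <= K ^+ 2 * (1 + M) ^+ 2.
    apply: (@le_trans _ _ ((1 + M) * (K * (1 + M)))).
      rewrite ler_pM//; [lra|lra|lra|].
      by rewrite /lam ax ler_wpM2l//; lra.
    have -> : (1 + M) * (K * (1 + M)) = K * (1 + M) ^+ 2 by ring.
    by rewrite ler_wpM2r ?sqr_ge0//; nra.
  have : - x * lam * e <= K ^+ 2 * (1 + M) ^+ 2 * e by rewrite ler_wpM2r.
  lra.
lra.
Qed.
End deterministic.

Section exponential_bounds.
Context (R : realType).

Lemma expR_le1D2 (y : R) : 0 <= y <= 1 -> expR y <= 1 + 2 * y.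
Proof.
move=> /andP[y0 y1]; have := expR_taylor3 y1; rewrite (ger0_norm y0) => /ler_normlW.
have : y ^+ 2 <= y by rewrite expr2 ler_piMl.
have : y ^+ 3 <= y by rewrite exprS ler_piMr// exprn_ile1.
lra.
Qed.

(** The error exp (- x ^+ 2) of the exceedance bound is of smaller order than
    1 - Phi x, whose exponent is - x ^+ 2 / 2. *)
Lemma Phi_bar_gauss_lower (x : R) :
  expR (- x ^+ 2) <= expR 2 / normal_peak 1 * Phi_bar x.
Proof.
have pk : 0 < normal_peak (1 : R) by rewrite normal_peak_gt0// oner_neq0.
have h := Phi_bar_lower x; rewrite phiE in h.
have h2 : 1 + `|x| <= expR ((1 + x ^+ 2) / 2).
  apply: (le_trans (expR_ge1Dx _)); rewrite ler_expR.
  by have := sqr_ge0 (`|x| - 1); rewrite sqrrB expr1n real_normK ?num_real//; lra.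
have h3 : expR (- (3 / 2)) * (normal_peak 1 * expR (- x ^+ 2 / 2)) <=
    expR ((1 + x ^+ 2) / 2) * Phi_bar x.
  by apply: (le_trans h); rewrite ler_wpM2r// Phi_bar_ge0.
have h4 : expR (- ((1 + x ^+ 2) / 2)) * expR ((1 + x ^+ 2) / 2) = 1 :> R.
  by rewrite -expRD addrC subrr expR0.
have h5 : expR (- ((1 + x ^+ 2) / 2)) * (expR (- (3 / 2)) * (normal_peak 1 * expR (- x ^+ 2 / 2))) <= Phi_bar x.
  apply: (@le_trans _ _ (expR (- ((1 + x ^+ 2) / 2)) * (expR ((1 + x ^+ 2) / 2) * Phi_bar x))).
    by rewrite ler_wpM2l ?expR_ge0.
  by rewrite mulrA h4 mul1r.
rewrite -mulrA [_^-1 * _]mulrC mulrA ler_pdivlMr//.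
have -> : expR (- x ^+ 2) * normal_peak 1 = expR 2 * (expR (- ((1 + x ^+ 2) / 2)) *
   (expR (- (3 / 2)) * (normal_peak 1 * expR (- x ^+ 2 / 2)))).
  have -> : expR (- x ^+ 2) = expR 2 * expR (- ((1 + x ^+ 2) / 2)) * expR (- (3 / 2)) *
      expR (- x ^+ 2 / 2) by rewrite -!expRD; congr expR; field.
  ring.
by rewrite ler_wpM2l ?expR_ge0.
Qed.

Lemma Phi_bar_nonincreasing (x y : R) : x <= y -> Phi_bar y <= Phi_bar x.
Proof. by move=> /Phi_nondecreasing; rewrite !Phi_eq_bar; lra. Qed.

End exponential_bounds.

(** * Moderate deviations of self-normalized sums *)

Section studentized.
Context d (T : measurableType d) (R : realType) (P : probability T R).

Lemma measure_le_setU2 (A B1 B2 B3 : set T) (b1 b2 b3 : R) :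
  measurable A -> measurable B1 -> measurable B2 -> measurable B3 ->
  A `<=` B1 `|` B2 `|` B3 ->
  (P B1 <= b1%:E)%E -> (P B2 <= b2%:E)%E -> (P B3 <= b3%:E)%E ->
  (P A <= (b1 + b2 + b3)%:E)%E.
Proof.
move=> mA m1 m2 m3 AB h1 h2 h3.
apply: (@le_trans _ _ (P (B1 `|` B2 `|` B3))).
  by apply: le_measure; rewrite ?inE//; apply: measurableU => //; exact: measurableU.
apply: (le_trans (measureU2 _ _ _)) => //; first exact: measurableU.
rewrite EFinD leeD//; apply: (le_trans (measureU2 _ _ _)) => //.
by rewrite EFinD leeD.
Qed.

Lemma measurable_set_le (f g : T -> R) : measurable_fun setT f -> measurable_fun setT g ->
  measurable [set w | f w <= g w].
Proof.
move=> mf mg; rewrite (_ : [set w | _] = (fun w => g w - f w) @^-1` `[0, +oo[%classic).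
  by rewrite -[X in measurable X]setTI; apply: measurable_funB.
by apply/seteqP; split => w /=; rewrite in_itv/= andbT subr_ge0.
Qed.

Variables (n : nat) (X : nat -> {mfun T >-> R}) (s t u : nat -> R) (x K c : R).
Local Notation lam := (K * (1 + `|x|)).
Local Notation S w := (\sum_(i < n) X i w).
Local Notation V w := (Num.sqrt (\sum_(i < n) X i w ^+ 2)).
Local Notation Ts := (\sum_(i < n) t i).
Local Notation Us := (\sum_(i < n) u i).
Local Notation N w := (\sum_(i < n) exceed1 (X i w)).
Local Notation mdbound := ((1 + expR (- c)) * expR (stepC (2 * K) * Ts) *
   (Phi_bar x * (1 + 2 * expR (5 / 2) / (K / (2 * c) - 1)))).

Hypothesis indX : independent_upto P n X.
Hypothesis s0 : forall i, 0 <= s i.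
Hypothesis t0 : forall i, 0 <= t i.
Hypothesis u0 : forall i, 0 <= u i.
Hypothesis mX : forall i, (i < n)%N -> centered_moments P (X i) (s i ^+ 2) (t i).
Hypothesis muX : forall i, (i < n)%N -> (\int[P]_w (X i w ^+ 4)%:E = (u i)%:E)%E.
Hypothesis sS : \sum_(i < n) s i ^+ 2 = lam ^+ 2.
Hypothesis CT : stepC (2 * K) * Ts <= 1.
Hypothesis c12 : 1 / 2 <= c.
Hypothesis cK : 2 * c < K.

Let mV2 : measurable_fun setT (fun w => \sum_(i < n) X i w ^+ 2).
Proof. by apply: measurable_sum => i; exact: measurable_funX. Qed.

Let mN : measurable_fun setT (fun w => N w).
Proof.
by apply: measurable_sum => i; exact: (measurableT_comp (@measurable_exceed1 R)).
Qed.

Let mcst (r : R) : measurable_fun setT (fun _ : T => r).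
Proof. exact: measurable_cst. Qed.

Let W := [set w | lam * x - c <= \sum_(i < n) replace_large (2 * K) (X i w)].

Let mW : measurable W.
Proof.
apply: measurable_set_le => //; apply: measurable_sum => i.
exact: (measurableT_comp (measurable_replace_large (2 * K))).
Qed.

Let PW : (P W <= mdbound%:E)%E.
Proof.
have D0 : 0 <= 2 * K by move: c12 cK; lra.
exact: (moderate_deviation D0 indX s0 t0 mX sS CT c12 cK).
Qed.

Let mE y : measurable [set w | 1 <= N w /\ y <= N w].
Proof. by apply: measurableI; exact: measurable_set_le. Qed.

Let PE y := @exceedance_tail _ _ _ P n X (fun i => s i ^+ 2) t y indX t0 mX.

Let cK_half_le : c * K / 2 <= lam ^+ 2.
Proof.
have K1 : 1 <= K by move: c12 cK; lra.
apply: (@le_trans _ _ (K ^+ 2)); first by rewrite expr2; move: c12 cK K1; nra.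
by rewrite exprMn ler_peMr ?sqr_ge0// exprn_ege1// lerDl.
Qed.

(** The parameter of the Chernoff bound for the small squares is optimised at
    a = h / (4 * U0), with h = c * K / 2 the tolerated deviation. *)
Lemma studentized_tail_nonneg (U0 : R) (A : set T) : 0 <= x -> 0 < U0 -> Us <= U0 ->
  Ts <= c * K / 4 -> measurable A -> (forall w, A w -> x * V w - c / 2 <= S w) ->
  (P A <=
   (mdbound + 2 * expR (- x ^+ 2) * (expR (2 * Ts) - 1) +
    expR (- ((c * K) ^+ 2 / 64 / U0)))%:E)%E.
Proof.
move=> x0 U00 UU TT mA Ale.
have ax : `|x| = x by rewrite ger0_norm.
have K1 : 1 <= K by move: c12 cK; lra.
set h := c * K / 2.
have h0 : 0 <= h by rewrite /h divr_ge0// mulr_ge0//; move: c12 K1; lra.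
set a := h / (4 * U0).
have a0 : 0 <= a by rewrite /a divr_ge0// mulr_ge0// ltW.
have tsl := @truncated_squares_lower _ _ _ P n X s t u h a indX a0 mX muX.
have {}tsl : (P [set w | (\sum_(i < n) sq1 (X i w) <= \sum_(i < n) s i ^+ 2 - h)%R] <=
    (expR (- ((c * K) ^+ 2 / 64 / U0)))%:E)%E.
  apply: (le_trans tsl); rewrite lee_fin ler_expR.
  have aT : a * Ts <= a * (h / 2).
    by rewrite ler_wpM2l// (le_trans TT)// /h le_eqVlt; apply/orP; left; apply/eqP; field.
  have aU : a ^+ 2 * Us <= a ^+ 2 * U0 by rewrite ler_wpM2l// sqr_ge0.
  apply: (@le_trans _ _ (- (a * h) + a * (h / 2) + a ^+ 2 * U0)).
    by apply: lerD => //; apply: lerD.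
  rewrite le_eqVlt; apply/orP; left; apply/eqP; rewrite /a /h.
  by field; rewrite gt_eqF.
have mV1 : measurable [set w | \sum_(i < n) sq1 (X i w) <= \sum_(i < n) s i ^+ 2 - h].
  apply: measurable_set_le => //; apply: measurable_sum => i.
  exact: (measurableT_comp (@measurable_sq1 R)).
refine (measure_le_setU2 mA mW (mE (x ^+ 2)) mV1 _ PW (PE (x ^+ 2)) tsl).
move=> w Aw.
case: (leP (\sum_(i < n) sq1 (X i w)) (\sum_(i < n) s i ^+ 2 - h)) => hsq; first by right.
left.
have [hn|hn] := pselect (1 <= N w /\ x ^+ 2 <= N w); first by right.
left; rewrite /W/= ax.
apply: (@studentized_inclusion_nonneg R n (fun i => X i w) x K c h) => //.
+ by move: cK_half_le; rewrite ax.
+ have [hN|hN] := count_nat (fun i : 'I_n => X i w); first by right.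
  left; rewrite leNgt; apply/negP => hx; apply: hn; split => //; exact: ltW.
+ by move: hsq; rewrite sS ax => /ltW.
+ exact: Ale.
Qed.

Lemma studentized_tail_neg (M e : R) (A : set T) : x < 0 -> - M <= x -> 0 < e ->
  2 * K ^+ 2 * (1 + M) ^+ 2 * e <= c -> e <= 1 / 2 ->
  measurable A -> (forall w, A w -> x * V w - c / 2 <= S w \/ V w <= lam / 2) ->
  (P A <=
   (mdbound + 2 * (expR (2 * Ts) - 1) + Us / (e * lam ^+ 2) ^+ 2)%:E)%E.
Proof.
move=> x0 xM e0 ec e12 mA Ale.
have K1 : 1 <= K by move: c12 cK; lra.
have lam0 : 0 < lam by rewrite mulr_gt0 ?ltr_pwDl//; move: K1; lra.
have el0 : 0 < e * lam ^+ 2 by rewrite mulr_gt0// exprn_gt0.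
have cheb := @sum_squares_chebyshev _ _ _ P n X s t u _ indX el0 u0 mX muX.
have mC : measurable [set w | e * lam ^+ 2 <= `|\sum_(i < n) X i w ^+ 2 - \sum_(i < n) s i ^+ 2| ].
  apply: measurable_set_le => //; apply: measurableT_comp => //.
  exact: measurable_funB.
have PE0 := PE 0; rewrite oppr0 expR0 mulr1 in PE0.
refine (measure_le_setU2 mA mW (mE 0) mC _ PW PE0 cheb).
move=> w Aw.
case: (leP (e * lam ^+ 2) (`|\sum_(i < n) X i w ^+ 2 - \sum_(i < n) s i ^+ 2|)) => hsq;
  first by right.
left.
have [hN|hN] := count_nat (fun i : 'I_n => X i w); last first.
  by right; split => //; rewrite (le_trans _ hN).
left; rewrite /W/=.
apply: (@studentized_inclusion_neg R n (fun i => X i w) x K c e M) => //.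
- exact: ltW.
- by move: hsq; rewrite sS => /ltW.
- exact: Ale.
Qed.

End studentized.

Section constants.
Context (R : realType).
Implicit Types (eps c K m x L : R).

(** The three error factors (logistic instead of indicator, replacement,
    smoothing on the left of x) are each at most 1 + eps / 8. *)
Lemma moderate_constant eps c K y : 0 < eps <= 1 -> 8 / eps <= c ->
  2 * c * (1 + 16 * expR (5 / 2) / eps) <= K -> 0 <= y <= eps / 16 ->
  (1 + expR (- c)) * expR y * (1 + 2 * expR (5 / 2) / (K / (2 * c) - 1)) <= 1 + eps / 2.
Proof.
move=> /andP[eps0 eps1] hc hK /andP[y0 y1].
have e50 : 0 < expR (5 / 2) :> R := expR_gt0 _.
have c8 : 8 <= c by rewrite (le_trans _ hc)// ler_pdivlMr//; lra.
have c0 : 0 < c by lra.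
have a1 : expR (- c) <= eps / 8.
  rewrite expRN; apply: (@le_trans _ _ (c^-1)).
    rewrite lef_pV2 ?posrE ?expR_gt0//.
    by rewrite (le_trans _ (expR_ge1Dx _))//; lra.
  rewrite -[leRHS]invrK lef_pV2 ?posrE ?invr_gt0//; last by rewrite divr_gt0.
  by rewrite invfM invrK mulrC.
have a2 : expR y <= 1 + eps / 8.
  apply: (le_trans (expR_le1D2 _)); first by rewrite y0/=; lra.
  lra.
have kk : 16 * expR (5 / 2) / eps <= K / (2 * c) - 1.
  rewrite lerBrDl ler_pdivlMr ?mulr_gt0//.
  by rewrite mulrC.
have kk0 : 0 < 16 * expR (5 / 2) / eps by rewrite divr_gt0// mulr_gt0.
have kp : 0 < K / (2 * c) - 1 by apply: lt_le_trans kk.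
have a3 : 2 * expR (5 / 2) / (K / (2 * c) - 1) <= eps / 8.
  rewrite ler_pdivrMr//.
  apply: (@le_trans _ _ (eps / 8 * (16 * expR (5 / 2) / eps))).
    by rewrite le_eqVlt; apply/orP; left; apply/eqP; field; rewrite gt_eqF.
  by rewrite ler_wpM2l//; lra.
have q0 : 0 <= 2 * expR (5 / 2) / (K / (2 * c) - 1).
  by rewrite divr_ge0 ?mulr_ge0 ?(ltW e50)// ltW.
move: a1 a2 a3 q0; set q := _ / (_ - 1); have := expR_ge0 (- c); have := expR_ge0 y.
set a := expR (- c); set b := expR y.
clear -eps0 eps1 => b0 a0 a1 b1 q1 q0.
have p0 : 0 <= 1 + eps / 8 by lra.
have f1 : (1 + a) * b <= (1 + eps / 8) * (1 + eps / 8) by rewrite ler_pM//; lra.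
have f2 : (1 + a) * b * (1 + q) <= (1 + eps / 8) * (1 + eps / 8) * (1 + eps / 8).
  rewrite ler_pM//; [by rewrite mulr_ge0//; lra|lra|lra].
apply: (le_trans f2).
have : eps ^+ 2 <= eps by rewrite expr2 ler_piMl// ltW.
have : eps ^+ 3 <= eps by rewrite exprS ler_piMr ?(ltW eps0)// exprn_ile1// ltW.
have -> : (1 + eps / 8) * (1 + eps / 8) * (1 + eps / 8) =
  1 + 3 / 8 * eps + 3 / 64 * eps ^+ 2 + 1 / 512 * eps ^+ 3 by field.
lra.
Qed.

Lemma exceedance_constant m : 0 <= m <= 1 / 2 -> 0 <= expR (2 * m) - 1 <= 4 * m.
Proof.
move=> /andP[m0 m1]; apply/andP; split; first by rewrite subr_ge0 -expR0 ler_expR mulr_ge0.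
have /expR_le1D2 : 0 <= 2 * m <= 1 by rewrite mulr_ge0//=; lra.
lra.
Qed.

End constants.

Section studentized_tail.
Context (R : realType).

Lemma exists_lower_bound (l : seq R) : all (fun a => 0 < a) l ->
  exists2 m : R, 0 < m & all (fun a => m <= a) l.
Proof.
elim: l => [|a l IH] /=; first by exists 1.
move=> /andP[a0 /IH[m m0 ml]]; exists (Num.min a m); first by rewrite lt_min a0.
rewrite ge_min lexx/=; apply/allP => b /(allP ml) mb.
by rewrite ge_min mb orbT.
Qed.

(** The alternative x < 0 with V <= lam / 2 is there for vanishing denominators:
    a t-statistic with denominator 0 has the value 0, which exceeds x exactly
    when x < 0.  The additive term is the lower tail of the sum of squares; it
    is small even after multiplication by the number of hypotheses, unlike any
    bound obtained from Chebyshev's inequality. *)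
Theorem studentized_tail (eps M : R) : 0 < eps <= 1 -> 0 <= M ->
  exists K eta : R, [/\ 1 <= K, 0 < eta &
  forall d (T : measurableType d) (P : probability T R) n (X : nat -> {mfun T >-> R})
    (s t u : nat -> R) (x L : R) (A : set T),
  independent_upto P n X ->
  (forall i, 0 <= s i) -> (forall i, 0 <= t i) -> (forall i, 0 <= u i) ->
  (forall i, (i < n)%N -> centered_moments P (X i) (s i ^+ 2) (t i)) ->
  (forall i, (i < n)%N -> (\int[P]_w (X i w ^+ 4)%:E = (u i)%:E)%E) ->
  \sum_(i < n) s i ^+ 2 = (K * (1 + `|x|)) ^+ 2 ->
  \sum_(i < n) t i <= (K * (1 + `|x|)) ^+ 3 * L ->
  \sum_(i < n) u i <= (K * (1 + `|x|)) ^+ 4 * L ^+ 2 ->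
  - M <= x -> 0 < L -> (1 + `|x|) ^+ 3 * L <= eta ->
  measurable A ->
  (forall w, A w -> let V := Num.sqrt (\sum_(i < n) X i w ^+ 2) in
     x * V - 1 / 2 <= \sum_(i < n) X i w \/ x < 0 /\ V <= K * (1 + `|x|) / 2) ->
  (P A <= ((1 + eps) * Phi_bar x + expR (- (eta / ((1 + `|x|) ^+ 4 * L ^+ 2))))%:E)%E].
Proof.
move=> /andP[eps0 eps1] M0.
pose c := 8 / eps.
have c8 : 8 <= c by rewrite /c ler_pdivlMr//; lra.
have c0 : 0 < c by lra.
have e50 : 0 < expR (5 / 2) :> R := expR_gt0 _.
(* c makes the logistic function sharp enough, and K makes the smoothing at
   scale 1 / lam harmless (moderate_constant). *)
pose K := 2 * c * (1 + 16 * expR (5 / 2) / eps).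
have K2c : 2 * c < K.
  rewrite /K mulrDr mulr1 ltrDl mulr_gt0//; first by rewrite mulr_gt0.
  by rewrite divr_gt0// mulr_gt0.
have hK : 2 * c * (1 + 16 * expR (5 / 2) / eps) <= K by [].
clearbody K.
have K1 : 1 <= K by lra.
have K0 : 0 < K by lra.
pose G : R := expR 2 / normal_peak 1.
have G0 : 0 < G by rewrite /G divr_gt0 ?expR_gt0// normal_peak_gt0// oner_neq0.
have Q00 : 0 < Phi_bar (0 : R) := Phi_bar_gt0 0.
have C0 := stepC_gt0 (2 * K).
(* The relative error of the sum of squares that x >= - M tolerates. *)
pose e := c / (2 * K ^+ 2 * (1 + M) ^+ 2).
have M1 : 0 < (1 + M) ^+ 2 by rewrite exprn_gt0//; lra.
have K20 : 0 < 2 * K ^+ 2 * (1 + M) ^+ 2 by rewrite mulr_gt0// mulr_gt0// exprn_gt0.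
have e0 : 0 < e by rewrite /e divr_gt0.
have e12 : e <= 1 / 2.
  rewrite /e ler_pdivrMr//.
  have : 1 <= (1 + M) ^+ 2 by rewrite exprn_ege1//; lra.
  have : K <= K ^+ 2 by rewrite expr2 ler_peMr// ltW.
  move: K2c K1; clear; set a := K ^+ 2; set b := (1 + M) ^+ 2; nra.
(* m bounds the sum of the third moments as well as L; every entry makes one
   error term small relative to eps * Phi_bar x or meets a hypothesis of the two
   tail lemmas. *)
have [|m m0] := @exists_lower_bound [:: 1; eps / (16 * stepC (2 * K)); eps / (16 * G);
   eps * Phi_bar 0 / 32; 1 / 2; c * K / 4; e ^+ 2 * eps * Phi_bar 0 / 4; (c * K) ^+ 2 / 64].
  have e20 : 0 < e ^+ 2 by rewrite exprn_gt0.
  rewrite /= andbT; apply/and5P; split => //; last (apply/and4P; split => //).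
  - by rewrite divr_gt0// mulr_gt0.
  - by rewrite divr_gt0// mulr_gt0.
  - by rewrite divr_gt0// mulr_gt0.
  - by rewrite divr_gt0// mulr_gt0.
  - by rewrite divr_gt0// mulr_gt0// mulr_gt0.
  - by rewrite divr_gt0// exprn_gt0// mulr_gt0.
rewrite /= andbT => /and5P[m1 mC mG mQ /and4P[m12 mh me mhh]].
have K4 : 0 < K ^+ 4 by rewrite exprn_gt0.
have mC' : stepC (2 * K) * m <= eps / 16.
  by move: mC; rewrite invfM mulrA ler_pdivlMr// mulrC.
have mG' : G * m <= eps / 16.
  by move: mG; rewrite invfM mulrA ler_pdivlMr// mulrC.
have ec : 2 * K ^+ 2 * (1 + M) ^+ 2 * e <= c by rewrite /e mulrC mulfVK// gt_eqF.
have xbound x y : 0 <= y <= m -> 2 * expR (- x ^+ 2) * (expR (2 * y) - 1) <= eps / 2 * Phi_bar x.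
  move=> /andP[y0 ym].
  have /andP[z0 z1] : 0 <= expR (2 * y) - 1 <= 4 * y.
    by apply: exceedance_constant; rewrite y0 (le_trans ym).
  have gl := Phi_bar_gauss_lower x; rewrite -/G in gl.
  apply: (@le_trans _ _ (2 * (G * Phi_bar x) * (4 * y))).
    by apply: ler_pM => //; rewrite ?mulr_ge0 ?expR_ge0// ler_pM2l.
  have -> : 2 * (G * Phi_bar x) * (4 * y) = 8 * (G * y) * Phi_bar x by ring.
  rewrite ler_wpM2r ?Phi_bar_ge0//.
  have : G * y <= G * m by rewrite ler_pM2l.
  by move: mG'; clear; lra.
have xbound_neg x y : x < 0 -> 0 <= y <= m -> 2 * (expR (2 * y) - 1) <= eps / 4 * Phi_bar x.
  move=> x0 /andP[y0 ym].
  have /andP[z0 z1] : 0 <= expR (2 * y) - 1 <= 4 * y.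
    by apply: exceedance_constant; rewrite y0 (le_trans ym).
  have : eps * Phi_bar 0 <= eps * Phi_bar x by rewrite ler_pM2l// Phi_bar_nonincreasing// ltW.
  by move: mQ z1 ym; clear; lra.
have sqbound x y : x < 0 -> 0 <= y <= m -> y ^+ 2 / e ^+ 2 <= eps / 4 * Phi_bar x.
  move=> x0 /andP[y0 ym]; rewrite ler_pdivrMr ?exprn_gt0//.
  have y1 : y <= 1 by exact: le_trans ym m1.
  have : y ^+ 2 <= y by rewrite expr2 ler_piMl.
  have : e ^+ 2 * eps * Phi_bar 0 <= e ^+ 2 * eps * Phi_bar x.
    have ee : 0 <= e ^+ 2 * eps by apply: mulr_ge0; [exact: sqr_ge0|exact: ltW].
    by rewrite ler_wpM2l// Phi_bar_nonincreasing// ltW.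
  by move: me ym; clear; lra.
exists K, (m / K ^+ 4); split => //; first by rewrite divr_gt0.
move=> d T P n X s t u x L A indX s0 t0 u0 mX muX sS sT sU xM L0 hL mA Ale.
have ax1 : 1 <= 1 + `|x| by rewrite lerDl.
have Tm : 0 <= \sum_(i < n) t i <= m.
  rewrite sumr_ge0//=; apply: (le_trans sT); rewrite exprMn -mulrA.
  apply: (@le_trans _ _ (K ^+ 3 * (m / K ^+ 4))).
    by rewrite ler_wpM2l// exprn_ge0// ltW.
  have -> : K ^+ 3 * (m / K ^+ 4) = m / K by field; rewrite gt_eqF.
  by rewrite ler_pdivrMr// ler_peMr// ltW.
case/andP: (Tm) => T0 Tm1.
have Lm : 0 <= L <= m.
  rewrite (ltW L0)/=; apply: (@le_trans _ _ ((1 + `|x|) ^+ 3 * L)).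
    by rewrite ler_peMl ?exprn_ege1// ltW.
  by apply: (le_trans hL); rewrite ler_pdivrMr// ler_peMr ?exprn_ege1// ltW.
have CT16 : stepC (2 * K) * (\sum_(i < n) t i) <= eps / 16.
  by apply: le_trans mC'; rewrite ler_pM2l.
have CT : stepC (2 * K) * (\sum_(i < n) t i) <= 1.
  by apply: (le_trans CT16); move: eps1; clear; lra.
have c12 : 1 / 2 <= c by move: c8; clear; lra.
have Qx := Phi_bar_ge0 x.
have md : (1 + expR (- c)) * expR (stepC (2 * K) * \sum_(i < n) t i) *
   (Phi_bar x * (1 + 2 * expR (5 / 2) / (K / (2 * c) - 1))) <= (1 + eps / 2) * Phi_bar x.
  rewrite [Phi_bar x * _]mulrC mulrA ler_wpM2r//.
  apply: moderate_constant => //; first by rewrite eps0.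
  by rewrite CT16 andbT mulr_ge0// ltW.
have lamK : m / K ^+ 4 / ((1 + `|x|) ^+ 4 * L ^+ 2) = m / ((K * (1 + `|x|)) ^+ 4 * L ^+ 2).
  by rewrite exprMn -(mulrA (K ^+ 4)) (invfM (K ^+ 4)) [RHS]mulrA.
have lam0 : 0 < K * (1 + `|x|) by rewrite mulr_gt0// (lt_le_trans ltr01).
have noise w : A w -> x * Num.sqrt (\sum_(i < n) X i w ^+ 2) - c / 2 <= \sum_(i < n) X i w
    \/ x < 0 /\ Num.sqrt (\sum_(i < n) X i w ^+ 2) <= K * (1 + `|x|) / 2.
  move=> /Ale[h|h]; [left|by right]; apply: le_trans h; rewrite lerD2l lerN2.
  by move: c8; clear; lra.
have [x0|x0] := leP 0 x.
- have U0 : 0 < (K * (1 + `|x|)) ^+ 4 * L ^+ 2 by rewrite mulr_gt0 ?exprn_gt0.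
  have Ale' w : A w -> x * Num.sqrt (\sum_(i < n) X i w ^+ 2) - c / 2 <= \sum_(i < n) X i w.
    by move=> /noise[//|[xn]]; move: (lt_le_trans xn x0); rewrite ltxx.
  apply: (le_trans (studentized_tail_nonneg indX s0 t0 mX muX sS CT c12 K2c
    x0 U0 sU (le_trans Tm1 mh) mA Ale')).
  rewrite lee_fin; apply: lerD; last first.
    rewrite ler_expR lerN2 lamK ler_wpM2r//.
    by rewrite invr_ge0 ltW.
  have := xbound x _ Tm; move: md; clear; lra.
- have Ale' w : A w -> x * Num.sqrt (\sum_(i < n) X i w ^+ 2) - c / 2 <= \sum_(i < n) X i w
    \/ Num.sqrt (\sum_(i < n) X i w ^+ 2) <= K * (1 + `|x|) / 2.
    by move=> /noise[|[]]; [left|right].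
  apply: (le_trans (studentized_tail_neg indX s0 t0 u0 mX muX sS CT c12 K2c
    x0 xM e0 ec e12 mA Ale')).
  rewrite lee_fin.
  have b2 : (\sum_(i < n) u i) / (e * (K * (1 + `|x|)) ^+ 2) ^+ 2 <= eps / 4 * Phi_bar x.
    apply: le_trans (sqbound x L x0 Lm).
    rewrite ler_pdivrMr; last by rewrite exprn_gt0// mulr_gt0// exprn_gt0.
    apply: (le_trans sU); rewrite le_eqVlt; apply/orP; left; apply/eqP.
    by set l := K * (1 + `|x|) in lam0 *; move: lam0 e0; clear => l0 e0; field; rewrite !gt_eqF.
  have := xbound_neg x _ x0 Tm.
  have := expR_ge0 (- (m / K ^+ 4 / ((1 + `|x|) ^+ 4 * L ^+ 2))).
  by move: md b2; clear; lra.
Qed.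
End studentized_tail.

(** * One coordinate of the approximate means *)

Section emp_norm.
Context (R : realType) (n : nat).

Lemma sqrt_sum_triangle (a b : 'I_n -> R) :
  Num.sqrt (\sum_i a i ^+ 2) <=
  Num.sqrt (\sum_i b i ^+ 2) + Num.sqrt (\sum_i (a i - b i) ^+ 2).
Proof.
set A := \sum_i a i ^+ 2; set B := \sum_i b i ^+ 2; set C := \sum_i (a i - b i) ^+ 2.
have A0 : 0 <= A by apply: sumr_ge0 => i _; exact: sqr_ge0.
have B0 : 0 <= B by apply: sumr_ge0 => i _; exact: sqr_ge0.
have C0 : 0 <= C by apply: sumr_ge0 => i _; exact: sqr_ge0.
rewrite -(@ler_pXn2r _ 2)// ?nnegrE ?addr_ge0 ?sqrtr_ge0//.
rewrite sqrrD !sqr_sqrtr//.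
have -> : A = B + (\sum_i b i * (a i - b i)) *+ 2 + C.
  rewrite /A /B /C -mulr_natl mulr_sumr -!big_split/=.
  by apply: eq_bigr => i _; ring.
rewrite lerD2r lerD2l lerMn2r/= -sqrtrM//.
apply: le_trans (ler_norm _) _; rewrite -sqrtr_sqr ler_wsqrtr//.
exact: cauchy_schwarz_sum.
Qed.

(** The empirical quadratic mean is a seminorm: estimating the Z_i perturbs the
    denominator by at most the quadratic mean of the estimation errors. *)
Lemma emp_norm_dist (a b : 'I_n -> R) :
  `|Num.sqrt (emp_mean (fun i => a i ^+ 2)) - Num.sqrt (emp_mean (fun i => b i ^+ 2))| <=
  Num.sqrt (emp_mean (fun i => (a i - b i) ^+ 2)).
Proof.
have E (f : 'I_n -> R) : (forall i, 0 <= f i) ->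
    Num.sqrt (emp_mean f) = Num.sqrt n%:R^-1 * Num.sqrt (\sum_i f i).
  by move=> f0; rewrite /emp_mean sqrtrM// invr_ge0.
rewrite !E; try by move=> i; exact: sqr_ge0.
rewrite -mulrBr normrM ger0_norm ?sqrtr_ge0// ler_wpM2l ?sqrtr_ge0//.
rewrite ler_norml; apply/andP; split.
  have := sqrt_sum_triangle b a.
  under [X in _ <= _ + Num.sqrt X -> _]eq_bigr do rewrite -sqrrN opprB.
  by rewrite lerNl opprB lerBlDl.
by rewrite lerBlDl sqrt_sum_triangle.
Qed.

End emp_norm.

Section coordinate.
Context d (T : measurableType d) (R : realType) (P : probability T R).

Lemma measurable_scale (k : R) : measurable_fun setT (fun x : R => k * x).
Proof. exact: measurable_funM. Qed.

Definition scale (k x : R) : R := k * x.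

HB.instance Definition _ k := isMeasurableFun.Build _ _ _ _ (scale k) (measurable_scale k).

Lemma centered_moments_scale (X : {mfun T >-> R}) (k m2 m3 : R) : 0 <= k ->
  centered_moments P X m2 m3 ->
  centered_moments P (scale k \o X) (k ^+ 2 * m2) (k ^+ 3 * m3).
Proof.
move=> k0 cm; have [e1 e2 e3] := cm; split.
- have iX : P.-integrable setT (EFin \o X).
    apply: (@integrable_of_cube _ _ _ P X idfun 1 _ _ cm) => [|//|x].
      exact: measurable_id.
    by rewrite mul1r -[leLHS]expr1 normX_le_cube.
  under eq_integral do rewrite /= /scale EFinM.
  by rewrite integralZl// e1 mule0.
- under eq_integral do rewrite /= /scale exprMn EFinM.
  rewrite ge0_integralZl//= ?e2 ?lee_fin ?sqr_ge0//.
  + by apply/measurable_EFinP; exact: measurable_funX.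
  + by move=> w _; rewrite lee_fin sqr_ge0.
- under eq_integral do rewrite /= /scale normrM exprMn (ger0_norm k0) EFinM.
  rewrite ge0_integralZl//= ?e3 ?lee_fin ?exprn_ge0//.
  by apply/measurable_EFinP; apply: measurable_funX; exact: measurableT_comp.
Qed.

Lemma fourth_moment_scale (X : {mfun T >-> R}) (k m4 : R) :
  (\int[P]_w (X w ^+ 4)%:E = m4%:E)%E ->
  (\int[P]_w ((scale k \o X) w ^+ 4)%:E = (k ^+ 4 * m4)%:E)%E.
Proof.
move=> e4; under eq_integral do rewrite /= /scale exprMn EFinM.
have p4 (y : R) : 0 <= y ^+ 4 by rewrite (exprM _ 2 2) sqr_ge0.
rewrite ge0_integralZl//= ?e4 ?lee_fin//.
- by apply/measurable_EFinP; exact: measurable_funX.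
- by move=> w _; rewrite lee_fin.
Qed.

Variables (n p : nat) (Z : 'I_n -> {RV P >-> p.-tuple R}) (j : 'I_p).

(** Extension by 0 to all indices i : nat, the form that independent_upto
    takes. *)
Definition zcoord (i : nat) (w : T) : R :=
  if insub i is Some i' then tnth (Z i' w) j else 0.

Lemma measurable_zcoord i : measurable_fun setT (zcoord i).
Proof.
rewrite /zcoord; case: insub => [i'|]; last exact: measurable_cst.
by apply: (measurableT_comp (measurable_tnth j)); exact: measurable_funP.
Qed.

HB.instance Definition _ i := isMeasurableFun.Build _ _ _ _ (zcoord i) (measurable_zcoord i).

Lemma zcoordE (i : 'I_n) w : zcoord i w = tnth (Z i w) j.
Proof. by rewrite /zcoord valK. Qed.

Lemma zcoord_independent : mutually_independent Z -> independent_upto P n zcoord.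
Proof.
move=> indZ A mA.
have mB i : measurable [set z : p.-tuple R | A i (tnth z j)].
  by rewrite -[X in measurable X]setTI; apply: measurable_tnth.
have := indZ [set: 'I_n]%SET (fun i => [set z : p.-tuple R | A i (tnth z j)]) (fun i => mB i).
have -> : \bigcap_(i in [set` [set: 'I_n]%SET]) (Z i @^-1` [set z | A i (tnth z j)]) =
    \big[setI/setT]_(i < n) (zcoord i @^-1` A i).
  rewrite -bigcap_seq; apply/seteqP; split => w h i _.
    by rewrite /preimage/= zcoordE; apply: (h i); rewrite /= inE.
  by have := h i (mem_index_enum i); rewrite /preimage/= zcoordE.
move=> ->; apply: congr_big => // i; first by rewrite inE.
by move=> _; congr (P _); apply/seteqP; split => w; rewrite /preimage/= zcoordE.
Qed.

Definition abs_moment (k i : nat) : R := fine (\int[P]_w (`|zcoord i w| ^+ k)%:E)%E.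

Lemma abs_moment_ge0 k i : 0 <= abs_moment k i.
Proof. by rewrite fine_ge0// integral_ge0// => w _; rewrite lee_fin exprn_ge0. Qed.

Let expE (f : T -> R) : ('E_P[f] = \int[P]_w (f w)%:E)%E.
Proof. by rewrite unlock. Qed.

Let fin_term (k : nat) (b : R) : (0 < n)%N ->
  ((n%:R^-1)%:E * \sum_(i < n) \int[P]_w (`|zcoord i w| ^+ k)%:E <= b%:E)%E ->
  forall i, (i < n)%N -> (\int[P]_w (`|zcoord i w| ^+ k)%:E = (abs_moment k i)%:E)%E.
Proof.
move=> n0 hb i i_n; rewrite /abs_moment fineK//.
have ge0 m : (0 <= \int[P]_w (`|zcoord m w| ^+ k)%:E)%E.
  by apply: integral_ge0 => w _; rewrite lee_fin exprn_ge0.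
rewrite ge0_fin_numE// ltNge; apply/negP; rewrite leye_eq => /eqP e.
move: hb; rewrite (bigD1 (Ordinal i_n))//= e addye; last first.
  by rewrite gt_eqF// (lt_le_trans ltNy0)// sume_ge0.
by rewrite gt0_muley// lte_fin invr_gt0 ltr0n.
Qed.

(** Condition M bounds averages in the extended reals; finiteness of the
    individual moments follows since the terms are nonnegative. *)
Lemma zcoord_moments (B : R) : (0 < n)%N ->
  (forall i, 'E_P[fun x => tnth (Z i x) j]%E = 0%E) ->
  condition_M Z B ->
  [/\ forall i, (i < n)%N -> centered_moments P (zcoord i) (abs_moment 2 i) (abs_moment 3 i),
      forall i, (i < n)%N -> (\int[P]_w (zcoord i w ^+ 4)%:E = (abs_moment 4 i)%:E)%E,
      n%:R <= \sum_(i < n) abs_moment 2 i,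
      \sum_(i < n) abs_moment 3 i <= n%:R * B &
      \sum_(i < n) abs_moment 4 i <= n%:R * B ^+ 2].
Proof.
move=> n0 EZ [M1 M2].
have nR : 0 < n%:R :> R by rewrite ltr0n.
have h k : k = 1%N \/ k = 2%N ->
  ((n%:R^-1)%:E * \sum_(i < n) \int[P]_w (`|zcoord i w| ^+ (2 + k))%:E <= (B ^+ k)%:E)%E.
  move=> /(M2 j); apply: le_trans; rewrite le_eqVlt; apply/orP; left; apply/eqP.
  congr (_ * _)%E; apply: eq_bigr => i _; rewrite expE.
  by apply: eq_integral => w _; rewrite zcoordE.
have h1 := h 1%N (or_introl erefl); have h2 := h 2%N (or_intror erefl).
have f3 := fin_term n0 h1; have f4 := fin_term n0 h2; rewrite ![(2 + _)%N]/= in h1 h2 f3 f4.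
have sumE k : (forall i, (i < n)%N -> (\int[P]_w (`|zcoord i w| ^+ k)%:E = (abs_moment k i)%:E)%E) ->
   ((n%:R^-1)%:E * \sum_(i < n) \int[P]_w (`|zcoord i w| ^+ k)%:E = (n%:R^-1 * \sum_(i < n) abs_moment k i)%:E)%E.
  move=> fk; rewrite (eq_bigr (fun i : 'I_n => (abs_moment k i)%:E)) => [|i _]; last exact: fk.
  by rewrite sumEFin EFinM.
have mabs k i : measurable_fun setT (fun w => (`|zcoord i w| ^+ k)%:E).
  apply/measurable_EFinP; apply: measurable_funX.
  by apply: measurableT_comp => //; exact: measurable_zcoord.
have f2 i : (i < n)%N -> (\int[P]_w (`|zcoord i w| ^+ 2)%:E = (abs_moment 2 i)%:E)%E.
  move=> i_n; rewrite /abs_moment fineK// ge0_fin_numE; last first.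
    by apply: integral_ge0 => w _; rewrite lee_fin exprn_ge0.
  apply: (@le_lt_trans _ _ (\int[P]_w (1 + (`|zcoord i w| ^+ 3)%:E))%E).
    apply: ge0_le_integral => //=.
    - by apply: emeasurable_funD => //; exact: mabs.
    - by move=> w _; rewrite -EFinD lee_fin normX_le_cube.
  rewrite ge0_integralD//= f3// integral_cst// mul1e.
  apply: lte_add_pinfty; last exact: ltry.
  by rewrite -ge0_fin_numE// fin_num_measure.
split.
- move=> i i_n; split.
  + have := EZ (Ordinal i_n); rewrite expE => <-.
    by apply: eq_integral => w _; rewrite -zcoordE.
  + rewrite -f2//; apply: eq_integral => w _; congr EFin.
    by rewrite real_normK ?num_real.
  + by rewrite -f3.
- move=> i i_n; rewrite -f4//; apply: eq_integral => w _; congr EFin.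
  by rewrite (exprM `|_| 2 2) real_normK ?num_real// -exprM.
- have := M1 j.
  have -> : ((n%:R^-1)%:E * \sum_(i < n) 'E_P[fun w => (tnth (Z i w) j ^+ 2)%R] =
     (n%:R^-1)%:E * \sum_(i < n) \int[P]_w (`|zcoord i w| ^+ 2)%:E)%E.
    congr (_ * _)%E; apply: eq_bigr => i _; rewrite expE; apply: eq_integral => w _.
    by rewrite zcoordE real_normK ?num_real.
  by rewrite (sumE _ f2) lee_fin mulrC ler_pdivlMr// mul1r.
- by move: h1; rewrite (sumE _ f3) lee_fin expr1 mulrC ler_pdivrMr// mulrC.
- by move: h2; rewrite (sumE _ f4) lee_fin mulrC ler_pdivrMr// mulrC.
Qed.

End coordinate.

(** * The tail of one t-statistic *)

Section coordinate_tail.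
Context (R : realType).

(** A rejection x < num / Vh is turned into a lower bound for G in terms of the
    true quadratic mean Vr, at scale lam / sd.  The noise a in the denominator
    and b in the numerator costs at most 1 / 2.  If Vh = 0 then Vr <= a and
    x < 0. *)
Lemma studentized_event (x G r num Vh Vr a b lam sd : R) :
  num <= G + r -> r <= b -> 0 <= Vh -> `|Vh - Vr| <= a -> x < num / Vh ->
  1 <= sd -> 0 < lam -> 0 <= a -> 0 <= b ->
  lam * (`|x| * a + b) <= 1 / 2 -> a <= 1 / 2 ->
  x * (lam / sd * Vr) - 1 / 2 <= lam / sd * G \/ x < 0 /\ lam / sd * Vr <= lam / 2.
Proof.
move=> hn hr Vh0 hV hx s1 lam0 a0 b0 noise a12.
have s0 : 0 < sd by apply: lt_le_trans s1.
have kle : lam / sd <= lam by rewrite ler_pdivrMr// ler_peMr// ltW.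
have k0 : 0 < lam / sd by rewrite divr_gt0.
have [V0|Vn0] := eqVneq Vh 0.
  right; move: hx; rewrite V0 invr0 mulr0 => hx; split => //.
  have Va : Vr <= a.
    by move: hV; rewrite V0 sub0r normrN; apply: le_trans; exact: ler_norm.
  apply: (@le_trans _ _ (lam / sd * a)); first by rewrite ler_pM2l.
  apply: (@le_trans _ _ (lam * a)); first by rewrite ler_wpM2r.
  by rewrite ler_pM2l//; move: a12; lra.
left; have Vp : 0 < Vh by rewrite lt_neqAle eq_sym Vn0.
move: hx; rewrite ltr_pdivlMr// => hx.
have xV : x * Vr - `|x| * a <= x * Vh.
  rewrite lerBlDl -lerBlDr -mulrBr; apply: (le_trans (ler_norm _)).
  by rewrite normrM distrC ler_wpM2l.
have h : x * Vr - (`|x| * a + b) <= G by lra.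
have : lam / sd * (x * Vr - (`|x| * a + b)) <= lam / sd * G by rewrite ler_pM2l.
have : lam / sd * (`|x| * a + b) <= lam * (`|x| * a + b).
  by rewrite ler_wpM2r// addr_ge0// mulr_ge0.
rewrite mulrBr (mulrCA x).
lra.
Qed.

(** The summands are Z_ij times k = lam / (sqrt n * sd), with sd ^+ 2 the average
    variance, which makes their variances add up to lam ^+ 2.  Since sd >= 1 the
    moment bounds only improve. *)
Theorem coordinate_tail (eps M : R) : 0 < eps <= 1 -> 0 <= M ->
  exists K eta : R, [/\ 1 <= K, 0 < eta &
  forall d (T : measurableType d) (P : probability T R) (n p : nat)
    (theta0 thetabar : p.-tuple R) (thetahat : {mfun T >-> p.-tuple R})
    (Z : 'I_n -> {RV P >-> p.-tuple R}) (r : {RV P >-> p.-tuple R})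
    (Zhat : 'I_n -> {mfun T >-> p.-tuple R}) (B delta l x : R) (j : 'I_p) (A : set T),
  (0 < n)%N -> 1 <= B -> approximate_means theta0 thetahat Z r -> condition_M Z B ->
  tnth theta0 j <= tnth thetabar j ->
  - M <= x -> (1 + `|x|) ^+ 3 * (B / Num.sqrt n%:R) <= eta ->
  0 < l -> 0 <= delta ->
  K * (1 + `|x|) * (`|x| * (delta / l) + delta / Num.sqrt l) <= 1 / 2 ->
  delta / l <= 1 / 2 ->
  measurable A ->
  (forall w, A w -> [/\ x < t_stat thetahat thetabar Zhat w j,
      `|tnth (r w) j| <= delta / Num.sqrt l &
      emp_mean (fun i => (tnth (Zhat i w) j - tnth (Z i w) j) ^+ 2) <= (delta / l) ^+ 2]) ->
  (P A <= ((1 + eps) * Phi_bar x +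
           expR (- (eta / ((1 + `|x|) ^+ 4 * (B / Num.sqrt n%:R) ^+ 2))))%:E)%E].
Proof.
move=> heps M0; have [K [eta [K1 eta0 tail]]] := studentized_tail heps M0.
exists K, eta; split => // d T P n p theta0 thetabar thetahat Z r Zhat B delta l x j A.
move=> n0 B1 [indZ EZ hth] cM null xM hL l0 d0 noise dl mA hA.
have [cmo m4 S2 S3 S4] := zcoord_moments n0 (EZ ^~ j) cM.
set lam := K * (1 + `|x|) in noise.
have nR : 0 < n%:R :> R by rewrite ltr0n.
have lam0 : 0 < lam by rewrite mulr_gt0 ?ltr_pwDl// (lt_le_trans ltr01).
set S := \sum_(i < n) abs_moment Z j 2 i in S2.
pose sd := Num.sqrt (S / n%:R).
have Sn : 1 <= S / n%:R by rewrite ler_pdivlMr// mul1r.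
have sd1 : 1 <= sd by rewrite -sqrtr1 ler_wsqrtr.
have sd0 : 0 < sd by apply: lt_le_trans sd1.
have sd2 : sd ^+ 2 = S / n%:R by rewrite sqr_sqrtr// (le_trans ler01).
pose q := Num.sqrt (n%:R : R).
have q0 : 0 < q by rewrite sqrtr_gt0.
have q2 : q ^+ 2 = n%:R by rewrite sqr_sqrtr// ltW.
pose k := lam / (q * sd).
have k0 : 0 < k by rewrite divr_gt0// mulr_gt0.
have L0 : 0 < B / q by rewrite divr_gt0// (lt_le_trans ltr01).
pose X i : {mfun T >-> R} := scale k \o zcoord Z j i.
have indX : independent_upto P n X.
  exact: (@independent_comp _ _ _ P n (zcoord Z j) (fun=> scale k) (zcoord_independent j indZ)).
have XE w (i : 'I_n) : X i w = k * tnth (Z i w) j by rewrite /X/= /scale zcoordE.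
pose s i := k * Num.sqrt (abs_moment Z j 2 i).
pose t i := k ^+ 3 * abs_moment Z j 3 i.
pose u i := k ^+ 4 * abs_moment Z j 4 i.
have s0 i : 0 <= s i by rewrite mulr_ge0 ?sqrtr_ge0// ltW.
have t0 i : 0 <= t i by rewrite mulr_ge0 ?abs_moment_ge0// exprn_ge0// ltW.
have u0 i : 0 <= u i by rewrite mulr_ge0 ?abs_moment_ge0// exprn_ge0// ltW.
have s2 i : s i ^+ 2 = k ^+ 2 * abs_moment Z j 2 i by rewrite exprMn sqr_sqrtr// abs_moment_ge0.
have mX i : (i < n)%N -> centered_moments P (X i) (s i ^+ 2) (t i).
  by move=> /cmo h; rewrite s2; apply: centered_moments_scale => //; exact: ltW.
have muX i : (i < n)%N -> (\int[P]_w (X i w ^+ 4)%:E = (u i)%:E)%E.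
  by move=> /m4; exact: fourth_moment_scale.
have sS : \sum_(i < n) s i ^+ 2 = lam ^+ 2.
  under eq_bigr do rewrite s2.
  rewrite -mulr_sumr -/S.
  have -> : S = sd ^+ 2 * q ^+ 2 by rewrite sd2 q2 divfK// gt_eqF.
  by rewrite /k; field; rewrite !gt_eqF.
have sT : \sum_(i < n) t i <= lam ^+ 3 * (B / q).
  rewrite -mulr_sumr; apply: (@le_trans _ _ (k ^+ 3 * (n%:R * B))).
    by rewrite ler_wpM2l// exprn_ge0// ltW.
  rewrite -q2.
  have -> : k ^+ 3 * (q ^+ 2 * B) = lam ^+ 3 * (B / q) / sd ^+ 3.
    by rewrite /k; field; rewrite !gt_eqF.
  rewrite ler_pdivrMr ?exprn_gt0// ler_peMr ?exprn_ege1//.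
  by rewrite mulr_ge0 ?exprn_ge0// ltW.
have sU : \sum_(i < n) u i <= lam ^+ 4 * (B / q) ^+ 2.
  rewrite -mulr_sumr; apply: (@le_trans _ _ (k ^+ 4 * (n%:R * B ^+ 2))).
    by rewrite ler_wpM2l// exprn_ge0// ltW.
  rewrite -q2.
  have -> : k ^+ 4 * (q ^+ 2 * B ^+ 2) = lam ^+ 4 * (B / q) ^+ 2 / sd ^+ 4.
    by rewrite /k; field; rewrite !gt_eqF.
  rewrite ler_pdivrMr ?exprn_gt0// ler_peMr ?exprn_ege1//.
  by rewrite mulr_ge0 ?exprn_ge0// ltW.
apply: (tail _ T P n X s t u) => // w /hA[hx hr hZ] /=.
have SE : \sum_(i < n) X i w = lam / sd * (q^-1 * \sum_(i < n) tnth (Z i w) j).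
  under eq_bigr do rewrite XE.
  by rewrite -mulr_sumr /k mulrA; congr (_ * _); field; rewrite !gt_eqF.
have VE : Num.sqrt (\sum_(i < n) X i w ^+ 2) =
    lam / sd * Num.sqrt (emp_mean (fun i => tnth (Z i w) j ^+ 2)).
  rewrite -[lam / sd]ger0_norm ?divr_ge0 ?(ltW lam0) ?(ltW sd0)//.
  rewrite -sqrtr_sqr -sqrtrM ?sqr_ge0//; congr Num.sqrt.
  under eq_bigr do rewrite XE exprMn.
  rewrite -mulr_sumr /emp_mean mulrA; congr (_ * _).
  by rewrite -q2 /k; field; rewrite !gt_eqF.
rewrite SE VE.
apply: (studentized_event (r := tnth (r w) j)
  (num := q * (tnth (thetahat w) j - tnth thetabar j))
  (Vh := Num.sqrt (emp_mean (fun i => tnth (Zhat i w) j ^+ 2)))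
  (a := delta / l) (b := delta / Num.sqrt l)) => //.
- rewrite -hth ler_pM2l//; lra.
- by apply: le_trans hr; exact: ler_norm.
- apply: (le_trans (emp_norm_dist _ _)).
  rewrite -[leRHS]ger0_norm ?divr_ge0 ?(ltW l0)// -sqrtr_sqr.
  exact: ler_wsqrtr.
- by rewrite divr_ge0// ltW.
- by rewrite divr_ge0// sqrtr_ge0.
Qed.

End coordinate_tail.

(** * Quantile growth, measurability and the stepdown procedure *)

Section quantiles.
Context (R : realType).

Lemma quantile_sqr (b : R) : 0 < b < 1 -> 0 <= Phi_inv (1 - b) ->
  Phi_inv (1 - b) ^+ 2 / 2 <= - ln b.
Proof.
move=> b01 x0; have := Phi_bar_tail x0; rewrite Phi_bar_Phi_inv//.
case/andP: b01 => b0 b1 h; rewrite lerNr -ler_expR lnK//.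
Qed.

Lemma level_in01 (alpha : R) (k : nat) : 0 < alpha < 1 -> (0 < k)%N -> 0 < alpha / k%:R < 1.
Proof.
move=> /andP[a0 a1] k0; have kR : 1 <= k%:R :> R by rewrite ler1n.
rewrite divr_gt0//= ?ltr_pdivrMr; [|lra..].
by rewrite mul1r; lra.
Qed.

(** The quantiles are bounded from below uniformly in k because k >= 1, and from
    above by Phi_bar_tail.  M and D depend on alpha only. *)
Lemma quantile_growth (alpha : R) : 0 < alpha < 1 ->
  exists M D : R, [/\ 0 <= M, 1 <= D &
    forall (k : nat) (l : R), (0 < k)%N -> 1 <= l -> ln k%:R <= l ->
    let x := Phi_inv (1 - alpha / k%:R) in - M <= x /\ 1 + `|x| <= D * Num.sqrt l].
Proof.
move=> a01; have /andP[a0 a1] := a01.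
pose M := `|Phi_inv (1 - alpha)|.
have lna : ln alpha < 0 by rewrite ln_lt0// a0.
pose D := 6 + 4 * (- ln alpha) + M.
have M0 : 0 <= M by exact: normr_ge0.
exists M, D; split => //; first by rewrite /D; lra.
move=> k l k0 l1 kl x.
have b01 := level_in01 a01 k0.
have kR : 1 <= k%:R :> R by rewrite ler1n.
have xM : - M <= x.
  apply: (@le_trans _ _ (Phi_inv (1 - alpha))).
    by rewrite /M lerNl; rewrite -normrN; exact: ler_norm.
  rewrite /x; case/andP: b01 => b0 b1; apply: Phi_inv_le; [lra|lra|].
  by rewrite lerD2l lerN2 ler_pdivrMr ?ler_peMr//; lra.
split => //.
have sl1 : 1 <= Num.sqrt l by rewrite -[leLHS]sqrtr1 ler_wsqrtr.
have [x0|x0] := leP 0 x; last first.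
  rewrite ltr0_norm//; apply: (@le_trans _ _ D); first by rewrite /D; lra.
  by rewrite ler_peMr//; rewrite /D; lra.
rewrite (ger0_norm x0).
have := quantile_sqr b01 x0; rewrite -/x lnM ?posrE//; last by rewrite invr_gt0; lra.
rewrite lnV ?posrE; last lra.
move=> h.
have x2 : x ^+ 2 <= (2 + 2 * (- ln alpha)) * l.
  have : - ln alpha <= (- ln alpha) * l by rewrite ler_peMr//; lra.
  lra.
have E0 : 0 <= 2 + 2 * (- ln alpha) by lra.
have xs : x <= (2 + 2 * (- ln alpha)) * Num.sqrt l.
  rewrite -(@ler_pXn2r _ 2)// ?nnegrE ?mulr_ge0 ?sqrtr_ge0//.
  apply: (le_trans x2); rewrite exprMn sqr_sqrtr; last lra.
  rewrite ler_wpM2r//; first lra.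
  rewrite expr2 ler_peMr//; lra.
apply: (@le_trans _ _ ((1 + (2 + 2 * (- ln alpha))) * Num.sqrt l)).
  by rewrite mulrDl mul1r lerD.
by rewrite ler_wpM2r ?sqrtr_ge0// /D; lra.
Qed.

Lemma ln_nat_ge1 (m : nat) : (3 <= m)%N -> 1 <= ln m%:R :> R.
Proof.
move=> m3; rewrite -ler_expR lnK ?posrE ?ltr0n ?(leq_trans _ m3)//.
apply: (@le_trans _ _ 3); last by rewrite ler_nat.
have := @expR_taylor3 R 1 (lexx _); rewrite normr1 !expr1n => /ler_normlW; lra.
Qed.

End quantiles.

Section measurability.
Context d (T : measurableType d) (R : realType) (n p : nat).
Context (thetahat : {mfun T >-> p.-tuple R}) (thetabar : p.-tuple R)
  (Zhat : 'I_n -> {mfun T >-> p.-tuple R}).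

Lemma measurable_coordinate (Y : {mfun T >-> p.-tuple R}) (j : 'I_p) :
  measurable_fun setT (fun w => tnth (Y w) j).
Proof. by apply: (measurableT_comp (measurable_tnth j)); exact: measurable_funP. Qed.

Lemma measurable_set_lt (f g : T -> R) : measurable_fun setT f -> measurable_fun setT g ->
  measurable [set w | f w < g w].
Proof.
move=> mf mg; rewrite (_ : [set w | _] = ~` [set w | g w <= f w]).
  by apply: measurableC; exact: measurable_set_le.
by apply/seteqP; split => w /=; rewrite ltNge => /negP.
Qed.

Lemma measurable_emp_mean (f : 'I_n -> T -> R) : (forall i, measurable_fun setT (f i)) ->
  measurable_fun setT (fun w => emp_mean (fun i => f i w)).
Proof. by move=> mf; apply: measurable_funM => //; exact: measurable_sum. Qed.

Lemma measurable_max_coord (f : 'I_p -> T -> R) : (forall i, measurable_fun setT (f i)) ->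
  measurable_fun setT (fun w => max_coord (fun i => f i w)).
Proof.
move=> mf; rewrite /max_coord; elim: (index_enum _) => [|i s IH].
  by under eq_fun do rewrite big_nil; exact: measurable_cst.
by under eq_fun do rewrite big_cons; exact: measurable_maxr.
Qed.

(** The division in t_stat is total: on the event that the denominator vanishes
    the comparison is between c and 0. *)
Lemma measurable_reject (c : R) (j : 'I_p) :
  measurable [set w | c < t_stat thetahat thetabar Zhat w j].
Proof.
pose V w := Num.sqrt (emp_mean (fun i => tnth (Zhat i w) j ^+ 2)).
pose N w := Num.sqrt n%:R * (tnth (thetahat w) j - tnth thetabar j).
have mV : measurable_fun setT V.
  apply: (measurableT_comp (continuous_measurable_fun (@sqrt_continuous R))).
  apply: measurable_emp_mean => i; apply: measurable_funX.
  exact: measurable_coordinate.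
have mN : measurable_fun setT N.
  apply: measurable_funM => //; apply: measurable_funB => //.
  exact: measurable_coordinate.
rewrite (_ : [set w | _] = ([set w | 0 < V w] `&` [set w | c * V w < N w]) `|`
  ([set w | V w <= 0] `&` [set w | c < 0])).
  apply: measurableU; apply: measurableI.
  - exact: measurable_set_lt.
  - by apply: measurable_set_lt => //; exact: measurable_funM.
  - exact: measurable_set_le.
  - by apply: (@measurable_set_lt (cst c) (cst 0)); exact: measurable_cst.
apply/seteqP; split => w /=; rewrite /t_stat -/(V w) -/(N w).
- have [V0|V0] := ltP 0 (V w); first by rewrite ltr_pdivlMr// => h; left.
  have -> : V w = 0 by apply/eqP; rewrite eq_le V0 sqrtr_ge0.
  by rewrite invr0 mulr0 => h; right.
- case=> [[V0]|[V0]]; first by rewrite ltr_pdivlMr.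
  have -> : V w = 0 by apply/eqP; rewrite eq_le V0 sqrtr_ge0.
  by rewrite invr0 mulr0.
Qed.

End measurability.

Section holm.
Context (R : realType) (p : nat).
Implicit Types (c : {set 'I_p} -> R) (t : 'I_p -> R) (w W : {set 'I_p}).

(** As long as no t_j with j in w exceeds c w, monotonicity of c shows by
    induction that w stays in the working set and that none of its members is
    rejected. *)
Lemma stepdown_reject_true_null c t w :
  (forall W, w \subset W -> c w <= c W) ->
  (exists2 j, j \in w & stepdown c t j) -> exists2 j, j \in w & c w < t j.
Proof.
move=> mono [j jw [l [jl tl]]].
apply: contrapT => hno.
have hle i : i \in w -> t i <= c w.
  by move=> iw; rewrite leNgt; apply/negP => ci; apply: hno; exists i.
have sub m : w \subset stepdown_set c t m.
  elim: m => [|m IH] /=; first exact: finset.subsetT.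
  apply/fintype.subsetP => i iw; rewrite inE (fintype.subsetP IH)//=.
  by rewrite -leNgt (le_trans (hle _ iw))// mono.
by move: tl; rewrite ltNge (le_trans (hle _ jw))// mono.
Qed.

Context d (T : measurableType d) (t : T -> 'I_p -> R).
Hypothesis mt : forall (a : R) j, measurable [set x | a < t x j].

(** The working set takes finitely many values, and given its value at step l the
    next one is determined by finitely many threshold events. *)
Lemma measurable_stepdown_set c l W : measurable [set x | stepdown_set c (t x) l = W].
Proof.
elim: l W => [|l IH] W /=.
  have [->|h] := eqVneq [set: 'I_p]%SET W.
    by rewrite (_ : [set x | _] = setT)//; apply/seteqP; split.
  rewrite (_ : [set x | _] = set0)//; apply/seteqP; split => // x /= e.
  by rewrite e eqxx in h.
(* F V is the event that V is followed by W. *)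
pose F (V : {set 'I_p}) := \bigcap_(j in @setT 'I_p) [set x | ((j \in V) && ~~ (t x j > c V)) = (j \in W)].
rewrite (_ : [set x | _] = \bigcup_(V in @setT {set 'I_p})
   ([set x | stepdown_set c (t x) l = V] `&` F V)).
  apply: fin_bigcup_measurable => // V _; apply: measurableI; first exact: IH.
  apply: fin_bigcap_measurable => // j _.
  case: (j \in V) => /=; case: (j \in W).
  - rewrite (_ : [set x | _] = ~` [set x | c V < t x j]).
      by apply: measurableC; exact: mt.
    by apply/seteqP; split => x /= => [/negP|/negP].
  - rewrite (_ : [set x | _] = [set x | c V < t x j]); first exact: mt.
    by apply/seteqP; split => x /= => [/negbFE|->].
  - by rewrite (_ : [set x | _] = set0)//; apply/seteqP; split.
  - by rewrite (_ : [set x | _] = setT)//; apply/seteqP; split.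
apply/seteqP; split => x /=.
  move=> e; exists (stepdown_set c (t x) l) => //; split => //= j _ /=.
  by rewrite -e inE.
move=> [V _ [/= -> h]]; apply/setP => j; rewrite inE.
by have /= := h j I.
Qed.

Lemma measurable_stepdown_event c w :
  measurable [set x | exists2 j, j \in w & stepdown c (t x) j].
Proof.
rewrite (_ : [set x | _] = \bigcup_(j in [set j | j \in w]) \bigcup_l
   \bigcup_(V in [set V : {set 'I_p} | j \in V])
   ([set x | stepdown_set c (t x) l = V] `&` [set x | c V < t x j])).
  apply: fin_bigcup_measurable => // j _; apply: bigcup_measurable => l _.
  apply: fin_bigcup_measurable => // V _.
  by apply: measurableI; [exact: measurable_stepdown_set|exact: mt].
apply/seteqP; split => x /=.
  by move=> [j jw [l [jl tl]]]; exists j => //; exists l => //; exists (stepdown_set c (t x) l).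
by move=> [j jw [l _ [V /= jV [/= e h]]]]; exists j => //; exists l; rewrite e.
Qed.

Lemma measurable_threshold_event (a : R) w :
  measurable [set x | exists2 j, j \in w & a < t x j].
Proof.
rewrite (_ : [set x | _] = \bigcup_(j in [set j | j \in w]) [set x | a < t x j]).
  by apply: fin_bigcup_measurable => // j _; exact: mt.
by apply/seteqP; split => x /= [j jw h]; exists j.
Qed.

End holm.

(** The positive part of u n - alpha is the error sequence.  The bound by 1 makes
    it real-valued for small n. *)
Lemma le_add_o1_of_eventually (R : realType) (u : nat -> \bar R) (alpha : R) :
  (forall n, (0 < n)%N -> u n <= 1)%E ->
  (forall eps : R, 0 < eps -> exists N : nat, forall n, (N <= n)%N ->
     (u n <= (alpha + eps)%:E)%E) -> le_add_o1 u alpha.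
Proof.
move=> u1 hu; pose v n := maxe (u n - alpha%:E)%E 0%E.
have vfin n : (0 < n)%N -> v n \is a fin_num.
  move=> n0; rewrite ge0_fin_numE; last by rewrite /v le_max lexx orbT.
  rewrite /v gt_max ltry andbT lteBlDr//.
  by apply: (le_lt_trans (u1 _ n0)); rewrite addye// ltry.
exists (fun n => fine (v n)).
  apply/cvgrPdist_le => e e0; have [N hN] := hu e e0.
  exists N.+1 => // n /= Nn.
  rewrite sub0r normrN ger0_norm; last by rewrite fine_ge0// le_max lexx orbT.
  rewrite -lee_fin fineK; last by apply: vfin; exact: leq_trans Nn.
  rewrite /v ge_max lee_fin (ltW e0) andbT leeBlDr// -EFinD addrC.
  by apply: hN; exact: ltnW.
move=> n n0; rewrite EFinD fineK ?vfin// -leeBlDl//.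
by rewrite /v le_max lexx.
Qed.

(** * Family-wise error rate for one sample size *)

Section union_bound.
Context d (T : measurableType d) (R : realType) (P : probability T R).

Lemma measure_bigsetU_le (I : Type) (s : seq I) (F : I -> set T) (b : I -> R)
    (D : pred I) :
  (forall i, measurable (F i)) -> (forall i, D i -> (P (F i) <= (b i)%:E)%E) ->
  (P (\big[setU/set0]_(i <- s | D i) F i) <= (\sum_(i <- s | D i) b i)%:E)%E.
Proof.
move=> mF hF; elim: s => [|i s IH]; first by rewrite !big_nil measure0.
rewrite !big_cons; case: ifPn => // Di.
apply: (le_trans (measureU2 _ _ _)) => //.
  exact: bigsetU_measurable.
by rewrite EFinD leeD// hF.
Qed.

End union_bound.

Section fwer.
Context (R : realType).

Lemma powR_three_halves (l : R) : 0 <= l -> l `^ (3 / 2) = Num.sqrt l ^+ 3.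
Proof.
move=> l0; rewrite -powR12_sqrt// -powR_mulrn ?powR_ge0// -powRrM.
by congr (_ `^ _); field.
Qed.

(** Here y = 1 + |x| is of order sqrt l with l = log (p n), so that the growth
    condition gives y ^+ 3 * (B / q) = O(delta) and, up to constants,
    l * (y ^+ 4 * (B / q) ^+ 2) <= delta ^+ 2: with delta small compared
    to eta the exceptional probability is at most exp (- l). *)
Lemma growth_consequences (K D eta delta B l y q ax : R) :
  0 < eta -> 1 <= K -> 1 <= D -> 1 <= l -> 1 <= B -> 0 < q ->
  B * Num.sqrt l ^+ 3 / q <= delta ->
  delta <= 1 / 2 -> K * D * (D + 1) * delta <= 1 / 2 -> D ^+ 3 * delta <= eta ->
  D ^+ 4 * delta <= eta ->
  y = 1 + ax -> 0 <= ax -> y <= D * Num.sqrt l ->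
  [/\ y ^+ 3 * (B / q) <= eta,
      K * y * (ax * (delta / l) + delta / Num.sqrt l) <= 1 / 2 &
      expR (- (eta / (y ^+ 4 * (B / q) ^+ 2))) <= expR (- l)].
Proof.
move=> eta0 K1 D1 l1 B1 q0 gr d12 dK d3 d4 ye ax0 yD.
set sl := Num.sqrt l in gr yD *.
have l0 : 0 < l by apply: lt_le_trans l1.
have sl2 : sl ^+ 2 = l by rewrite sqr_sqrtr// ltW.
have sl1 : 1 <= sl by rewrite -[leLHS]sqrtr1 ler_wsqrtr.
have sl0 : 0 < sl by apply: lt_le_trans sl1.
have L0 : 0 < B / q by rewrite divr_gt0// (lt_le_trans ltr01).
have gr' : sl ^+ 3 * (B / q) <= delta.
  by rewrite mulrA [sl ^+ 3 * B]mulrC.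
have delta0 : 0 < delta by apply: lt_le_trans gr'; rewrite mulr_gt0// exprn_gt0.
have y0 : 0 < y by rewrite ye ltr_pwDl.
have D0 : 0 < D by apply: lt_le_trans D1.
have K0 : 0 < K by apply: lt_le_trans K1.
split.
- apply: le_trans d3; apply: (@le_trans _ _ ((D * sl) ^+ 3 * (B / q))).
    rewrite ler_wpM2r ?(ltW L0)// lerXn2r ?nnegrE ?(ltW y0)//.
    by rewrite mulr_ge0 ?(ltW D0) ?(ltW sl0).
  by rewrite exprMn -mulrA ler_pM2l ?exprn_gt0.
- have axy : ax <= y by rewrite ye lerDr.
  apply: (@le_trans _ _ (K * (D * sl) * ((D * sl) * (delta / l) + delta / sl))).
    apply: ler_pM.
    + by rewrite mulr_ge0 ?(ltW K0) ?(ltW y0).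
    + apply: addr_ge0; last by rewrite divr_ge0 ?(ltW delta0) ?(ltW sl0).
      by rewrite mulr_ge0// divr_ge0 ?(ltW delta0) ?(ltW l0).
    + by rewrite ler_pM2l.
    + rewrite lerD2r ler_wpM2r ?divr_ge0 ?(ltW delta0) ?(ltW l0)//.
      exact: le_trans yD.
  apply: le_trans dK; rewrite le_eqVlt; apply/orP; left; apply/eqP.
  by rewrite -sl2; field; rewrite gt_eqF.
- rewrite ler_expR lerN2.
  have yL : 0 < y ^+ 4 * (B / q) ^+ 2 by rewrite mulr_gt0// exprn_gt0.
  rewrite ler_pdivlMr//.
  apply: le_trans d4.
  apply: (@le_trans _ _ (l * ((D * sl) ^+ 4 * (B / q) ^+ 2))).
    rewrite ler_pM2l// ler_wpM2r ?sqr_ge0// lerXn2r ?nnegrE ?(ltW y0)//.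
    by rewrite mulr_ge0 ?(ltW D0) ?(ltW sl0).
  have -> : l * ((D * sl) ^+ 4 * (B / q) ^+ 2) = D ^+ 4 * (sl ^+ 3 * (B / q)) ^+ 2.
    by rewrite -sl2; ring.
  rewrite ler_pM2l ?exprn_gt0// expr2.
  apply: (@le_trans _ _ (delta * delta)).
    by apply: ler_pM => //; rewrite mulr_ge0 ?exprn_ge0 ?(ltW sl0) ?(ltW L0).
  by rewrite ler_piMr ?(ltW delta0)//; lra.
Qed.

(** The threshold delta0 depends on alpha and eps alone, which is what makes the
    control uniform over distributions and over w.  The terms n^-1 and
    2 * beta come from the exceptional probabilities of at most p coordinates
    and from the two parts of condition A. *)
Theorem fwer_bound (alpha eps : R) : 0 < alpha < 1 -> 0 < eps <= 1 ->
  exists2 delta0 : R, 0 < delta0 &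
  forall d (T : measurableType d) (P : probability T R) (n p : nat)
    (theta0 thetabar : p.-tuple R) (thetahat : {mfun T >-> p.-tuple R})
    (Z : 'I_n -> {RV P >-> p.-tuple R}) (r : {RV P >-> p.-tuple R})
    (Zhat : 'I_n -> {mfun T >-> p.-tuple R}) (B delta beta : R)
    (w : {set 'I_p}) (k : nat) (E : set T),
  (3 <= n)%N -> 1 <= B -> approximate_means theta0 thetahat Z r -> condition_M Z B ->
  condition_A Z Zhat r delta beta ->
  (2 * Num.sqrt 2) ^+ 3 * B * (ln (p * n)%:R `^ (3 / 2)) / Num.sqrt n%:R <= delta ->
  delta <= delta0 ->
  (forall j, j \in w -> tnth theta0 j <= tnth thetabar j) ->
  (#|w| <= k)%N -> (0 < k <= p)%N ->
  measurable E ->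
  (forall x, E x -> exists2 j, j \in w &
     Phi_inv (1 - alpha / k%:R) < t_stat thetahat thetabar Zhat x j) ->
  (P E <= (alpha * (1 + eps) + n%:R^-1 + 2 * beta)%:E)%E.
Proof.
move=> a01 eps01; have /andP[a0 a1] := a01; have /andP[eps0 eps1] := eps01.
have [M [D [M0 D1 growth]]] := quantile_growth a01.
have [K [eta [K1 eta0 tail]]] := coordinate_tail eps01 M0.
have D0 : 0 < D by apply: lt_le_trans D1.
have K0 : 0 < K by apply: lt_le_trans K1.
have [|m m0] := @exists_lower_bound R [:: 1 / 2; 1 / 2 / (K * D * (D + 1)); eta / D ^+ 3; eta / D ^+ 4].
  have D1p : 0 < D + 1 by rewrite addr_gt0.
  rewrite /= andbT; apply/and4P; split; rewrite ?divr_gt0 ?exprn_gt0 //.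
  by rewrite !mulr_gt0.
rewrite /= andbT => /and4P[m12 mK m3 m4].
exists m => // d T P n p theta0 thetabar thetahat Z r Zhat B delta beta w k E.
move=> n3 B1 appr cM cA gr dm null wk /andP[k0 kp] mE hE.
have n0 : (0 < n)%N by exact: leq_trans n3.
have p0 : (0 < p)%N by exact: leq_trans kp.
have pn3 : (3 <= p * n)%N by rewrite (leq_trans n3)// leq_pmull.
set l := ln (p * n)%:R in gr.
have l1 : 1 <= l by exact: ln_nat_ge1.
have l0 : 0 < l by apply: lt_le_trans l1.
set q := Num.sqrt n%:R in gr.
have nR : 0 < n%:R :> R by rewrite ltr0n.
have pR : 0 < p%:R :> R by rewrite ltr0n.
have kR : 0 < k%:R :> R by rewrite ltr0n.
have q0 : 0 < q by rewrite sqrtr_gt0.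
have gr' : B * Num.sqrt l ^+ 3 / q <= delta.
  apply: le_trans gr; rewrite powR_three_halves ?(ltW l0)//.
  rewrite ler_wpM2r ?invr_ge0 ?(ltW q0)// ler_wpM2r ?exprn_ge0 ?sqrtr_ge0//.
  rewrite ler_peMl//; first by rewrite (le_trans ler01).
  rewrite exprn_ege1//.
  have : 1 <= Num.sqrt 2 :> R by rewrite -[leLHS]sqrtr1 ler_wsqrtr// ler1n.
  lra.
have kl : ln k%:R <= l.
  by rewrite ler_ln ?posrE ?ltr0n ?muln_gt0 ?p0// ler_nat (leq_trans kp)// leq_pmulr.
have [xM xD] := growth k l k0 l1 kl.
set x := Phi_inv _ in xM xD hE.
have ax0 : 0 <= `|x| by [].
have DD : 0 < K * D * (D + 1) by rewrite !mulr_gt0// addr_gt0.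
have [] := @growth_consequences K D eta delta B l (1 + `|x|) q `|x| eta0 K1 D1 l1 B1 q0 gr'
  _ _ _ _ erefl ax0 xD.
- exact: le_trans dm m12.
- by move: (le_trans dm mK); rewrite ler_pdivlMr// mulrC.
- by move: (le_trans dm m3); rewrite ler_pdivlMr ?exprn_gt0// mulrC.
- by move: (le_trans dm m4); rewrite ler_pdivlMr ?exprn_gt0// mulrC.
move=> c1 c2 c3.
have delta0 : 0 <= delta.
  apply: le_trans gr'; rewrite divr_ge0 ?(ltW q0)// mulr_ge0 ?exprn_ge0 ?sqrtr_ge0//.
  exact: le_trans B1.
have dl : delta / l <= 1 / 2.
  rewrite ler_pdivrMr//; apply: (le_trans (le_trans dm m12)).
  by rewrite ler_peMr//.
have [A1 A2] := cA (leq_trans (isT : (1 < 3)%N) pn3).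
rewrite -/l in A1 A2.
set E1 := [set x | _] in A1; set E2 := [set x | _] in A2.
have mE1 : measurable E1.
  apply: (@measurable_set_lt _ _ _ (cst (delta / Num.sqrt l))) => //.
  apply: measurable_max_coord => j; apply: measurableT_comp => //.
  exact: measurable_coordinate.
have mE2 : measurable E2.
  apply: (@measurable_set_lt _ _ _ (cst (delta ^+ 2 / l ^+ 2))) => //.
  apply: measurable_max_coord => j; apply: measurable_emp_mean => i.
  apply: measurable_funX; apply: measurable_funB; exact: measurable_coordinate.
pose A j := [set y | x < t_stat thetahat thetabar Zhat y j] `&` ~` E1 `&` ~` E2.
have mA j : measurable (A j).
  apply: measurableI; last exact: measurableC.
  by apply: measurableI; [exact: measurable_reject|exact: measurableC].
have PA j : j \in w -> (P (A j) <= ((1 + eps) * (alpha / k%:R) + (p * n)%:R^-1)%:E)%E.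
  move=> jw.
  have := tail d T P n p theta0 thetabar thetahat Z r Zhat B delta l x j (A j) n0 B1 appr cM
    (null j jw) xM c1 l0 delta0 c2 dl (mA j).
  move=> /(_ _)/le_trans; apply.
    move=> y [[/= hx /negP h1] /negP h2]; split => //.
      move: h1; rewrite -leNgt; apply: le_trans.
      by rewrite /max_coord; exact: (le_bigmax _ (fun j => `|tnth (r y) j|)).
    rewrite expr_div_n; move: h2; rewrite -leNgt; apply: le_trans.
    rewrite /max_coord.
    exact: (le_bigmax _ (fun j => emp_mean (fun i => (tnth (Zhat i y) j - tnth (Z i y) j) ^+ 2))).
  rewrite lee_fin /x Phi_bar_Phi_inv; last exact: level_in01.
  rewrite lerD2l; apply: (le_trans c3); rewrite expRN lnK//.
  by rewrite posrE ltr0n muln_gt0 p0.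
have EU : E `<=` E1 `|` E2 `|` \big[setU/set0]_(j <- index_enum _ | j \in w) A j.
  move=> y /hE[j jw hj].
  have [h1|h1] := pselect (E1 y); first by left; left.
  have [h2|h2] := pselect (E2 y); first by left; right.
  right; rewrite -bigcup_seq_cond; exists j => //=.
  by rewrite mem_index_enum.
have mU : measurable (\big[setU/set0]_(j <- index_enum _ | j \in w) A j).
  exact: bigsetU_measurable.
have := measure_le_setU2 mE mE1 mE2 mU EU A1 A2 (measure_bigsetU_le (index_enum _) mA PA).
move=> /le_trans; apply; rewrite lee_fin.
rewrite addrC; apply: lerD; last by lra.
rewrite sumr_const -[X in X <= _]mulr_natl mulrDr.
have wkR : #|w|%:R <= k%:R :> R by rewrite ler_nat.
apply: lerD.
  rewrite mulrCA [X in _ <= X]mulrC ler_pM2l; last by lra.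
  by rewrite mulrCA ler_piMr ?(ltW a0)// ler_pdivrMr ?mul1r.
rewrite natrM invfM mulrA ler_piMl ?invr_ge0 ?(ltW nR)//.
by rewrite ler_pdivrMr// mul1r (le_trans wkR)// ler_nat.
Qed.

End fwer.

(** * Strong control *)

(** The definition of true_null_class puts P in the class Pc only through one of
    its members j; for w empty there is nothing to reject. *)
Lemma sup_fwer_le (R : realType) (p : nat) d (T : measurableType d)
    (Pc : set (probability T R)) (theta0 : probability T R -> p.-tuple R)
    (thetabar : p.-tuple R) (t : T -> 'I_p -> R) (proc : procedure R p) (b : R) :
  0 <= b ->
  (forall w P, w != finset.set0 -> Pc P ->
     (forall j, j \in w -> tnth (theta0 P) j <= tnth thetabar j) ->
     (P [set x | exists2 j, j \in w & proc (t x) j] <= b%:E)%E) ->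
  (sup_fwer Pc theta0 thetabar t proc <= b%:E)%E.
Proof.
move=> b0 h; apply: ge_ereal_sup => _ [w _ <-]; apply: ge_ereal_sup => _ [P [Pw _] <-].
have [w0|w0] := eqVneq w finset.set0.
  rewrite (_ : [set x | _] = set0) ?measure0 ?lee_fin//.
  by apply/seteqP; split => // x /= [j]; rewrite w0 inE.
have [j0 j0w] := set0Pn _ w0.
apply: h => // [|j jw]; first by have [] := Pw j0 j0w.
by have [] := Pw j jw.
Qed.

Theorem theorem2p7 (R : realType) (alpha : R) (halpha : 0 < alpha < 1)
  (B delta beta : R^nat)
  (hB : forall n : nat, (0 < n)%N -> 1 <= B n)
  (hdelta : decreases_to0 delta) (hbeta : decreases_to0 beta)
  (p : nat -> nat) (hp : forall n : nat, (0 < n)%N -> (0 < p n)%N)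
  (d : nat -> measure_display)
  (Omega : forall n : nat, measurableType (d n))
  (Pc : forall n : nat, set (probability (Omega n) R))
  (theta0 : forall n : nat, probability (Omega n) R -> (p n).-tuple R)
  (thetabar : forall n : nat, (p n).-tuple R)
  (thetahat : forall n : nat, {mfun Omega n >-> (p n).-tuple R})
  (Z : forall (n : nat) (P : probability (Omega n) R),
         'I_n -> {RV P >-> (p n).-tuple R})
  (r : forall (n : nat) (P : probability (Omega n) R),
         {RV P >-> (p n).-tuple R})
  (Zhat : forall n : nat, 'I_n -> {mfun Omega n >-> (p n).-tuple R})
  (hsetting : forall n : nat, (0 < n)%N -> forall P, Pc n P ->
     approximate_means (theta0 n P) (thetahat n) (Z n P) (r n P))
  (hM : forall n : nat, (0 < n)%N -> forall P, Pc n P ->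
     condition_M (Z n P) (B n))
  (hA : forall n : nat, (0 < n)%N -> forall P, Pc n P ->
     condition_A (Z n P) (Zhat n) (r n P) (delta n) (beta n))
  (hgrowth : forall n : nat, (0 < n)%N ->
     (2 * Num.sqrt 2) ^+ 3 * B n * (ln (p n * n)%:R `^ (3 / 2)) /
       Num.sqrt n%:R <= delta n) :
  le_add_o1 (fun n => sup_fwer (Pc n) (theta0 n) (thetabar n)
      (t_stat (thetahat n) (thetabar n) (Zhat n))
      (bonferroni alpha)) alpha /\
  le_add_o1 (fun n => sup_fwer (Pc n) (theta0 n) (thetabar n)
      (t_stat (thetahat n) (thetabar n) (Zhat n))
      (bonferroni_holm alpha)) alpha.
Proof.
(* Both procedures satisfy the following with k the number of tests that the
   critical value accounts for: k = p, and k = #|w|. *)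
have control (proc : forall n, procedure R (p n)) (k : forall n, {set 'I_(p n)} -> nat) :
    (forall n w, w != finset.set0 -> (#|w| <= k n w)%N && (0 < k n w <= p n)%N) ->
    (forall n w t, w != finset.set0 -> (exists2 j, j \in w & proc n t j) ->
       exists2 j, j \in w & Phi_inv (1 - alpha / (k n w)%:R) < t j) ->
    (forall n (t : Omega n -> 'I_(p n) -> R),
       (forall (a : R) j, measurable [set x | a < t x j]) ->
       forall w : {set _}, measurable [set x | exists2 j, j \in w & proc n (t x) j]) ->
    le_add_o1 (fun n => sup_fwer (Pc n) (theta0 n) (thetabar n)
      (t_stat (thetahat n) (thetabar n) (Zhat n)) (proc n)) alpha.
  move=> hk hproc mproc.
  have mE n w := mproc n _ (measurable_reject (thetahat n) (thetabar n) (Zhat n)) w.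
  apply: le_add_o1_of_eventually => [n n0|eps0 eps00].
    by apply: sup_fwer_le => // w P _ _ _; apply: probability_le1; exact: mE.
  pose eps := Num.min 1 (eps0 / 4).
  have e40 : 0 < eps0 / 4 by lra.
  have eps01 : 0 < eps <= 1 by rewrite lt_min ltr01 e40 ge_min lexx.
  have eps4 : eps <= eps0 / 4 by rewrite ge_min lexx orbT.
  have [delta0 delta00 bound] := fwer_bound halpha eps01.
  have /cvgrPdist_le/(_ _ delta00)[N1 _ hN1] := hdelta.2.
  have /cvgrPdist_le/(_ _ e40)[N2 _ hN2] := hbeta.2.
  have /cvgrPdist_le/(_ _ e40)[N3 _ hN3] := (@cvg_harmonic R).
  exists (maxn (maxn 3 N1) (maxn N2 N3.+1)) => n.
  rewrite !geq_max => /andP[/andP[n3 n1] /andP[n2 n4]].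
  have n0 : (0 < n)%N by exact: leq_trans n3.
  have := hN1 n n1; rewrite sub0r normrN => /ler_normlW dn.
  have := hN2 n n2; rewrite sub0r normrN => /ler_normlW bn.
  have := hN3 n.-1; rewrite /= sub0r normrN prednK// -ltnS prednK// => /(_ n4)/ler_normlW in_.
  have alpha_eps : alpha * (1 + eps) <= alpha + eps0 / 4.
    have /andP[a0 a1] := halpha; have /andP[e0 _] := eps01.
    rewrite mulrDr mulr1 lerD2l (le_trans _ eps4)// ler_piMl ?(ltW e0) ?(ltW a1)//.
  apply: sup_fwer_le => [|w P w0 PcP null].
    by have /andP[a0 _] := halpha; rewrite addr_ge0 ?(ltW a0) ?(ltW eps00).
  have /andP[wk k0] := hk n w w0.
  have crit x : [set x | exists2 j, j \in w & proc n (t_stat (thetahat n) (thetabar n) (Zhat n) x) j] x ->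
      exists2 j, j \in w &
        Phi_inv (1 - alpha / (k n w)%:R) < t_stat (thetahat n) (thetabar n) (Zhat n) x j.
    exact: hproc.
  have := bound _ _ _ _ _ _ _ _ _ _ _ _ _ _ _ _ _ n3 (hB n n0)
    (hsetting n n0 P PcP) (hM n n0 P PcP) (hA n n0 P PcP) (hgrowth n n0) dn null wk k0
    (mE n w) crit.
  by move=> /le_trans; apply; rewrite lee_fin; lra.
split.
- apply: (control _ (fun n _ => p n)) => [n w w0|n w t _ [j jw hj]|n t mt w].
  + have [j _] := set0Pn _ w0.
    rewrite -[leqRHS]card_ord max_card leqnn andbT/=.
    exact: leq_ltn_trans (ltn_ord j).
  + by exists j.
  + exact: measurable_threshold_event.
- apply: (control _ (fun n w => #|w|)) => [n w w0|n w t w0|n t mt w].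
  + by rewrite leqnn card_gt0 w0 /= -[leqRHS]card_ord max_card.
  + apply: stepdown_reject_true_null => W wW.
    have w1 : (0 < #|w|)%N by rewrite card_gt0.
    have wW1 := subset_leq_card wW.
    have /andP[b0 b1] := level_in01 halpha w1.
    have /andP[b0' b1'] := level_in01 halpha (leq_trans w1 wW1).
    have /andP[a0 _] := halpha.
    apply: Phi_inv_le; [lra|lra|].
    rewrite lerD2l lerN2 ler_pM2l// lef_pV2 ?posrE ?ltr0n ?(leq_trans w1)//.
    by rewrite ler_nat.
  + exact: measurable_stepdown_event.
Qed.
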